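(* Let $n\ge 1$ be an integer, $1<p<\infty$ and let $w$ be a parabolic $A_p$ weight on $\mathbb{R}^{n+1}$. Then there exist constants $\delta>0$, $c>0$ and, with $k=\frac{n+2}{n+1}+\delta$, an exponent $\gamma\in(1,k)$, all depending only on $n$, $p$ and $[w]_p$, such that the following holds for every $r>0$. If $u\in L^1((-r^2,r^2), W^1_1(K_r))$ with $Du\in L^p_w(Q_r,\mathbb{R}^n)$ is a distributional solution to $u_t=\mathrm{div}\,G$ in $Q_r$, where $G\in L^p_w(Q_r,\mathbb{R}^n)$, then $|u|^pw\in L^\gamma(Q_r)$ and $$\left(\frac{1}{|Q_r|}\int_{Q_r} \big[|u-(u)_{Q_r}|^{p}\,w\big]^{\gamma}\,dz \right)^{\frac{1}{p\gamma}} \le c \, r \left(\frac{1}{|Q_r|}\int_{Q_r}\left[|Du|^p+|G|^p\right]w\,dz\right)^{\frac{1}{p}}.$$ Moreover, the same statement holds true if the cube $K_r$ and the parabolic cube $Q_r$ are replaced throughout by the ball $B_r$ and the parabolic cylinder $C_r$, respectively.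
   Context: Points of $\mathbb{R}^{n+1}=\mathbb{R}^n\times\mathbb{R}$ are written $z=(x,t)$, $dz=dx\,dt$. For $r>0$ and $z=(x,t)$: $K_r(x)=\{y\in\mathbb{R}^n:|x_i-y_i|<r,\ i=1,\dots,n\}$ and $B_r(x)=\{y\in\mathbb{R}^n:|x-y|<r\}$ (Euclidean norm); the parabolic cube is $Q_r(z)=K_r(x)\times(t-r^2,t+r^2)$ and the parabolic cylinder is $C_r(z)=B_r(x)\times(t-r^2,t+r^2)$. When the center is the origin it is omitted: $K_r,B_r,Q_r,C_r$. $Du=D_xu$ is the spatial gradient and $\mathrm{div}=\mathrm{div}_x$ the spatial divergence. $(g)_U=\frac1{|U|}\int_U g\,dz$. A weight $w$ is a nonnegative locally integrable function on $\mathbb{R}^{n+1}$. For $1<p<\infty$ it is a parabolic $A_p$ weight if $$[w]_p:=\sup_Q\Big(\frac1{|Q|}\int_Q w\,dz\Big)\Big(\frac1{|Q|}\int_Q w^{-\frac1{p-1}}\,dz\Big)^{p-1}<\infty,$$ the supremum over all parabolic cubes $Q=Q_s(z)\subset\mathbb{R}^{n+1}$; both averages are finite, so $w>0$ a.e. $L^p_w(U)$ is the space of measurable functions $f$ on $U$ with $\int_U|f|^pw\,dz<\infty$; $L^p_w(U,\mathbb{R}^n)$ is the $\mathbb{R}^n$-valued version. For an open set $\Omega\subset\mathbb{R}^n$ and an interval $I$, $u\in L^1(I,W^1_1(\Omega))$ means that $u(\cdot,t)\in W^1_1(\Omega)$ (i.e. $u(\cdot,t)$ and its weak gradient lie in $L^1(\Omega)$)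 for a.e. $t\in I$, and $u,Du\in L^1(\Omega\times I)$. Such a $u$ is a distributional solution of $u_t=\mathrm{div}\,G$ in $\Omega\times I$ (with $G\in L^1(\Omega\times I,\mathbb{R}^n)$) if $\int_{\Omega\times I}u\,\varphi_t\,dz=\int_{\Omega\times I}G\cdot D_x\varphi\,dz$ for all $\varphi\in C_0^\infty(\Omega\times I)$. *)

(* Defs.v *)
From HB Require Import structures.
From mathcomp Require Import all_boot all_order all_algebra.
From mathcomp Require Import all_classical all_reals all_analysis.

Set Implicit Arguments.
Unset Strict Implicit.
Unset Printing Implicit Defensive.

Import Order.TTheory GRing.Theory Num.Theory.
Import numFieldNormedType.Exports.

Local Open Scope classical_set_scope.
Local Open Scope ring_scope.

(* Row vectors carry the product sigma-algebra generated by the coordinates, as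
   tuples do in the library; for 'rV[R]_n over a realType this is the Borel
   sigma-algebra. *)
Definition measure_rV_display : measure_display -> measure_display.
Proof. exact. Qed.

Section measurable_rV.
Context {d} {T : measurableType d} (n : nat).

Let coord (i : 'I_n) (x : 'rV[T]_n) : T := x ord0 i.

Let rV_set0 : g_sigma_preimage coord set0.
Proof. exact: sigma_algebra0. Qed.

Let rV_setC A : g_sigma_preimage coord A -> g_sigma_preimage coord (~` A).
Proof. exact: sigma_algebraC. Qed.

Let rV_bigcup (F : _^nat) : (forall i, g_sigma_preimage coord (F i)) ->
  g_sigma_preimage coord (\bigcup_i (F i)).
Proof. exact: sigma_algebra_bigcup. Qed.

HB.instance Definition _ := @isMeasurable.Build (measure_rV_display d)
  'rV[T]_n (g_sigma_preimage coord) rV_set0 rV_setC rV_bigcup.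

End measurable_rV.

Section measurable_fun_rV.
Context d d' (T : measurableType d) (T' : measurableType d') (n : nat).

Lemma measurable_coord (i : 'I_n) :
  measurable_fun [set: 'rV[T]_n] (fun x : 'rV[T]_n => x ord0 i).
Proof.
move=> _ Y mY; rewrite setTI; apply: sub_sigma_algebra => /=.
rewrite -bigcup_seq/=; exists i => /=; first by rewrite mem_index_enum.
by exists Y => //; rewrite setTI.
Qed.

Lemma measurable_fun_rV (f : T' -> 'rV[T]_n) :
  (forall i, measurable_fun [set: T'] (fun x => f x ord0 i)) ->
  measurable_fun [set: T'] f.
Proof.
move=> mf _ A mA; rewrite setTI.
suff: g_sigma_preimage (fun i : 'I_n => (fun x : 'rV[T]_n => x ord0 i) \o f)
    `<=` @measurable _ T'.
  rewrite g_sigma_preimage_comp; apply; exists A => //.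
  by rewrite setTI.
apply: smallest_sub; first exact: sigma_algebra_measurable.
move=> B; rewrite -bigcup_seq => -[i _ [C mC <-]].
exact: mf.
Qed.

End measurable_fun_rV.

Lemma product_measure1_sigma_finite d1 d2 (T1 : measurableType d1)
    (T2 : measurableType d2) (R : realType)
    (m1 : {sigma_finite_measure set T1 -> \bar R})
    (m2 : {sigma_finite_measure set T2 -> \bar R}) :
  sigma_finite setT (m1 \x m2)%E.
Proof.
have /sigma_finiteP[F [TF ndF Foo]] := sigma_finiteT m1.
have /sigma_finiteP[G [TG ndG Goo]] := sigma_finiteT m2.
exists (fun n => F n `*` G n).
  rewrite -setXTT TF TG predeqE => -[x y]; split.
    move=> [/= [n _ Fnx] [k _ Gky]]; exists (maxn n k) => //; split.
    - by move: x Fnx; exact/subsetPset/ndF/leq_maxl.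
    - by move: y Gky; exact/subsetPset/ndG/leq_maxr.
  by move=> [n _ []/= ? ?]; split; exists n.
move=> k; have [? ?] := Foo k; have [? ?] := Goo k.
split; first exact: measurableX.
by rewrite product_measure1E// lte_mul_pinfty// ge0_fin_numE.
Qed.

Definition rV_cons (T : Type) (n : nat) (ax : T * 'rV[T]_n) : 'rV[T]_n.+1 :=
  \row_j oapp (ax.2 ord0) ax.1 (unlift ord0 j).

Section lebesgue_measure_rV.
Context (R : realType).

Lemma measurable_rV_cons n :
  measurable_fun [set: (R * 'rV[R]_n)%type] (@rV_cons R n).
Proof.
apply: measurable_fun_rV => i.
case: (unliftP ord0 i) => [j|] ->.
- under eq_fun do rewrite mxE liftK.
  exact: measurableT_comp (measurable_coord (T := R) j) measurable_snd.
- under eq_fun do rewrite mxE unlift_none.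
  exact: measurable_fst.
Qed.

Let rV_uncons n (x : 'rV[R]_n.+1) : R * 'rV[R]_n :=
  (x ord0 ord0, \row_j x ord0 (lift ord0 j)).

Let rV_consK n : cancel (@rV_cons R n) (@rV_uncons n).
Proof.
move=> [a x]; rewrite /rV_uncons mxE unlift_none; congr (_, _).
by apply/rowP => j; rewrite !mxE liftK.
Qed.

Let measurable_rV_uncons n : measurable_fun setT (@rV_uncons n).
Proof.
apply/measurable_fun_pairP; split; first exact: (measurable_coord (T := R) ord0).
apply: measurable_fun_rV => i; rewrite /rV_uncons /=.
under eq_fun do rewrite mxE.
exact: (measurable_coord (T := R) (lift ord0 i)).
Qed.

Section step.
Context (n : nat) (mu : {sigma_finite_measure set 'rV[R]_n -> \bar R}).

Definition lebesgue_rV_step : set 'rV[R]_n.+1 -> \bar R :=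
  pushforward (@lebesgue_measure R \x mu)%E (@rV_cons R n).

Let step0 : lebesgue_rV_step set0 = 0%E.
Proof. by rewrite /lebesgue_rV_step /pushforward preimage_set0 measure0. Qed.

Let step_ge0 A : (0 <= lebesgue_rV_step A)%E.
Proof. exact: (measure_ge0 (@lebesgue_measure R \x mu)%E). Qed.

Let step_sigma_additive : semi_sigma_additive lebesgue_rV_step.
Proof.
have mcons A : measurable A -> measurable (@rV_cons R n @^-1` A).
  by rewrite -[X in _ -> measurable X]setTI; exact: measurable_rV_cons.
move=> F mF tF mUF; rewrite /lebesgue_rV_step /pushforward preimage_bigcup.
apply: measure_semi_sigma_additive => [k||].
- exact: mcons.
- apply/trivIsetP => /= i j _ _ ij; rewrite -preimage_setI.
  by move/trivIsetP : tF => /(_ _ _ _ _ ij) ->//; rewrite preimage_set0.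
- by rewrite -preimage_bigcup; exact: mcons.
Qed.

HB.instance Definition _ := isMeasure.Build _ _ _ lebesgue_rV_step
  step0 step_ge0 step_sigma_additive.

Let step_sigma_finite : sigma_finite setT lebesgue_rV_step.
Proof.
have [F FT mF] := product_measure1_sigma_finite (@lebesgue_measure R) mu.
exists (fun k => @rV_uncons n @^-1` F k).
  by rewrite -preimage_bigcup -FT preimage_setT.
move=> k; have [mFk Fk] := mF k; split.
  by rewrite -[X in measurable X]setTI; exact: measurable_rV_uncons.
rewrite /lebesgue_rV_step /pushforward -comp_preimage.
by rewrite (_ : _ \o _ = id) //; apply/funext => x /=; rewrite rV_consK.
Qed.

HB.instance Definition _ := @Measure_isSigmaFinite.Build _ _ _
  lebesgue_rV_step step_sigma_finite.

End step.

(* n-dimensional Lebesgue measure, as an iterated product of the one on R *)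
Fixpoint lebesgue_rV (n : nat) :
    {sigma_finite_measure set 'rV[R]_n -> \bar R} :=
  if n is m.+1 then lebesgue_rV_step (lebesgue_rV m)
  else \d_(0 : 'rV[R]_0).

Definition lebesgue_spacetime (n : nat) : set ('rV[R]_n * R)%type -> \bar R :=
  (lebesgue_rV n \x @lebesgue_measure R)%E.

Section spacetime.
Context (n : nat).

Let spacetime0 : @lebesgue_spacetime n set0 = 0%E.
Proof. exact: (measure0 (lebesgue_rV n \x @lebesgue_measure R)%E). Qed.

Let spacetime_ge0 A : (0 <= @lebesgue_spacetime n A)%E.
Proof. exact: (measure_ge0 (lebesgue_rV n \x @lebesgue_measure R)%E). Qed.

Let spacetime_sigma_additive : semi_sigma_additive (@lebesgue_spacetime n).
Proof.
exact: (@measure_semi_sigma_additive _ _ _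
  (lebesgue_rV n \x @lebesgue_measure R)%E).
Qed.

HB.instance Definition _ := isMeasure.Build _ _ _ (@lebesgue_spacetime n)
  spacetime0 spacetime_ge0 spacetime_sigma_additive.

HB.instance Definition _ := @Measure_isSigmaFinite.Build _ _ _
  (@lebesgue_spacetime n)
  (product_measure1_sigma_finite (lebesgue_rV n) (@lebesgue_measure R)).

End spacetime.

End lebesgue_measure_rV.

Section averages_and_spaces.
Context d (T : measurableType d) (R : realType) (mu : set T -> \bar R).

(* The measurable sets on R and 'rV[R]_n are the Borel sets; Lebesgue
   measurability, i.e. measurability for the completed sigma-algebra, is equality
   almost everywhere with a Borel function.  The library integral of such a
   function with respect to the Borel-Lebesgue measure is its Lebesgue integral. *)
Definition ae_measurable (D : set T) (f : T -> R) : Prop :=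
  exists2 g : T -> R,
    measurable_fun D g & {ae mu, forall z, D z -> f z = g z}.

Definition mean (D : set T) (f : T -> \bar R) : \bar R :=
  (((fine (mu D))^-1)%:E * \int[mu]_(z in D) f z)%E.

Definition in_Lp (q : R) (D : set T) (f : T -> R) : Prop :=
  ae_measurable D f /\ (\int[mu]_(z in D) (`|f z| `^ q)%:E < +oo)%E.

Definition in_Lp_rV (n : nat) (q : R) (D : set T) (F : T -> 'rV[R]_n) : Prop :=
  forall i, in_Lp q D (fun z => F z ord0 i).

End averages_and_spaces.

(* The library norm on 'rV[R]_n is the sup norm. *)
Definition enorm (R : realType) (n : nat) (x : 'rV[R]_n) : R :=
  Num.sqrt (\sum_(i < n) x ord0 i ^+ 2).

Definition in_Lpw_rV d (T : measurableType d) (R : realType)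
    (mu : set T -> \bar R) (n : nat) (q : R) (w : T -> R) (D : set T)
    (F : T -> 'rV[R]_n) : Prop :=
  (forall i, ae_measurable mu D (fun z => F z ord0 i)) /\
  (\int[mu]_(z in D) (enorm (F z) `^ q * w z)%:E < +oo)%E.

Section smooth.
Context (R : realType) (V : normedModType R).

Fixpoint iter_derive (vs : seq V) (f : V -> R) : V -> R :=
  if vs is v :: vs' then 'D_v (iter_derive vs' f) else f.

Definition smooth (f : V -> R) : Prop :=
  forall vs : seq V, continuous (iter_derive vs f) /\
    forall x v, derivable (iter_derive vs f) x v.

Definition test_function (U : set V) (f : V -> R) : Prop :=
  let supp := closure [set x | f x != 0] in
  [/\ smooth f, compact supp & supp `<=` U].

End smooth.

Section geometry.
Context (R : realType) (n : nat).

Definition cube (x : 'rV[R]_n) (r : R) : set 'rV[R]_n :=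
  [set y | forall i, `|x ord0 i - y ord0 i| < r].

Definition eball (x : 'rV[R]_n) (r : R) : set 'rV[R]_n :=
  [set y | enorm (x - y) < r].

Definition time_interval (t r : R) : set R := `]t - r ^+ 2, t + r ^+ 2[.

Definition pcube (z : 'rV[R]_n * R) (r : R) : set ('rV[R]_n * R)%type :=
  cube z.1 r `*` time_interval z.2 r.

End geometry.

Section weights.
Context (R : realType) (n : nat).
Let mu := @lebesgue_spacetime R n.
Implicit Type w : 'rV[R]_n * R -> R.

Definition weight w : Prop :=
  [/\ ae_measurable mu setT w, forall z, 0 <= w z &
      forall K, compact K -> (\int[mu]_(z in K) (w z)%:E < +oo)%E].

(* w^(-1/(p-1)), infinite where w vanishes (whereas 0 `^ a = 0 for a < 0) *)
Definition dual_weight (p : R) w (z : 'rV[R]_n * R) : \bar R :=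
  if w z == 0 then +oo%E else (w z `^ (- (p - 1)^-1))%:E.

Definition Ap_const (p : R) w : \bar R :=
  ereal_sup [set (mean mu (pcube zs.1 zs.2) (EFin \o w) *
                  poweR (mean mu (pcube zs.1 zs.2) (dual_weight p w)) (p - 1))%E
            | zs in [set zs : ('rV[R]_n * R) * R | 0 < zs.2]].

(* Finiteness of the second average has to be required apart: since 0 * +oo = 0,
   the product would not detect a weight vanishing on a whole cube. *)
Definition Ap_weight (p : R) w : Prop :=
  [/\ weight w,
      forall z s, 0 < s -> (mean mu (pcube z s) (dual_weight p w) < +oo)%E &
      (Ap_const p w < +oo)%E].

End weights.

Section sobolev_and_solutions.
Context (R : realType) (n : nat).
Implicit Types (Omega : set 'rV[R]_n) (I : set R).

Let e (i : 'I_n) : 'rV[R]_n := delta_mx ord0 i.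

Definition weak_gradient Omega (f : 'rV[R]_n -> R) (Df : 'rV[R]_n -> 'rV[R]_n)
    : Prop :=
  forall phi, test_function Omega phi -> forall i,
    \int[lebesgue_rV R n]_(x in Omega) (f x * 'D_(e i) phi x) =
    - \int[lebesgue_rV R n]_(x in Omega) (Df x ord0 i * phi x).

Definition in_W11 Omega (f : 'rV[R]_n -> R) (Df : 'rV[R]_n -> 'rV[R]_n) : Prop :=
  [/\ in_Lp (lebesgue_rV R n) 1 Omega f, in_Lp_rV (lebesgue_rV R n) 1 Omega Df &
      weak_gradient Omega f Df].

(* u is in L^1(I, W^1_1(Omega)) with spatial gradient Du *)
Definition in_L1_W11 I Omega (u : 'rV[R]_n * R -> R)
    (Du : 'rV[R]_n * R -> 'rV[R]_n) : Prop :=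
  [/\ {ae @lebesgue_measure R, forall t, I t ->
        in_W11 Omega (fun x => u (x, t)) (fun x => Du (x, t))},
      in_Lp (@lebesgue_spacetime R n) 1 (Omega `*` I) u &
      in_Lp_rV (@lebesgue_spacetime R n) 1 (Omega `*` I) Du].

(* u_t = div G in Q, in the sense of distributions *)
Definition distributional_solution (Q : set ('rV[R]_n * R)%type)
    (u : 'rV[R]_n * R -> R) (G : 'rV[R]_n * R -> 'rV[R]_n) : Prop :=
  in_Lp_rV (@lebesgue_spacetime R n) 1 Q G /\
  forall phi, test_function Q phi ->
    \int[@lebesgue_spacetime R n]_(z in Q) (u z * 'D_(0, 1) phi z) =
    \int[@lebesgue_spacetime R n]_(z in Q)
      (\sum_(i < n) G z ord0 i * 'D_(e i, 0) phi z).

End sobolev_and_solutions.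

(* Main.v *)
Require Import Defs.
From mathcomp Require Import all_boot all_order all_algebra.
From mathcomp Require Import all_classical all_reals all_analysis.
From mathcomp Require Import measurable_realfun.
From mathcomp Require Import ring lra.

(* Since delta is free, it suffices to find some gamma > 1.  Average u against a
   product bump function of relative width l, centred at the contraction of z by
   the factor 1 - l towards the centre of the cylinder (1 - l^2 in time).  Halving
   the scale of one coordinate changes this average by the integral of u against
   a derivative of a test function, which the weak equations bound by l r times an
   average of H = |Du| + |G| over a parabolic cube of radius 2 l r around z.  At
   scale l = 1 the average is a constant c, and as l -> 0 it converges to u; so
   |u - c| is dominated by a sum over the dyadic scales of averages of H.  Each of
   them is controlled by the weighted L^p norm of H through the A_p condition, and
   the reverse Hoelder inequality for w, obtained by a stopping time argument on
   repeatedly bisected parabolic cubes, gives the integrability of the gamma-th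
   powers; the series converges when gamma is close to 1.  Replacing c by the
   mean of u costs a constant, again by the A_p condition. *)

Import Order.TTheory GRing.Theory Num.Theory.
Import numFieldNormedType.Exports.

Local Open Scope classical_set_scope.
Local Open Scope ring_scope.

Set Implicit Arguments.
Unset Strict Implicit.
Unset Printing Implicit Defensive.

(** * Approximate identities *)

(** The kernels are products because two product kernels that differ in one coordinate differ by a
    derivative in that coordinate: replace the factor there by the difference of two primitives.
    These primitives agree off a bounded interval, so the result is a test function. Their
    difference is bounded by 1, whereas a kernel factor is as large as its inverse width; this is
    the gain of [l * r] in space. In time the gain is the square of [l * r], and one power pays for
    the spatial derivative that u_t = div G puts on another factor. Contracting towards the centre
    keeps all supports inside the domain, for balls as for cubes, so that [u] is never extended.
    Against this gain, raising averages over cubes of radius l r to the power p gamma costs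
    l^(-(n+2)(gamma-1)), a small loss for gamma near 1. Both limits, that of the bump averages and
    that of the averages over bisected boxes, are taken at the level of integrals: averages converge
    in L1, a subsequence converges almost everywhere, and Fatou's lemma carries over bounds uniform
    in the scale. *)

Section integral_complements.
Local Open Scope ereal_scope.
Context d (T : measurableType d) (R : realType) (mu : {measure set T -> \bar R}).

(* No measurability is needed: for nonnegative functions the integral is a
   supremum over simple functions. *)
Lemma ge0_le_integral_nomeas (D : set T) (f g : T -> \bar R) :
  (forall x, D x -> 0 <= f x) -> (forall x, D x -> f x <= g x) ->
  \int[mu]_(x in D) f x <= \int[mu]_(x in D) g x.
Proof.
move=> f0 fg.
have g0 x : D x -> 0 <= g x by move=> Dx; exact: le_trans (f0 _ Dx) (fg _ Dx).
rewrite !ge0_integralE//; apply: ereal_sup_le => _ [h hf <-].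
exists h => // x; apply: (le_trans (hf x)).
by rewrite /patch; case: ifPn => //; rewrite inE; exact: fg.
Qed.

End integral_complements.

Section tonelli.
Local Open Scope ereal_scope.
Context d1 d2 (T1 : measurableType d1) (T2 : measurableType d2) (R : realType)
  (m1 : {sigma_finite_measure set T1 -> \bar R})
  (m2 : {sigma_finite_measure set T2 -> \bar R}) (F : T1 -> T2 -> \bar R).
Hypothesis mF : measurable_fun [set: T1 * T2] (fun z : T1 * T2 => F z.1 z.2).
Hypothesis F0 : forall x y, 0 <= F x y.

Lemma measurable_integral_snd : measurable_fun setT (fun x => \int[m2]_y F x y).
Proof. exact: (measurable_fun_fubini_tonelli_F _ mF (fun z => F0 z.1 z.2)). Qed.

Lemma tonelli_swap :
  \int[m1]_x \int[m2]_y F x y = \int[m2]_y \int[m1]_x F x y.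
Proof. exact: (fubini_tonelli _ mF (fun z => F0 z.1 z.2)). Qed.

Lemma measurable_Rintegral_snd (G : T1 -> T2 -> R) :
  measurable_fun [set: T1 * T2] (fun z : T1 * T2 => G z.1 z.2) ->
  measurable_fun setT (fun x => \int[m2]_y (G x y))%R.
Proof.
move=> mG.
pose H (z : T1 * T2) := (G z.1 z.2)%:E.
have mH : measurable_fun [set: T1 * T2] H by exact/measurable_EFinP.
apply: (@measurableT_comp _ _ _ _ _ _ (fine : \bar R -> R)) => //.
under eq_fun do rewrite integralE.
apply: emeasurable_funB.
- rewrite (_ : (fun x => _) = fubini_F m2 H^\+); last first.
    by apply/funext => x; apply: eq_integral => y _; rewrite !funeposE.
  apply: measurable_fun_fubini_tonelli_F => //.
  exact: measurable_funepos.
- rewrite (_ : (fun x => _) = fubini_F m2 H^\-); last first.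
    by apply/funext => x; apply: eq_integral => y _; rewrite !funenegE.
  apply: measurable_fun_fubini_tonelli_F => //.
  exact: measurable_funeneg.
Qed.

End tonelli.

Lemma measurable_fun_powR d (T : measurableType d) (R : realType) (D : set T)
    (f : T -> R) (q : R) :
  measurable_fun D f -> measurable_fun D (fun x => f x `^ q).
Proof. by move=> mf; exact: (measurableT_comp (@measurable_powR R q) mf). Qed.

(** For a > 0 the power is exp(q ln x), which is continuous. This formula fails at 0, where
    monotonicity and the radius e^(1/q) are used instead. *)
Lemma cvgn_powR (R : realType) (q a : R) (u : nat -> R) : 0 < q ->
  (forall k, 0 <= u k) -> u @ \oo --> a -> (fun k => u k `^ q) @ \oo --> a `^ q.
Proof.
move=> q0 u0 ua.
have a0 : 0 <= a.
  rewrite -(cvg_lim _ ua)//; apply: limr_ge; last exact: nearW.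
  by apply/cvg_ex; exists a.
move: a0; rewrite le_eqVlt => /predU1P[a0|a0].
  rewrite -a0 powR0 ?gt_eqF//; rewrite -a0 in ua.
  apply/cvgrPdist_le => e e0.
  have e1 : 0 < e `^ q^-1 by rewrite powR_gt0.
  move/cvgrPdist_le : ua => /(_ _ e1); apply: filterS => k.
  rewrite !sub0r !normrN !ger0_norm ?powR_ge0// => uk.
  have := ge0_ler_powR (ltW q0) _ _ uk; rewrite !nnegrE powR_ge0 u0 => /(_ isT isT).
  by rewrite -powRrM mulVf ?gt_eqF// (powRr1 (ltW e0)).
have ca : {for a, continuous (fun x => expR (q * ln x))}.
  apply: continuous_comp; last exact: continuous_expR.
  by apply: continuousM; [exact: cst_continuous|exact: continuous_ln].
have := cvg_comp _ _ ua ca.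
rewrite {2}/powR gt_eqF//; apply: cvg_trans.
apply: near_eq_cvg; near=> k => /=; rewrite /powR gt_eqF//.
near: k; exact: (cvgr_gt a).
Unshelve. all: by end_near. Qed.

Section L1_fatou.
Local Open Scope ereal_scope.
Context d (T : measurableType d) (R : realType) (mu : {measure set T -> \bar R}).
Context (D : set T) (g : nat -> T -> R) (f v : T -> R) (c q : R) (K : \bar R).
Hypothesis mD : measurable D.
Hypothesis mg : forall j, measurable_fun D (g j).
Hypothesis mf : measurable_fun D f.
Hypothesis mv : measurable_fun D v.
Hypothesis v_ge0 : forall z, D z -> (0 <= v z)%R.
Hypothesis q_gt0 : (0 < q)%R.
Hypothesis gf_L1 : forall e : R, (0 < e)%R -> exists J, forall j, (J <= j)%N ->
  \int[mu]_(z in D) `|g j z - f z|%:E <= e%:E.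

(* A subsequence converges in L1 fast enough to converge almost everywhere. *)
Lemma L1_cvg_powR_le :
  (forall j, \int[mu]_(z in D) (`|g j z - c| `^ q * v z)%:E <= K) ->
  \int[mu]_(z in D) (`|f z - c| `^ q * v z)%:E <= K.
Proof.
move=> gK.
have half_gt0 k : (0 < (2^-1 : R) ^+ k)%R by rewrite exprn_gt0// invr_gt0.
(* Errors at most 2^-k have a sum with finite integral, hence a sum that is finite almost
   everywhere. *)
have /choice[s Hs] : forall k, exists J, 
    \int[mu]_(z in D) `|g J z - f z|%:E <= ((2^-1 : R) ^+ k)%:E.
  by move=> k; have [J HJ] := gf_L1 (half_gt0 k); exists J; exact: HJ.
have mh k : measurable_fun D (fun z => `|g (s k) z - f z|%:E).
  by apply/measurable_EFinP; apply: measurableT_comp => //; exact: measurable_funB.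
have sumfin : \int[mu]_(z in D) (\sum_(k <oo) `|g (s k) z - f z|%:E) < +oo.
  rewrite integral_nneseries//.
  apply: (@le_lt_trans _ _ (\sum_(k <oo) ((2^-1 : R) ^+ k)%:E)).
    apply: lee_nneseries; last by move=> *; exact: Hs.
    by move=> *; apply: integral_ge0 => z _; rewrite lee_fin.
  have := @cvg_geometric_eseries_half R 2 0.
  rewrite (_ : (fun k => _) = (fun k => ((2^-1 : R) ^+ k)%:E)); last first.
    apply/funext => k; rewrite addn1 natrX exprS invfM mulrA divff// mul1r.
    by rewrite exprVn.
  by move=> /cvg_lim; rewrite /eseries => ->//; rewrite ltry.
have ae1 : {ae mu, forall z, D z -> (\sum_(k <oo) `|g (s k) z - f z|%:E) \is a fin_num}.
  apply: integrable_ae => //; apply/integrableP; split.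
    apply: ge0_emeasurable_sum => // k z _ _; rewrite lee_fin//.
  under eq_integral do rewrite gee0_abs ?nneseries_ge0//.
  exact: sumfin.
have mF k : measurable_fun D (fun z => (`|g (s k) z - c| `^ q * v z)%:E).
  apply/measurable_EFinP; apply: measurable_funM => //.
  apply: measurable_fun_powR.
  by apply: measurableT_comp => //; exact: measurable_funB.
have mF' : measurable_fun D (fun z => (`|f z - c| `^ q * v z)%:E).
  apply/measurable_EFinP; apply: measurable_funM => //.
  apply: measurable_fun_powR.
  by apply: measurableT_comp => //; exact: measurable_funB.
have F0 k z : D z -> 0 <= (`|g (s k) z - c| `^ q * v z)%:E.
  by move=> Dz; rewrite lee_fin mulr_ge0 ?powR_ge0 ?v_ge0.
apply: (@le_trans _ _ (\int[mu]_(z in D)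
    limn_einf (fun k => (`|g (s k) z - c| `^ q * v z)%:E))).
  apply: ae_ge0_le_integral => //.
  - by move=> z Dz; rewrite lee_fin mulr_ge0 ?powR_ge0 ?v_ge0.
  - move=> z Dz; rewrite limn_einf_lim; apply: lime_ge; first exact: is_cvg_einfs.
    by apply: nearW => k; apply: le_ereal_inf_tmp => _ [i _ <-]; exact: F0.
  - rewrite /limn_einf; apply: measurableT_comp => //.
    apply: (@measurable_fun_limn_esup _ _ _ _ (fun k z => - (`|g (s k) z - c| `^ q * v z)%:E)).
    by move=> k; exact: measurableT_comp.
  apply: filterS ae1 => z Hz Dz.
  have : (fun k => (`|g (s k) z - c| `^ q * v z)%:E) @ \oo -->
      (`|f z - c| `^ q * v z)%:E.
    apply: cvg_EFin; first by near=> k.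
    apply: cvgM; last exact: cvg_cst.
    apply: cvgn_powR => //; apply: cvg_norm; apply: cvgB; last exact: cvg_cst.
    have := Hz Dz; rewrite ge0_fin_numE ?nneseries_ge0// => Hlt.
    (* Each error is one term of a convergent series, so it is at most the tail, which tends to
       0. *)
    have Ht := nneseries_tail_cvg Hlt (fun k _ => ltac:(by rewrite lee_fin)).
    apply/cvgrPdist_le => e e0.
    move/fine_cvgP : Ht => [Ht1 /cvgrPdist_le /(_ _ e0) Ht2].
    near=> k.
    have H1 : \sum_(k <= i <oo) `|g (s i) z - f z|%:E \is a fin_num by near: k.
    have H2 : (`|0 - fine (\sum_(k <= i <oo) `|g (s i) z - f z|%:E)| <= e)%R.
      by near: k.
    rewrite -lee_fin; apply: (@le_trans _ _ (\sum_(k <= i <oo) `|g (s i) z - f z|%:E)).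
      have := @nneseries_lim_ge R (fun i => `|g (s i) z - f z|%:E) xpredT k k.+1
        (fun _ _ _ => ltac:(by rewrite lee_fin)).
      by rewrite big_nat1 distrC.
    rewrite -(fineK H1) lee_fin; apply: le_trans H2.
    by rewrite sub0r normrN ler_norm.
  by move=> /cvg_limn_einf_sup[-> _].
apply: le_trans (fatou mu mD mF F0) _.
rewrite limn_einf_lim; apply: lime_le; first exact: is_cvg_einfs.
near=> k; apply: le_trans (gK (s k)); apply: ereal_inf_lbound; exists k => //=.
Unshelve. all: by end_near.
Qed.

End L1_fatou.

Section approximate_identity.
Local Open Scope ereal_scope.
Context d (T : measurableType d) (R : realType)
  (mu : {sigma_finite_measure set T -> \bar R}).
Context (Ix : Type) (X : Ix -> T -> R) (D : set T)
  (kappa : nat -> T -> T -> R) (C : R) (eps : nat -> R).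
Hypothesis mX : forall i, measurable_fun [set: T] (X i).
Hypothesis mD : measurable D.
Hypothesis muD : mu D < +oo.
Hypothesis hyperplane0 : forall i a, mu (D `&` [set z | X i z = a]) = 0.
Hypothesis X_generate : forall G : set (set T), sigma_algebra setT G ->
  (forall i a, G [set z | (X i z < a)%R]) -> @measurable _ T `<=` G.
Hypothesis mk : forall j,
  measurable_fun [set: T * T] (fun zz : T * T => kappa j zz.1 zz.2).
Hypothesis k_ge0 : forall j z z', (0 <= kappa j z z')%R.
Hypothesis kD : forall j z z', kappa j z z' != 0%R -> D z /\ D z'.
Hypothesis k_int2 : forall j z, \int[mu]_z' (kappa j z z')%:E <= C%:E.
Hypothesis k_int1 : forall j z', \int[mu]_z (kappa j z z')%:E <= C%:E.
Hypothesis k_eps : forall j z z', kappa j z z' != 0%R ->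
  forall i, (`|X i z - X i z'| <= eps j)%R.
Hypothesis eps_small : forall e : R, (0 < e)%R ->
  exists J, forall j, (J <= j)%N -> (eps j <= e)%R.

Let C_ge0 : (0 <= C)%R.
Proof.
rewrite -lee_fin; apply: le_trans (k_int2 0%N point).
by apply: integral_ge0 => z _; rewrite lee_fin.
Qed.

(** When [kappa j z] has integral 1 for [z] in [D], this dominates the L1 distance on [D] from [f]
    to its kernel average. As an integral of nonnegative functions it is subadditive without any
    integrability, so the functions whose oscillation vanishes in the limit can be built up from
    indicators. *)
Definition kernel_osc (j : nat) (f : T -> R) : \bar R :=
  \int[mu]_z \int[mu]_z' (kappa j z z' * `|f z' - f z|)%:E.

Let mk1 j z : measurable_fun setT (kappa j z).
Proof. exact: (measurableT_comp (mk j) (pair1_measurable z)). Qed.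

Let mkf j (f : T -> R) : measurable_fun setT f ->
  measurable_fun [set: T * T]
    (fun zz : T * T => (kappa j zz.1 zz.2 * `|f zz.2 - f zz.1|)%:E).
Proof.
move=> mf; apply/measurable_EFinP; apply: measurable_funM => //.
apply: measurableT_comp => //; apply: measurable_funB.
  exact: measurableT_comp mf measurable_snd.
exact: measurableT_comp mf measurable_fst.
Qed.

Let mkf1 j (f : T -> R) z : measurable_fun setT f ->
  measurable_fun setT (fun z' => (kappa j z z' * `|f z' - f z|)%:E).
Proof.
by move=> mf; exact: (measurableT_comp (mkf j mf) (pair1_measurable z)).
Qed.

Let mosc j (f : T -> R) : measurable_fun setT f -> measurable_fun setT
  (fun z => \int[mu]_z' (kappa j z z' * `|f z' - f z|)%:E).
Proof.
move=> mf.
apply: (@measurable_integral_snd _ _ _ _ _ mu (fun z z' => (kappa j z z' * `|f z' - f z|)%:E)).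
  exact: mkf.
by move=> z z'; rewrite lee_fin mulr_ge0.
Qed.

Let inner_ge0 j (f : T -> R) z : 0 <= \int[mu]_z' (kappa j z z' * `|f z' - f z|)%:E.
Proof. by apply: integral_ge0 => z' _; rewrite lee_fin mulr_ge0. Qed.

Lemma kernel_osc_le (j : nat) (f g h : T -> R) :
  measurable_fun setT g -> measurable_fun setT h ->
  (forall z z', `|f z' - f z| <= `|g z' - g z| + `|h z' - h z|)%R ->
  kernel_osc j f <= kernel_osc j g + kernel_osc j h.
Proof.
move=> mg mh fgh; rewrite /kernel_osc -ge0_integralD//; [|exact: mosc..].
apply: ge0_le_integral_nomeas => // z _.
rewrite -ge0_integralD//; [|by move=> z' _; rewrite lee_fin mulr_ge0|exact: mkf1
  |by move=> z' _; rewrite lee_fin mulr_ge0|exact: mkf1].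
apply: ge0_le_integral_nomeas => z' _; rewrite lee_fin ?mulr_ge0//.
by rewrite -mulrDr ler_wpM2l.
Qed.

(** The two marginal bounds by [C] handle the two terms of |f z' - f z| <= |f z'| + |f z|, the first
    one after Tonelli. This stability in L1 is what makes density arguments possible. *)
Lemma kernel_osc_le_L1 (j : nat) (f : T -> R) : measurable_fun setT f ->
  kernel_osc j f <= (2 * C)%:E * \int[mu]_(z in D) `|f z|%:E.
Proof.
move=> mf.
have mfa : measurable_fun setT (fun z => `|f z|%R) by exact: measurableT_comp.
have mkk : measurable_fun [set: T * T]
    (fun zz : T * T => (kappa j zz.1 zz.2 * `|f zz.2|)%:E).
  apply/measurable_EFinP; apply: measurable_funM => //.
  exact: measurableT_comp mfa measurable_snd.
have mkk1 z : measurable_fun setT (fun z' => (kappa j z z' * `|f z'|)%:E).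
  exact: (measurableT_comp mkk (pair1_measurable z)).
have mkk2 z : measurable_fun setT (fun z' => (kappa j z z' * `|f z|)%:E).
  by apply/measurable_EFinP; apply: measurable_funM.
have kf0 z z' : 0 <= (kappa j z z' * `|f z'|)%:E by rewrite lee_fin mulr_ge0.
have mS : measurable_fun setT
    (fun z => \int[mu]_z' (kappa j z z' * `|f z'|)%:E).
  exact: (measurable_integral_snd mu mkk kf0).
have mS2 : measurable_fun setT
    (fun z => \int[mu]_z' (kappa j z z' * `|f z|)%:E).
  have mkk' : measurable_fun [set: T * T]
      (fun zz : T * T => (kappa j zz.1 zz.2 * `|f zz.1|)%:E).
    apply/measurable_EFinP; apply: measurable_funM => //.
    exact: measurableT_comp mfa measurable_fst.
  apply: (@measurable_integral_snd _ _ _ _ _ mu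
    (fun z z' => (kappa j z z' * `|f z|)%:E) mkk').
  by move=> z z'; rewrite lee_fin mulr_ge0.
have CDint : forall F : T -> \bar R, (forall z, ~ D z -> F z = 0) ->
    (forall z, 0 <= F z) ->
    (forall z, F z <= C%:E * `|f z|%:E) ->
    \int[mu]_z F z <= C%:E * \int[mu]_(z in D) `|f z|%:E.
  move=> F FD F0 Fle; rewrite -ge0_integralZl//; last first.
    by apply/measurable_EFinP; exact: measurable_funTS.
  rewrite [leRHS]integral_mkcond; apply: ge0_le_integral_nomeas => // z _.
  rewrite patchE; case: ifPn => [_|]; first exact: Fle.
  by rewrite notin_setE => /FD ->.
apply: (@le_trans _ _ (\int[mu]_z (\int[mu]_z' (kappa j z z' * `|f z'|)%:E +
    \int[mu]_z' (kappa j z z' * `|f z|)%:E))).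
  apply: ge0_le_integral_nomeas => // z _.
  rewrite -ge0_integralD//; last by move=> z' _; rewrite lee_fin mulr_ge0.
  apply: ge0_le_integral_nomeas => z' _; rewrite lee_fin ?mulr_ge0//.
  by rewrite -mulrDr ler_wpM2l// ler_normB.
rewrite ge0_integralD//; last 2 first.
- by move=> z _; apply: integral_ge0 => z' _; rewrite lee_fin mulr_ge0.
- by move=> z _; apply: integral_ge0 => z' _; rewrite lee_fin mulr_ge0.
rewrite mulrDl mul1r EFinD ge0_muleDl ?lee_fin//; apply: leeD.
- have -> : \int[mu]_z \int[mu]_z' (kappa j z z' * `|f z'|)%:E =
            \int[mu]_z' \int[mu]_z (kappa j z z' * `|f z'|)%:E.
    exact: (tonelli_swap mu mu mkk kf0).
  apply: CDint => [z' Dz'|z'|z'].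
  + apply: integral0_eq => z _; rewrite (_ : kappa j z z' = 0%R) ?mul0r//.
    by apply/eqP/negP => /negP/kD[].
  + by apply: integral_ge0 => z _; rewrite lee_fin mulr_ge0.
  + have mk2 : measurable_fun setT (fun z => kappa j z z').
      exact: (measurableT_comp (mk j) (pair2_measurable z')).
    under eq_integral do rewrite EFinM.
    rewrite ge0_integralZr//; last 2 first.
      exact/measurable_EFinP.
      by move=> z _; rewrite lee_fin.
    by apply: lee_wpmul2r; rewrite ?lee_fin.
- apply: CDint => [z Dz|z|z].
  + apply: integral0_eq => z' _; rewrite (_ : kappa j z z' = 0%R) ?mul0r//.
    by apply/eqP/negP => /negP/kD[].
  + by apply: integral_ge0 => z' _; rewrite lee_fin mulr_ge0.
  + under eq_integral do rewrite EFinM.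
    rewrite ge0_integralZr//; last 2 first.
      exact/measurable_EFinP.
      by move=> z' _; rewrite lee_fin.
    by apply: lee_wpmul2r; rewrite ?lee_fin.
Qed.

Let small (f : T -> R) := forall e : R, (0 < e)%R -> exists J, forall j, (J <= j)%N ->
  kernel_osc j f <= e%:E.

Let small_add (f g h : T -> R) : measurable_fun setT g -> measurable_fun setT h ->
  (forall z z', `|f z' - f z| <= `|g z' - g z| + `|h z' - h z|)%R ->
  small g -> small h -> small f.
Proof.
move=> mg mh fgh sg sh e e0.
have e2 : (0 < e / 2)%R by rewrite divr_gt0.
have [J1 HJ1] := sg _ e2; have [J2 HJ2] := sh _ e2.
exists (maxn J1 J2) => j; rewrite geq_max => /andP[j1 j2].
apply: le_trans (kernel_osc_le j mg mh fgh) _.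
by rewrite [e in e%:E]splitr EFinD; apply: leeD; [exact: HJ1|exact: HJ2].
Qed.

Let small_L1 (f : T -> R) : measurable_fun setT f ->
  (forall e : R, (0 < e)%R -> exists g, [/\ measurable_fun setT g,
    small g & \int[mu]_(z in D) `|f z - g z|%:E <= e%:E]) -> small f.
Proof.
move=> mf fg e e0.
have e1 : (0 < e / 2 / (2 * C + 1))%R.
  by rewrite !divr_gt0// ltr_wpDl ?mulr_ge0.
have [g [mg sg fge]] := fg _ e1.
have e2 : (0 < e / 2)%R by rewrite divr_gt0.
have [J HJ] := sg _ e2; exists J => j Jj.
have mfg : measurable_fun setT (fun z => f z - g z)%R by exact: measurable_funB.
apply: (@le_trans _ _ (kernel_osc j g + kernel_osc j (fun z => f z - g z)%R)).
  apply: kernel_osc_le => // z z'.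
  rewrite [X in (`|X| <= _)%R](_ : _ = (g z' - g z) + ((f z' - g z') - (f z - g z)))%R.
    exact: ler_normD.
  by ring.
rewrite [e in e%:E]splitr EFinD; apply: leeD; first exact: HJ.
apply: le_trans (kernel_osc_le_L1 j mfg) _.
apply: (@le_trans _ _ ((2 * C)%:E * (e / 2 / (2 * C + 1))%:E)).
  by apply: lee_wpmul2l; rewrite ?lee_fin ?mulr_ge0.
rewrite -EFinM lee_fin mulrCA -[leRHS]mulr1 ler_wpM2l ?(ltW e2)//.
by rewrite ler_pdivrMr ?mul1r ?lerDl// ltr_wpDl ?mulr_ge0.
Qed.

(** Good-sets principle: coordinate half-spaces generate the measurable sets, so it is enough that
    they belong to this class and that the class is a sigma-algebra. *)
Let good : set (set T) := [set E | measurable E /\ small \1_E].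

(** The kernel connects the two sides of the hyperplane X i = a only within distance [eps j] of it.
    The corresponding slabs of [D] shrink to the hyperplane section, which is null. *)
Let good_halfspace i a : good [set z | (X i z < a)%R].
Proof.
have mH : measurable [set z | (X i z < a)%R].
  rewrite (_ : mkset _ = X i @^-1` `]-oo, a[); last first.
    by apply/seteqP; split => z /=; rewrite in_itv.
  by rewrite -[X in measurable X]setTI; exact: mX.
split=> // e e0.
pose S (m : nat) := D `&` [set z | (`|X i z - a| <= m.+1%:R^-1)%R].
have mS m : measurable (S m).
  apply: measurableI => //.
  rewrite (_ : mkset _ = (fun z => `|X i z - a|)%R @^-1` [set` `]-oo, m.+1%:R^-1]%R]).
    rewrite -[X in measurable X]setTI.
    have : measurable_fun setT (fun z => `|X i z - a|%R).
      by apply: measurableT_comp => //; exact: measurable_funB.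
    by apply.
  by apply/seteqP; split => z /=; rewrite in_itv.
have Scap : \bigcap_m S m = D `&` [set z | X i z = a].
  apply/seteqP; split=> [z Sz|z [Dz /= Xa] m _]; last first.
    by split => //=; rewrite Xa subrr normr0.
  split; first by have [] := Sz 0%N I.
  apply/eqP; rewrite /= -subr_eq0 -normr_eq0 eq_le normr_ge0 andbT.
  apply/ler_addgt0Pl => /= b b0; rewrite addr0.
  have [m _ mb] := @near_infty_natSinv_lt _ (PosNum b0).
  have [_ /= Sm] := Sz m I.
  by apply: (le_trans Sm); apply/ltW/mb => /=.
have Scvg : mu \o S @ \oo --> mu (\bigcap_m S m).
  apply: nonincreasing_cvg_mu => //.
  - apply: le_lt_trans muD; apply: le_measure; rewrite ?inE//.
    by move=> ? [].
  - by exact: bigcap_measurable.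
  - move=> m m' mm'; apply/subsetPset => z [Dz /= Sz]; split => //=.
    apply: le_trans Sz _; rewrite lef_pV2 ?posrE// ler_nat ltnS.
    exact: mm'.
rewrite Scap hyperplane0 in Scvg.
have [m Sm] : exists m, C%:E * mu (S m) <= e%:E.
  (* Dividing by C + 1 covers the case C = 0. *)
  have e1 : (0 < e / (C + 1))%R by rewrite divr_gt0// ltr_wpDl.
  move/fine_cvgP : Scvg => [[N0 _ HN0]].
  move/cvgrPdist_le => /(_ _ e1)[N1 _ HN1].
  exists (maxn N0 N1).
  have := HN0 (maxn N0 N1) (leq_maxl _ _); have := HN1 (maxn N0 N1) (leq_maxr _ _).
  rewrite /= sub0r normrN => + fS; rewrite ger0_norm ?fine_ge0// => H.
  rewrite -(fineK fS) -EFinM lee_fin.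
  apply: (@le_trans _ _ (C * (e / (C + 1)))%R); first by rewrite ler_wpM2l.
  rewrite mulrCA -[leRHS]mulr1 ler_wpM2l ?(ltW e0)//.
  by rewrite ler_pdivrMr ?mul1r ?lerDl// ltr_wpDl.
have [J HJ] := @eps_small m.+1%:R^-1 (ltac:(by rewrite invr_gt0)).
exists J => j Jj; apply: le_trans Sm.
have -> : C%:E * mu (S m) = \int[mu]_z (C%:E * (\1_(S m) z)%:E).
  rewrite ge0_integralZl//; last first.
    by apply/measurable_EFinP.
  by rewrite integral_indic// setIT.
apply: ge0_le_integral_nomeas => // z _.
have [zS|zS] := boolP (z \in S m).
  have -> : \1_(S m) z = 1%R :> R by rewrite indicE zS.
  rewrite mule1; apply: le_trans (k_int2 j z).
  apply: ge0_le_integral_nomeas => z' _; rewrite lee_fin ?mulr_ge0//.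
  rewrite -[leRHS]mulr1 ler_wpM2l// !indicE.
  by do 2 case: (_ \in _); rewrite ?subrr ?normr0 ?subr0 ?sub0r ?normrN ?normr1.
have -> : \1_(S m) z = 0%R :> R by rewrite indicE (negbTE zS).
rewrite mule0 integral0_eq// => z' _.
have [->|k0] := eqVneq (kappa j z z') 0%R; first by rewrite mul0r.
suff -> : \1_[set z | (X i z < a)%R] z' = \1_[set z | (X i z < a)%R] z :> R.
  by rewrite subrr normr0 mulr0.
move: zS; rewrite notin_setE /S => /not_andP zS.
have [Dz _] := kD k0; case: zS => //= zS.
have := le_trans (k_eps k0 i) (HJ _ Jj) => zz'.
have inE' w : (w \in [set z | (X i z < a)%R]) = (X i w < a)%R.
  by apply/idP/idP; rewrite inE.
rewrite !indicE !inE'; congr ((_ : bool)%:R).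
move: zz' zS; move: (m.+1%:R^-1)%R (X i z) (X i z') => b x x'.
rewrite ler_norml => /andP[xx1 xx2] xb.
apply/idP/idP => za; rewrite ltNge; apply/negP => za';
  apply: xb; rewrite ler_norml; apply/andP; split; lra.
Qed.

Let indic_setD_bound (E F : set T) : E `<=` F ->
  forall z, (`|\1_F z - \1_E z| = \1_(F `\` E) z :> R)%R.
Proof.
move=> EF z; rewrite !indicE in_setD.
have [Ez|Ez] := boolP (z \in E); have [Fz|Fz] := boolP (z \in F) => //=;
  rewrite ?subrr ?normr0 ?subr0 ?normr1//.
by move: Fz; rewrite notin_setE => /(_ (EF _ (set_mem Ez))).
Qed.

(** Complements have the same oscillation. Inside [D] a countable union differs from a finite one by
    a set of small measure, so stability in L1 applies. *)
Let good_sigma_algebra : sigma_algebra setT good.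
Proof.
have goodC A : good A -> good (setT `\` A).
  move=> [mA sA]; split; first exact: measurableD.
  move=> e e0; have [J HJ] := sA e e0; exists J => j /HJ.
  suff -> : kernel_osc j \1_(setT `\` A) = kernel_osc j \1_A by [].
  apply: eq_integral => z _; apply: eq_integral => z' _.
  rewrite setTD !indicE !in_setC; do 2 case: (_ \in A) => //=.
  - by rewrite !subrr.
  - by rewrite subr0 sub0r normrN.
  - by rewrite subr0 sub0r normrN.
  - by rewrite !subrr.
have good0 : good set0.
  split => // e e0; exists 0%N => j _; rewrite /kernel_osc integral0_eq ?lee_fin ?ltW//.
  move=> z _; rewrite integral0_eq// => z' _.
  by rewrite indic0 subrr normr0 mulr0.
have goodU A B : good A -> good B -> good (A `|` B).
  move=> [mA sA] [mB sB]; split; first exact: measurableU.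
  apply: (small_add (measurable_indic mA) (measurable_indic mB) _ sA sB) => z z'.
  rewrite !indicE !in_setU; do 2 case: (_ \in A); do 2 case: (_ \in B) => //=;
  by rewrite ?subrr ?subr0 ?sub0r ?normrN ?normr0 ?normr1 ?addr0 ?add0r ?lexx ?ler01 ?lerDl.
split; [exact: good0|exact: goodC|move=> F goodF].
have mF k : measurable (F k) by case: (goodF k).
have mU : measurable (\bigcup_k F k) by exact: bigcup_measurable.
split => //; apply: small_L1 => // e e0.
pose U k := \big[setU/set0]_(i < k) F i.
have goodUk k : good (U k).
  elim: k => [|k IH]; first by rewrite /U big_ord0; exact: good0.
  have -> : U k.+1 = U k `|` F k by rewrite /U big_ord_recr.
  exact: (goodU _ _ IH (goodF k)).
have mUk k : measurable (U k) by case: (goodUk k).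
have UE : \bigcup_k U k = \bigcup_k F k.
  apply/seteqP; split=> z [k _].
    by rewrite /U -bigcup_mkord => -[i _ Fz]; exists i.
  by move=> Fz; exists k.+1 => //; rewrite /U -bigcup_mkord; exists k => /=.
have cv : mu \o (fun k => D `&` U k) @ \oo --> mu (\bigcup_k (D `&` U k)).
  apply: nondecreasing_cvg_mu.
  - by move=> k; exact: measurableI.
  - by apply: bigcup_measurable => k _; exact: measurableI.
  - move=> m n mn; apply/subsetPset; apply: setIS.
    exact: subset_bigsetU.
rewrite -setI_bigcupr UE in cv.
have DU_fin : mu (D `&` \bigcup_k F k) \is a fin_num.
  rewrite ge0_fin_numE//; apply: le_lt_trans muD.
  by apply: le_measure; rewrite ?inE//; exact: measurableI.
have [k Hk] : exists k, mu (D `&` (\bigcup_k F k `\` U k)) <= e%:E.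
  move: cv; rewrite -(fineK DU_fin) => /fine_cvgP[_] /cvgrPdist_le.
  move=> /(_ _ e0)[N _ HN].
  exists N; have := HN N (leqnn _); rewrite /=.
  have -> : D `&` (\bigcup_k F k `\` U N) =
      (D `&` \bigcup_k F k) `\` (D `&` U N).
    apply/seteqP; split.
      by move=> z [Dz [Fz Uz]]; split => // -[].
    by move=> z [[Dz Fz] DU]; split => //; split => // Uz; apply: DU.
  rewrite measureD//; [|exact: measurableI|exact: measurableI|].
  - rewrite setIA -(setIA D) [_ `&` D]setIC setIA setIid -setIA.
    rewrite (_ : \bigcup_k F k `&` U N = U N); last first.
      by apply/setIidPr; rewrite -UE; exact: bigcup_sup.
    move=> H; have DUN_fin : mu (D `&` U N) \is a fin_num.
      rewrite ge0_fin_numE//; apply: le_lt_trans muD.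
      by apply: le_measure; rewrite ?inE//; exact: measurableI.
    apply: (@le_trans _ _ (fine (mu (D `&` \bigcup_k F k)) -
        fine (mu (D `&` U N)))%:E).
      by rewrite EFinB !fineK.
    by rewrite lee_fin (le_trans (ler_norm _) H).
  - apply: le_lt_trans muD.
    by apply: le_measure; rewrite ?inE//; exact: measurableI.
exists \1_(U k); split => //; first by case: (goodUk k).
apply: le_trans Hk.
have UF : U k `<=` \bigcup_k F k by rewrite -UE; exact: bigcup_sup.
under eq_integral do rewrite (indic_setD_bound UF).
by rewrite integral_indic//; [rewrite setIC|exact: measurableD].
Qed.

Import HBSimple.

Let small_sfun (g : {sfun T >-> R}) : small g.
Proof.
have small_indic E : measurable E -> small \1_E.
  move=> mE; suff [] : good E by [].
  exact: (X_generate good_sigma_algebra good_halfspace mE).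
have -> : (g : T -> R) = (fun z => \sum_(y <- finmap.enum_fset (fset_set (range g)))
    y * \1_(g @^-1` [set y]) z)%R.
  apply/funext => z; rewrite [LHS]fimfunE fsbig_finite//.
elim: (finmap.enum_fset _) => [|y s IH].
  move=> e e0; exists 0%N => j _; rewrite /kernel_osc integral0_eq ?lee_fin ?ltW//.
  by move=> z _; rewrite integral0_eq// => z' _; rewrite !big_nil subrr normr0 mulr0.
have my : measurable (g @^-1` [set y]) by [].
have mg u : measurable_fun setT
    (fun z => \sum_(y <- u) y * \1_(g @^-1` [set y]) z)%R.
  by apply: measurable_sum => x; apply: measurable_funM.
have mg1 : measurable_fun setT (fun z => y * \1_(g @^-1` [set y]) z)%R.
  by apply: measurable_funM.
apply: (small_add mg1 (mg s) _ _ IH) => [z z'|].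
  by rewrite !big_cons opprD addrACA; exact: ler_normD.
move=> e e0.
have e1 : (0 < e / (`|y| + 1))%R by rewrite divr_gt0// ltr_wpDl.
have [J HJ] := small_indic _ my _ e1; exists J => j /HJ => H.
have -> : kernel_osc j (fun z => y * \1_(g @^-1` [set y]) z)%R =
    `|y|%:E * kernel_osc j \1_(g @^-1` [set y]).
  rewrite /kernel_osc -ge0_integralZl//; [|exact: mosc].
  apply: eq_integral => z _; rewrite -ge0_integralZl//; last 2 first.
    exact: mkf1.
    by move=> z' _; rewrite lee_fin mulr_ge0.
  apply: eq_integral => z' _.
  by rewrite -EFinM -mulrBr normrM mulrCA.
apply: (@le_trans _ _ (`|y|%:E * (e / (`|y| + 1))%:E)).
  by apply: lee_wpmul2l; rewrite ?lee_fin.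
rewrite -EFinM lee_fin mulrCA -[leRHS]mulr1 ler_wpM2l ?(ltW e0)//.
by rewrite ler_pdivrMr ?mul1r ?lerDl// ltr_wpDl.
Qed.

Lemma kernel_osc_cvg0 (f : T -> R) : measurable_fun setT f ->
  \int[mu]_(z in D) `|f z|%:E < +oo ->
  forall e : R, (0 < e)%R -> exists J, forall j, (J <= j)%N ->
  kernel_osc j f <= e%:E.
Proof.
move=> mf foo; apply: small_L1 => // e e0.
have intf : mu.-integrable D (EFin \o f).
  apply/integrableP; split => //.
  by apply/measurable_EFinP; exact: measurable_funTS.
have [g [intg _ fg]] := approximation_sfun_integrable mD intf.
move/fine_cvgP : fg => [[N1 _ HN1]] /cvgrPdist_le /(_ _ e0)[N2 _ HN2].
exists (g (maxn N1 N2)); split => //.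
have := HN2 (maxn N1 N2) (leq_maxr _ _); rewrite /= sub0r normrN.
have H := HN1 (maxn N1 N2) (leq_maxl _ _).
rewrite ger0_norm ?fine_ge0 ?integral_ge0//.
by move=> ?; rewrite -(fineK H) lee_fin.
Qed.

Let kf_integrable j (f : T -> R) z : measurable_fun setT f ->
  mu.-integrable D (EFin \o f) -> (exists M, forall z', (kappa j z z' <= M)%R) ->
  mu.-integrable setT (fun z' => (kappa j z z' * f z')%:E).
Proof.
move=> mf /integrableP[_ intf] [M kM].
apply/integrableP; split.
  by apply/measurable_EFinP; exact: measurable_funM.
have M0 : (0 <= M)%R by exact: le_trans (kM point).
apply: (@le_lt_trans _ _ (\int[mu]_(z' in D) (M%:E * `|f z'|%:E))).
  rewrite [leRHS]integral_mkcond; apply: ge0_le_integral_nomeas => // z' _.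
  rewrite patchE; case: ifPn => [_|].
    by rewrite abse_EFin lee_fin normrM ger0_norm// ler_wpM2r.
  rewrite notin_setE => Dz'; rewrite (_ : kappa j z z' = 0%R) ?mul0r ?abse0//.
  by apply/eqP/negP => /negP/kD[].
rewrite ge0_integralZl//; last first.
  by apply/measurable_EFinP; apply: measurable_funTS; exact: measurableT_comp.
by rewrite lte_mul_pinfty ?lee_fin.
Qed.

(** As the kernel has integral 1, [f z] is the kernel average of the constant [f z]; the rest is the
    triangle inequality for integrals. *)
Let kernel_mean_osc j (f : T -> R) z : measurable_fun setT f ->
  mu.-integrable D (EFin \o f) -> (exists M, forall z', (kappa j z z' <= M)%R) ->
  \int[mu]_z' (kappa j z z')%:E = 1 ->
  (`|(\int[mu]_z' (kappa j z z' * f z'))%R - f z|%R)%:E <=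
  \int[mu]_z' (kappa j z z' * `|f z' - f z|)%:E.
Proof.
move=> mf intf kM k1.
have ik : mu.-integrable setT (EFin \o (fun z' => kappa j z z' * f z')%R).
  exact: kf_integrable.
have ikc : mu.-integrable setT (EFin \o (fun z' => kappa j z z' * f z)%R).
  apply/integrableP; split; first by apply/measurable_EFinP; exact: measurable_funM.
  under eq_integral => z' _ do rewrite /= normrM EFinM (ger0_norm (k_ge0 _ _ _)).
  rewrite ge0_integralZr//; last 2 first.
    exact/measurable_EFinP.
    by move=> z' _; rewrite lee_fin.
  by rewrite k1 mul1e ltry.
have fzE : f z = (\int[mu]_z' (kappa j z z' * f z))%R.
  rewrite RintegralZr//; last first.
    apply/integrableP; split; first exact/measurable_EFinP.
    by under eq_integral => z' _ do rewrite /= (ger0_norm (k_ge0 _ _ _)); rewrite k1 ltry.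
  by rewrite /Rintegral k1 mul1r.
rewrite [X in (`|_ - X|%R)%:E <= _]fzE -RintegralB//.
under eq_Rintegral do rewrite -mulrBr.
have ikB : mu.-integrable setT (EFin \o (fun z' => kappa j z z' * (f z' - f z))%R).
  have := integrableB measurableT ik ikc.
  by apply: eq_integrable => // z' _; rewrite /= mulrBr.
rewrite EFin_normr_Rintegral//; apply: le_trans (le_abse_integral _ _ _) _ => //.
  by case/integrableP : ikB.
by apply: ge0_le_integral_nomeas => // z' _; rewrite lee_fin normrM ger0_norm.
Qed.

(** This stands in for a differentiation theorem: a bound on the averages that is uniform in [j]
    passes to [f] itself. It serves twice, for averages over bisected boxes and for averages against
    contracted bumps. *)
Theorem approx_identity_powR_le (f v : T -> R) (c q : R) (K : \bar R) :
  measurable_fun setT f -> \int[mu]_(z in D) `|f z|%:E < +oo ->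
  measurable_fun D v -> (forall z, D z -> (0 <= v z)%R) -> (0 < q)%R ->
  (forall j z, exists M, forall z', (kappa j z z' <= M)%R) ->
  (forall j z, D z -> \int[mu]_z' (kappa j z z')%:E = 1) ->
  (forall j, \int[mu]_(z in D)
    (`|(\int[mu]_z' (kappa j z z' * f z'))%R - c| `^ q * v z)%:E <= K) ->
  \int[mu]_(z in D) (`|f z - c| `^ q * v z)%:E <= K.
Proof.
move=> mf foo mv v0 q0 kM k1 HK.
have intf : mu.-integrable D (EFin \o f).
  apply/integrableP; split => //.
  by apply/measurable_EFinP; exact: measurable_funTS.
have mg j : measurable_fun setT (fun z => \int[mu]_z' (kappa j z z' * f z'))%R.
  apply: (@measurable_Rintegral_snd _ _ _ _ _ mu (fun z z' => kappa j z z' * f z')%R).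
  apply: measurable_funM => //; exact: measurableT_comp mf measurable_snd.
apply: (@L1_cvg_powR_le _ _ _ _ _
  (fun j z => (\int[mu]_z' (kappa j z z' * f z'))%R)) => //.
- by move=> j; exact: measurable_funTS.
- exact: measurable_funTS.
move=> e e0; have [J HJ] := kernel_osc_cvg0 mf foo e0.
exists J => j Jj; apply: le_trans (HJ j Jj).
rewrite integral_mkcond; apply: ge0_le_integral_nomeas => z _;
  rewrite patchE; case: ifPn => // Dz; apply: kernel_mean_osc => //.
by apply: k1; exact: set_mem.
Qed.

End approximate_identity.

(** * The reverse Hoelder inequality *)

Lemma powR_ge1 (R : realType) (x r : R) : 1 <= x -> 0 <= r -> 1 <= x `^ r.
Proof. by move=> x1 r0; rewrite -[leLHS](powRr0 x) ler_powR. Qed.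

Lemma powR_le1 (R : realType) (x r : R) : 0 <= x -> x <= 1 -> 0 <= r -> x `^ r <= 1.
Proof.
by move=> x0 x1 r0; have := ge0_ler_powR r0 _ _ x1; rewrite powR1 !nnegrE; apply.
Qed.

Lemma powR_subr1 (R : realType) (x p : R) : 0 < x -> x `^ (p - 1) = x `^ p / x.
Proof.
move=> x0; rewrite powRB; first by rewrite powRr1// ltW.
by rewrite (gt_eqF x0) implybT.
Qed.

(** * Stopping times on an abstract binary tree *)

Section stopping_tree.
Context (R : realType) (node : Type) (ok : node -> Prop)
  (left right : node -> node) (W S m : node -> R) (p A e : R).
Hypothesis ok_left : forall P, ok P -> ok (left P).
Hypothesis ok_right : forall P, ok P -> ok (right P).
Hypothesis W_gt0 : forall P, ok P -> 0 < W P.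
Hypothesis S_gt0 : forall P, ok P -> 0 < S P.
Hypothesis m_gt0 : forall P, ok P -> 0 < m P.
Hypothesis W_split : forall P, ok P -> W P = W (left P) + W (right P).
Hypothesis S_split : forall P, ok P -> S P = S (left P) + S (right P).
Hypothesis m_left : forall P, ok P -> m (left P) = m P / 2.
Hypothesis m_right : forall P, ok P -> m (right P) = m P / 2.
Hypothesis p_gt1 : 1 < p.
Hypothesis A_ge1 : 1 <= A.
Hypothesis Muckenhoupt : forall P, ok P -> W P * S P `^ (p - 1) <= A * m P `^ p.
Hypothesis mass_le : forall P k, ok P -> 0 < k ->
  m P <= k * W P + k `^ (- (p - 1)^-1) * S P.

Let s := 4 `^ (- p) / A.
Hypothesis e_gt0 : 0 < e.
Hypothesis e_small : 4 `^ e <= 1 + s.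

(** With [W] the integral of a weight and [m] the measure, W (W/m)^e = m (W/m)^(1+e). The sum is
    thus the integral of the power 1 + e of the weight averaged over the nodes of depth [J]. *)
Fixpoint leaf_sum (J : nat) (P : node) : R :=
  if J is J'.+1 then leaf_sum J' (left P) + leaf_sum J' (right P)
  else W P * (W P / m P) `^ e.

(* The tree is cut at the first node whose average exceeds the threshold t. *)
Fixpoint stop_sum (t : R) (f b : node -> R) (J : nat) (P : node) : R :=
  if t < W P / m P then b P
  else if J is J'.+1 then stop_sum t f b J' (left P) + stop_sum t f b J' (right P)
  else f P.

Let m_split P : ok P -> m P = m (left P) + m (right P).
Proof. by move=> oP; rewrite m_left// m_right//; field. Qed.

(** With [b] zero, [stop_sum] runs over the leaves reached without stopping; with [f] zero, over the
    stopped nodes. Together they tile the root. *)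
Let stop_sum_additive t (f : node -> R) J P : ok P ->
  (forall P, ok P -> f P = f (left P) + f (right P)) ->
  stop_sum t f (fun=> 0) J P + stop_sum t (fun=> 0) f J P = f P.
Proof.
move=> + fs; elim: J P => [|J IH] P oP /=; case: ifPn => _;
  rewrite ?add0r ?addr0//.
by rewrite addrACA !IH -?fs//; [exact: ok_right|exact: ok_left].
Qed.

Let stop_sum_ge0 t (f b : node -> R) J P : ok P ->
  (forall P, ok P -> 0 <= f P) -> (forall P, ok P -> 0 <= b P) ->
  0 <= stop_sum t f b J P.
Proof.
move=> + f0 b0; elim: J P => [|J IH] P oP /=; case: ifPn => _;
  rewrite ?f0 ?b0// addr_ge0// IH//; [exact: ok_left|exact: ok_right].
Qed.

(** Chebyshev's inequality: the average exceeds [t] on each stopped node. *)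
Let stopped_mass t J P : ok P ->
  t * stop_sum t (fun=> 0) m J P <= stop_sum t (fun=> 0) W J P.
Proof.
elim: J P => [|J IH] P oP /=; case: ifPn => [tW|_]; rewrite ?mulr0//.
- by rewrite -ler_pdivlMr ?ltW// m_gt0.
- by rewrite -ler_pdivlMr ?ltW// m_gt0.
- by rewrite mulrDr lerD// IH//; [exact: ok_left|exact: ok_right].
Qed.

(** Young's form of Hoelder's inequality is linear in [W] and [S], so it can be summed over the kept
    leaves before [k] is chosen. *)
Let kept_mass t k J P : ok P -> 0 < k ->
  stop_sum t m (fun=> 0) J P <=
  k * stop_sum t W (fun=> 0) J P + k `^ (- (p - 1)^-1) * stop_sum t S (fun=> 0) J P.
Proof.
move=> + k0; elim: J P => [|J IH] P oP /=; case: ifPn => _;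
  rewrite ?mulr0 ?addr0//; first exact: mass_le.
rewrite !mulrDr addrACA lerD// IH//; [exact: ok_left|exact: ok_right].
Qed.

(** Bisection halves the measure and does not increase the weight, so averages at most double. A
    node whose parent was not stopped therefore has average at most 2 t. *)
Let avg_left P : ok P -> W (left P) / m (left P) <= 2 * (W P / m P).
Proof.
move=> oP; have m0 := m_gt0 oP; rewrite m_left//.
rewrite (_ : _ / _ = 2 * (W (left P) / m P)); last by field; rewrite gt_eqF.
rewrite ler_pM2l//.
rewrite ler_pM2r ?invr_gt0 ?m_gt0// [leRHS]W_split// lerDl ltW// W_gt0//.
exact: ok_right.
Qed.

Let avg_right P : ok P -> W (right P) / m (right P) <= 2 * (W P / m P).
Proof.
move=> oP; have m0 := m_gt0 oP; rewrite m_right//.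
rewrite (_ : _ / _ = 2 * (W (right P) / m P)); last by field; rewrite gt_eqF.
rewrite ler_pM2l//.
rewrite ler_pM2r ?invr_gt0 ?m_gt0// [leRHS]W_split// lerDr ltW// W_gt0//.
exact: ok_left.
Qed.

Let avg_gt0 P : ok P -> 0 < W P / m P.
Proof. by move=> oP; rewrite divr_gt0 ?W_gt0 ?m_gt0. Qed.

(** A kept leaf has average at most [t]. At a stopped node the assumed bound on its subtree is used,
    with an average of at most 2 t because its parent stayed below the threshold; the condition on
    [W P / m P] carries this last fact down the induction. *)
Let leaf_sum_stop t C J P : ok P -> 0 < t -> 0 <= C -> W P / m P <= 2 * t ->
  (forall J' Q, (J' <= J)%N -> ok Q -> leaf_sum J' Q <= C * (W Q * (W Q / m Q) `^ e)) ->
  leaf_sum J P <= t `^ e * stop_sum t W (fun=> 0) J P +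
    C * (2 * t) `^ e * stop_sum t (fun=> 0) W J P.
Proof.
move=> + t0 C0; elim: J P => [|J IH] P oP Pt HC.
  rewrite /=; case: ifPn => tP; rewrite ?mulr0 ?addr0 ?add0r.
    apply: le_trans (HC 0%N P isT oP) _; rewrite -mulrA ler_wpM2l// mulrC.
    rewrite ler_wpM2r ?(ltW (W_gt0 oP))//.
    by rewrite ge0_ler_powR ?nnegrE ?(ltW e_gt0) ?(ltW (avg_gt0 oP)) ?mulr_ge0 ?(ltW t0).
  rewrite mulrC ler_wpM2r ?(ltW (W_gt0 oP))//.
  rewrite ge0_ler_powR ?nnegrE ?(ltW e_gt0) ?(ltW (avg_gt0 oP)) ?(ltW t0)//.
  by rewrite leNgt.
rewrite [stop_sum _ _ _ _ _]/= [X in _ <= _ + _ * X]/=.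
case: ifPn => tP; rewrite ?mulr0 ?add0r.
  apply: le_trans (HC J.+1 P (leqnn _) oP) _; rewrite -mulrA ler_wpM2l// mulrC.
  rewrite ler_wpM2r ?(ltW (W_gt0 oP))//.
  by rewrite ge0_ler_powR ?nnegrE ?(ltW e_gt0) ?(ltW (avg_gt0 oP)) ?mulr_ge0 ?(ltW t0).
rewrite -leNgt in tP; rewrite /= !mulrDr addrACA lerD// IH//.
- exact: ok_left.
- by apply: le_trans (avg_left oP) _; rewrite ler_pM2l.
- by move=> J' Q J'J; apply: HC; exact: leqW.
- exact: ok_right.
- by apply: le_trans (avg_right oP) _; rewrite ler_pM2l.
- by move=> J' Q J'J; apply: HC; exact: leqW.
Qed.

Let s_gt0 : 0 < s.
Proof. by rewrite divr_gt0 ?powR_gt0// (lt_le_trans ltr01). Qed.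

Let s_lt1 : s < 1.
Proof.
rewrite ltr_pdivrMr ?(lt_le_trans ltr01)// mul1r; apply: lt_le_trans A_ge1.
rewrite powRN invf_lt1 ?powR_gt0//; apply: (@lt_le_trans _ _ 4); first by rewrite ltr1n.
by rewrite -[leLHS]powRr1// ler_powR ?ler1n// ltW.
Qed.

(** With the threshold at twice the average of the root, Chebyshev leaves at most half of the
    measure to the stopped nodes. The A_p condition turns the kept half of the measure into a fixed
    share [s] of the weight. *)
Let kept_weight J P : ok P ->
  s * W P <= stop_sum (2 * (W P / m P)) W (fun=> 0) J P.
Proof.
move=> oP; set t := 2 * (W P / m P).
have m0 := m_gt0 oP; have W0 := W_gt0 oP; have S0 := S_gt0 oP.
have t0 : 0 < t by rewrite mulr_gt0// avg_gt0.
(* With this [k] the term in [S] is at most m/4, so at least m/4 of the kept measure m/2 is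
   accounted for by the weight. The A_p condition bounds m/(4k) below by s W. *)
pose k := (4 * S P / m P) `^ (p - 1).
have k0 : 0 < k by rewrite powR_gt0// divr_gt0// mulr_gt0.
have p1 : 0 < p - 1 by rewrite subr_gt0.
have kE : k `^ (- (p - 1)^-1) = m P / (4 * S P).
  rewrite -powRrM mulrN divff ?gt_eqF// powR_inv1 ?invf_div//.
  by rewrite ltW// divr_gt0// mulr_gt0.
have Wb_le : stop_sum t (fun=> 0) W J P <= W P.
  rewrite -[leRHS](stop_sum_additive t J oP W_split) lerDr.
  by apply: stop_sum_ge0 => // Q oQ; rewrite ltW// W_gt0.
have Sg_le : stop_sum t S (fun=> 0) J P <= S P.
  rewrite -[leRHS](stop_sum_additive t J oP S_split) lerDl.
  by apply: stop_sum_ge0 => // Q oQ; rewrite ltW// S_gt0.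
have mb_le : stop_sum t (fun=> 0) m J P <= m P / 2.
  have := le_trans (stopped_mass t J oP) Wb_le.
  rewrite mulrC -ler_pdivlMr// => /le_trans; apply.
  by rewrite (_ : W P / t = m P / 2)// /t; field; rewrite !gt_eqF.
have mg_ge : m P / 2 <= stop_sum t m (fun=> 0) J P.
  have := stop_sum_additive t J oP m_split; lra.
have kg := kept_mass t J oP k0.
have Sg' : k `^ (- (p - 1)^-1) * stop_sum t S (fun=> 0) J P <= m P / 4.
  apply: (@le_trans _ _ (m P / (4 * S P) * S P)).
    by rewrite kE ler_wpM2l// ltW// divr_gt0// mulr_gt0.
  by rewrite invfM mulrA divfK ?gt_eqF.
have kW : m P / 4 <= k * stop_sum t W (fun=> 0) J P by lra.
apply: (@le_trans _ _ (m P / 4 / k)); last by rewrite ler_pdivrMr// [leRHS]mulrC.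
rewrite ler_pdivlMr// /k /s.
have -> : (4 * S P / m P) `^ (p - 1) = 4 `^ p / 4 * S P `^ (p - 1) * (m P / m P `^ p).
  rewrite !powRM ?invr_ge0 ?mulr_ge0 ?(ltW m0) ?(ltW S0)// -powR_inv1 ?(ltW m0)//.
  rewrite -powRrM mulN1r powRN !powR_subr1//.
  by field; rewrite !gt_eqF ?powR_gt0.
have := Muckenhoupt oP => Ap.
have x0 : 0 < (m P `^ p) by rewrite powR_gt0.
have y0 : 0 < 4 `^ p :> R by rewrite powR_gt0.
rewrite powRN.
have A0 : 0 < A by exact: lt_le_trans A_ge1.
rewrite [leLHS](_ : _ = (W P * S P `^ (p - 1)) * (m P / 4 / A / m P `^ p)); last first.
  by field; rewrite !gt_eqF.
rewrite -[leRHS](mulVKf (_ : A * m P `^ p != 0)) ?gt_eqF ?mulr_gt0//.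
rewrite (_ : m P / 4 / A / m P `^ p = (A * m P `^ p)^-1 * (m P / 4)); last first.
  by field; rewrite !gt_eqF.
by rewrite ler_wpM2r// mulr_ge0// ?ltW// ?invr_gt0 ?mulr_gt0// divr_gt0.
Qed.

(** Induction on the depth, cutting at twice the average a of the root. The kept part is at most (2
    a)^e W. The stopped part has weight at most (1 - s) W and averages at most 4 a, and costs the
    inductive constant; the missing share [s] absorbs 4^e, so the constant does not grow. *)
Theorem leaf_sum_le J P : ok P ->
  leaf_sum J P <= 4 / s ^+ 2 * (W P * (W P / m P) `^ e).
Proof.
(* The fixed-point inequality for C = 4 / s^2: from 4^e <= 1 + s one gets C 4^e (1 - s) <= C (1 -
   s^2) = C - 4, which leaves room for 2^e <= 4. *)
have C1 : 2 `^ e + 4 / s ^+ 2 * 4 `^ e * (1 - s) <= 4 / s ^+ 2 :> R.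
  have h2 : 2 `^ e <= 4 :> R.
    apply: (@le_trans _ _ (4 `^ e)).
      by rewrite ge0_ler_powR ?nnegrE ?(ltW e_gt0)// ler_nat.
    by move: s_lt1 => ?; apply: le_trans e_small _; lra.
  have sc : 0 < s ^+ 2 by rewrite exprn_gt0.
  have h3 : 4 `^ e * (1 - s) <= 1 - s ^+ 2.
    apply: (@le_trans _ _ ((1 + s) * (1 - s))).
      by rewrite ler_wpM2r// subr_ge0 ltW.
    by rewrite le_eqVlt; apply/orP; left; apply/eqP; ring.
  have h4 : 4 / s ^+ 2 * (4 `^ e * (1 - s)) <= 4 / s ^+ 2 * (1 - s ^+ 2).
    by rewrite ler_wpM2l// ltW// divr_gt0.
  rewrite -mulrA; apply: le_trans (lerD h2 h4) _.
  by rewrite mulrBr mulr1 divfK ?gt_eqF// addrC subrK.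
have C0 : 1 <= 4 / s ^+ 2.
  rewrite ler_pdivlMr ?exprn_gt0// mul1r; apply: (@le_trans _ _ 1) => //.
    by rewrite expr_le1// ltW.
  by rewrite ler1n.
have C0' : 0 <= 4 / s ^+ 2 by exact: le_trans C0.
elim/ltn_ind: J P => -[|J] IH P oP.
  by rewrite /= ler_peMl// mulr_ge0 ?powR_ge0 ?(ltW (W_gt0 oP)).
set t := 2 * (W P / m P); have t0 : 0 < t by rewrite mulr_gt0// avg_gt0.
have ntP : (t < W P / m P) = false.
  apply/negbTE; rewrite -leNgt /t; have := avg_gt0 oP; lra.
have IHJ J' Q : (J' <= J)%N -> ok Q ->
  leaf_sum J' Q <= 4 / s ^+ 2 * (W Q * (W Q / m Q) `^ e) by move=> /IH; apply.
have HL : leaf_sum J.+1 P <= t `^ e * stop_sum t W (fun=> 0) J.+1 P +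
    4 / s ^+ 2 * (2 * t) `^ e * stop_sum t (fun=> 0) W J.+1 P.
  (* The root lies below the threshold and is not stopped, so the bound is taken at its two
     children, where the inductive hypothesis is available. *)
  rewrite /= ntP !mulrDr addrACA lerD// leaf_sum_stop//.
  - exact: ok_left.
  - apply: le_trans (avg_left oP) _; rewrite ler_pM2l// /t.
    by have := avg_gt0 oP; lra.
  - exact: ok_right.
  - apply: le_trans (avg_right oP) _; rewrite ler_pM2l// /t.
    by have := avg_gt0 oP; lra.
have Wadd := stop_sum_additive t J.+1 oP W_split.
have Wg := kept_weight J.+1 oP; rewrite -/t in Wg.
have Wg0 : 0 <= stop_sum t (fun=> 0) W J.+1 P.
  by apply: stop_sum_ge0 => // Q oQ; rewrite ltW// W_gt0.
apply: le_trans HL _.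
have a0 := avg_gt0 oP; have W0 := W_gt0 oP.
have tE : t `^ e = 2 `^ e * (W P / m P) `^ e by rewrite /t powRM// ltW.
have ttE : (2 * t) `^ e = 4 `^ e * (W P / m P) `^ e.
  by rewrite -powRM ?(ltW a0)// /t mulrA; congr (_ `^ e); ring.
set a := (W P / m P) `^ e in tE ttE *; have a_ge0 : 0 <= a by exact: powR_ge0.
rewrite tE ttE.
apply: (@le_trans _ _ (2 `^ e * a * W P + 4 / s ^+ 2 * (4 `^ e * a) * ((1 - s) * W P))).
  apply: lerD.
    by rewrite ler_wpM2l ?mulr_ge0 ?powR_ge0//; lra.
  rewrite ler_wpM2l ?mulr_ge0 ?powR_ge0//.
    by rewrite ltW// invr_gt0 exprn_gt0.
  lra.
rewrite (_ : _ + _ = (2 `^ e + 4 / s ^+ 2 * 4 `^ e * (1 - s)) * (W P * a)); last by ring.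
by rewrite ler_wpM2r// mulr_ge0// ltW.
Qed.

End stopping_tree.

(** * Bisection of parabolic boxes *)

Section parabolic_boxes.
Context d (T : measurableType d) (R : realType)
  (mu : {sigma_finite_measure set T -> \bar R}) (Ix : finType)
  (X : Ix -> T -> R) (deg : Ix -> nat) (i0 : Ix).

(** Half-open, so that bisection gives an exact partition. *)
Definition cbox (a l : Ix -> R) : set T :=
  [set z | forall i, a i <= X i z < a i + l i].

Hypothesis mX : forall i, measurable_fun [set: T] (X i).
Hypothesis mu_cbox : forall a l, (forall i, 0 <= l i) ->
  mu (cbox a l) = (\prod_i l i)%:E.
Hypothesis X_generate : forall G : set (set T), sigma_algebra setT G ->
  (forall i a, G [set z | X i z < a]) -> @measurable _ T `<=` G.
Hypothesis deg_gt0 : forall i, (0 < deg i)%N.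

Lemma measurable_cbox a l : measurable (cbox a l).
Proof.
have -> : cbox a l = \bigcap_(i in [set: Ix]) (X i @^-1` `[a i, a i + l i[).
  apply/seteqP; split => [z H i _ /=|z H i]; first by rewrite in_itv /=; exact: H.
  by have := H i Logic.I; rewrite /= in_itv.
apply: fin_bigcap_measurable => // i _.
by rewrite -[X in measurable X]setTI; exact: mX.
Qed.

(** The slice lies in boxes whose side in direction [i] is arbitrarily small. *)
Lemma cbox_hyperplane0 a l i b : (forall j, 0 <= l j) ->
  mu (cbox a l `&` [set z | X i z = b]) = 0%E.
Proof.
move=> l0.
have mI : measurable (cbox a l `&` [set z | X i z = b]).
  apply: measurableI; first exact: measurable_cbox.
  rewrite (_ : [set z | _] = X i @^-1` [set b]) //.
  by rewrite -[X in measurable X]setTI; exact: mX.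
pose K := \prod_(j | j != i) l j.
have K0 : 0 <= K by apply: prodr_ge0.
have H e : 0 < e -> (mu (cbox a l `&` [set z | X i z = b]) <= (e * K)%:E)%E.
  move=> e0.
  pose a' j := if j == i then b else a j.
  pose l' j := if j == i then e else l j.
  have l'0 j : 0 <= l' j by rewrite /l'; case: ifP => // _; exact: ltW.
  apply: (@le_trans _ _ (mu (cbox a' l'))).
    apply: le_measure; rewrite ?inE//; first exact: measurable_cbox.
    move=> z [Hz /= Xb] j; rewrite /a' /l'; case: eqVneq => [->|_].
      by rewrite Xb lexx ltrDl.
    exact: Hz.
  rewrite mu_cbox// lee_fin (bigD1 i)//= /l' eqxx ler_wpM2l ?(ltW e0)//.
  rewrite /K le_eqVlt; apply/orP; left; apply/eqP; apply: eq_bigr => j /negbTE ji.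
  by rewrite ji.
apply/eqP; rewrite eq_le measure_ge0 andbT; apply/lee_addgt0Pr => e e0.
rewrite add0e; apply: le_trans (H (e / (K + 1)) _) _.
  by rewrite divr_gt0// ltr_wpDl.
rewrite lee_fin -mulrA ler_piMr ?(ltW e0)// mulrC ler_pdivrMr ?mul1r ?lerDl//.
by rewrite ltr_wpDl.
Qed.

(** The half-open parabolic cube of radius [s], given by its lower corner. *)
Definition pcorner (a : Ix -> R) (s : R) : set T :=
  cbox a (fun i => 2 * s ^+ deg i).

(** The order of bisection. One period halves coordinate [i] exactly [deg i] times, so after [N]
    bisections the box is again a parabolic cube, of half the radius. *)
Let sch : seq Ix := flatten [seq nseq (deg i) i | i <- enum Ix].
Let N := size sch.

Let count_sch i : count_mem i sch = deg i.
Proof.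
rewrite /sch count_flatten -map_comp sumnE big_map big_enum /=.
rewrite (bigD1 i)//= count_nseq /= eqxx mul1n big1 ?addn0// => j ji.
by rewrite count_nseq /= (negbTE ji) mul0n.
Qed.

Let N_gt0 : (0 < N)%N.
Proof.
by have := count_size (pred1 i0) sch; rewrite count_sch; apply: leq_trans.
Qed.

Lemma sum_degE : N = (\sum_i deg i)%N.
Proof.
rewrite /N /sch size_flatten /shape -map_comp sumnE big_map big_enum /=.
by apply: eq_bigr => i _; rewrite size_nseq.
Qed.

(** [c k] is the coordinate bisected at depth [k], and [cnt i k] the number of times coordinate [i]
    has been bisected before. *)
Let c (k : nat) : Ix := nth i0 sch (k %% N).
Let cnt (i : Ix) (k : nat) : nat :=
  ((k %/ N) * deg i + count_mem i (take (k %% N) sch))%N.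

Let cntS i k : cnt i k.+1 = (cnt i k + (c k == i))%N.
Proof.
rewrite /cnt /c divnS// modnS.
have kN : (k %% N < N)%N by rewrite ltn_mod.
have tk : count_mem i (take (k %% N).+1 sch) =
    (count_mem i (take (k %% N) sch) + (nth i0 sch (k %% N) == i))%N.
  by rewrite (take_nth i0)// -cats1 count_cat /= addn0.
(* If step [k] ends a period, the remainder returns to 0 and the whole of [sch] has been counted
   once more. *)
case: ifPn => kd; last by rewrite add0n tk addnA.
rewrite take0 /= addn0 mulnDl mul1n addnC -addnA -tk; congr (_ + _)%N.
rewrite -(count_sch i); congr (count _ _).
have /eqP := kd; rewrite modnS kd => _.
rewrite take_oversize//.
apply: dvdn_leq => //; move: kd; rewrite {1}(divn_eq k N) -addnS dvdn_addr//.
exact: dvdn_mull.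
Qed.

Let cnt_ge i k : ((k %/ N) * deg i <= cnt i k)%N.
Proof. exact: leq_addr. Qed.

Let cnt_le i k : (cnt i k <= (k %/ N).+1 * deg i)%N.
Proof.
rewrite /cnt mulSn addnC leq_add2r -[X in (_ <= X)%N]count_sch.
by rewrite -[X in (_ <= count _ X)%N](cat_take_drop (k %% N)) count_cat leq_addr.
Qed.

Context (s : R).
Hypothesis s_gt0 : 0 < s.

Let len (i : Ix) (k : nat) : R := 2 * s ^+ deg i / 2 ^+ cnt i k.

Let len_gt0 i k : 0 < len i k.
Proof. by rewrite divr_gt0 ?mulr_gt0 ?exprn_gt0. Qed.

Let lenS i k : len i k.+1 = if c k == i then len i k / 2 else len i k.
Proof.
rewrite /len cntS; case: ifP => _; last by rewrite addn0.
by rewrite addn1 exprSr invfM mulrA.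
Qed.

Let node : Type := ((Ix -> R) * nat)%type.
Let left (P : node) : node := (P.1, P.2.+1).
Let right (P : node) : node :=
  (fun i => P.1 i + (c P.2 == i)%:R * len i P.2.+1, P.2.+1).
Let nbox (P : node) : set T := cbox P.1 (len ^~ P.2).
Let mass (P : node) : R := \prod_i len i P.2.

Let mass_gt0 P : 0 < mass P.
Proof. exact: prodr_gt0. Qed.

Let mnbox P : measurable (nbox P).
Proof. exact: measurable_cbox. Qed.

Let mu_nbox P : mu (nbox P) = (mass P)%:E.
Proof. by rewrite mu_cbox// => i; exact: ltW. Qed.

Let mass_left P : mass (left P) = mass P / 2.
Proof.
rewrite /mass /= (bigD1 (c P.2))//= [in RHS](bigD1 (c P.2))//= lenS eqxx mulrAC.
congr (_ * _ * _); apply: eq_bigr => i /negbTE ic.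
by rewrite lenS eq_sym ic.
Qed.

Let mass_right P : mass (right P) = mass P / 2.
Proof. exact: mass_left. Qed.

Let nboxU P : nbox P = nbox (left P) `|` nbox (right P).
Proof.
case: P => a k; rewrite /nbox /left /right /=; apply/seteqP; split => z.
  move=> Hz; have [Xz|Xz] := ltP (X (c k) z) (a (c k) + len (c k) k.+1).
    left => i; have := Hz i; rewrite lenS; case: eqVneq => [<-|_ //].
    by move: Xz; rewrite lenS eqxx => -> /andP[->].
  right => i; have := Hz i; rewrite lenS; case: eqVneq => [<-|_].
    move: Xz; rewrite lenS eqxx mul1r => -> /= /andP[_ h].
    by rewrite -addrA -splitr.
  by rewrite mul0r addr0.
case=> Hz i; have := Hz i; rewrite /= lenS; have l0 := len_gt0 i k.
  case: eqVneq => [<-|_ //] /andP[-> h] /=; apply: lt_trans h _.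
  by rewrite ltrD2l ltr_pdivrMr// ltr_pMr// ltr1n.
case: eqVneq => [<-|_]; last by rewrite mul0r addr0.
rewrite mul1r -addrA -splitr => /andP[h ->]; rewrite andbT.
by apply: le_trans h; rewrite lerDl divr_ge0// ltW.
Qed.

Let nboxI P : nbox (left P) `&` nbox (right P) = set0.
Proof.
apply/seteqP; split => // z [/(_ (c P.2)) /= /andP[_ h1] /(_ (c P.2)) /= /andP[+ _]].
by rewrite eqxx mul1r leNgt h1.
Qed.

Let nbox_left P : nbox (left P) `<=` nbox P.
Proof. by rewrite [X in _ `<=` X]nboxU; exact: subsetUl. Qed.

Let nbox_right P : nbox (right P) `<=` nbox P.
Proof. by rewrite [X in _ `<=` X]nboxU; exact: subsetUr. Qed.

(** The enclosing cube takes only completed periods into account. Each coordinate has been bisected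
    at most [deg i] times since, so the cube is at most 2^N times too large, as [mass_pcorner]
    records. *)
Let nbox_sub P : nbox P `<=` pcorner P.1 (s / 2 ^+ (P.2 %/ N)).
Proof.
move=> z Hz i; have /andP[-> h] := Hz i; apply: lt_le_trans h _.
rewrite lerD2l /len -mulrA ler_wpM2l// exprMn ler_wpM2l ?exprn_ge0 ?(ltW s_gt0)//.
rewrite exprVn lef_pV2 ?posrE ?exprn_gt0// -exprM ler_weXn2l ?ler1n//.
Qed.

Let mass_pcorner P :
  \prod_i (2 * (s / 2 ^+ (P.2 %/ N)) ^+ deg i) <= 2 ^+ N * mass P.
Proof.
rewrite [X in _ <= 2 ^+ X * _]sum_degE -prodrXr -big_split /=; apply: ler_prod => i _.
rewrite mulr_ge0 ?exprn_ge0 ?divr_ge0 ?exprn_ge0 ?(ltW s_gt0)//= /len.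
have h : 2 ^+ cnt i P.2 <= 2 ^+ deg i * (2 ^+ (P.2 %/ N)) ^+ deg i :> R.
  by rewrite -exprM -exprD ler_weXn2l ?ler1n// -mulSn cnt_le.
set D := (2 ^+ (P.2 %/ N)) ^+ deg i in h *.
have D0 : 0 < D by rewrite !exprn_gt0.
rewrite expr_div_n -/D (_ : _ * (_ / _) = 2 * s ^+ deg i * D^-1); last by ring.
rewrite [leRHS](_ : _ = 2 * s ^+ deg i * (2 ^+ deg i / 2 ^+ cnt i P.2)); last by ring.
rewrite ler_wpM2l ?mulr_ge0 ?exprn_ge0 ?(ltW s_gt0)//.
by rewrite ler_pdivlMr ?exprn_gt0// ler_pdivrMl// mulrC.
Qed.

Context (w : T -> R) (p A e : R).
Hypothesis mw : measurable_fun [set: T] w.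
Hypothesis w_gt0 : forall z, 0 < w z.
Hypothesis p_gt1 : 1 < p.
Hypothesis A_ge1 : 1 <= A.
Let sg (z : T) : R := w z `^ (- (p - 1)^-1).
Hypothesis w_lty : forall a t, 0 < t ->
  (\int[mu]_(z in pcorner a t) (w z)%:E < +oo)%E.
Hypothesis sg_lty : forall a t, 0 < t ->
  (\int[mu]_(z in pcorner a t) (w z `^ (- (p - 1)^-1))%:E < +oo)%E.
Hypothesis Ap : forall a t, 0 < t ->
  (\int[mu]_(z in pcorner a t) w z) *
  (\int[mu]_(z in pcorner a t) w z `^ (- (p - 1)^-1)) `^ (p - 1) <=
  A * (\prod_i (2 * t ^+ deg i)) `^ p.

Let msg : measurable_fun [set: T] sg.
Proof. exact: measurable_fun_powR. Qed.

Let sg_gt0 z : 0 < sg z.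
Proof. exact: powR_gt0. Qed.

Let W (P : node) : R := \int[mu]_(z in nbox P) w z.
Let S (P : node) : R := \int[mu]_(z in nbox P) sg z.

Let sP_gt0 (P : node) : 0 < s / 2 ^+ (P.2 %/ N).
Proof. by rewrite divr_gt0// exprn_gt0. Qed.

Let int_sub_lty (f : T -> R) (P : node) : measurable_fun [set: T] f ->
  (forall z, 0 < f z) ->
  (\int[mu]_(z in pcorner P.1 (s / 2 ^+ (P.2 %/ N))) (f z)%:E < +oo)%E ->
  (\int[mu]_(z in nbox P) (f z)%:E)%E \is a fin_num.
Proof.
move=> mf f0 foo; rewrite ge0_fin_numE; last first.
  by apply: integral_ge0 => z _; rewrite lee_fin ltW.
apply: le_lt_trans foo; apply: ge0_subset_integral => //.
- exact: measurable_cbox.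
- by apply/measurable_EFinP; exact: measurable_funTS.
- by move=> z _; rewrite lee_fin ltW.
Qed.

Let W_fin P : (\int[mu]_(z in nbox P) (w z)%:E)%E \is a fin_num.
Proof. by apply: int_sub_lty => //; exact: w_lty. Qed.

Let S_fin P : (\int[mu]_(z in nbox P) (sg z)%:E)%E \is a fin_num.
Proof. by apply: int_sub_lty => //; exact: sg_lty. Qed.

Let int_split (f : T -> R) (P : node) : measurable_fun [set: T] f ->
  (forall z, 0 < f z) ->
  (forall Q, (\int[mu]_(z in nbox Q) (f z)%:E)%E \is a fin_num) ->
  \int[mu]_(z in nbox P) f z =
  \int[mu]_(z in nbox (left P)) f z + \int[mu]_(z in nbox (right P)) f z.
Proof.
move=> mf f0 ffin; rewrite /Rintegral -fineD//; congr fine.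
rewrite nboxU ge0_integral_setU//.
- by apply/measurable_EFinP; exact: measurable_funTS.
- by move=> z _; rewrite lee_fin ltW.
- by rewrite disj_set2E nboxI.
Qed.

(** Integrated form of 1 <= k w + (k w)^(-1/(p-1)): the first term is at least 1 when k w is, and
    otherwise the second one. *)
Let mass_le P k : 0 < k ->
  mass P <= k * W P + k `^ (- (p - 1)^-1) * S P.
Proof.
move=> k0.
have p1 : 0 < (p - 1)^-1 by rewrite invr_gt0 subr_gt0.
rewrite -lee_fin EFinD !EFinM !fineK// -mu_nbox.
rewrite -!ge0_integralZl ?lee_fin ?powR_ge0 ?(ltW k0)//; try
  by [move=> z _; rewrite lee_fin ltW
     |apply/measurable_EFinP; exact: measurable_funTS].
rewrite -ge0_integralD//; try by [
   move=> z _; rewrite lee_fin mulr_ge0 ?powR_ge0 ?(ltW k0) ?(ltW (w_gt0 _))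
  |apply/measurable_EFinP; apply: measurable_funM => //; exact: measurable_funTS].
rewrite -[leLHS]mul1e -integral_cst//.
apply: ge0_le_integral_nomeas => z _ /=; first by rewrite lee_fin.
rewrite -EFinD lee_fin /sg -powRM ?(ltW k0) ?(ltW (w_gt0 _))//.
have kw0 : 0 < k * w z by rewrite mulr_gt0.
have [kw1|kw1] := leP 1 (k * w z).
  by apply: le_trans kw1 _; rewrite lerDl powR_ge0.
apply: (@le_trans _ _ ((k * w z) `^ (- (p - 1)^-1))); last by rewrite lerDr ltW.
rewrite powRN -[leLHS]invr1 lef_pV2 ?posrE ?powR_gt0//.
by rewrite powR_le1// ltW.
Qed.

Let W_ge0 P : 0 <= W P.
Proof. by apply: Rintegral_ge0 => z _; exact: ltW. Qed.

Let S_ge0 P : 0 <= S P.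
Proof. by apply: Rintegral_ge0 => z _; exact: ltW. Qed.

Let p1_gt0 : 0 < p - 1. Proof. by rewrite subr_gt0. Qed.

(** Positivity comes from [mass_le]: if this integral vanished, a suitable [k] would make the other
    term smaller than the mass of the box. The same holds for [S] below. *)
Let W_gt0 P : 0 < W P.
Proof.
rewrite lt_neqAle W_ge0 andbT; apply/negP => /eqP W0.
have m0 := mass_gt0 P; have S1 : 0 < S P + 1 by rewrite ltr_wpDl.
pose k := (2 * (S P + 1) / mass P) `^ (p - 1).
have k0 : 0 < k by rewrite powR_gt0// divr_gt0// mulr_gt0.
have := mass_le P k0; rewrite -W0 mulr0 add0r leNgt => /negP; apply.
rewrite /k -powRrM mulrN divff ?gt_eqF// powR_inv1; last first.
  by rewrite ltW// divr_gt0// mulr_gt0.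
rewrite invf_div mulrAC ltr_pdivrMr ?mulr_gt0// ltr_pM2l//.
by have := S_ge0 P; lra.
Qed.

Let S_gt0 P : 0 < S P.
Proof.
rewrite lt_neqAle S_ge0 andbT; apply/negP => /eqP S0.
have m0 := mass_gt0 P; have W1 : 0 < W P + 1 by rewrite ltr_wpDl.
pose k := mass P / (2 * (W P + 1)).
have k0 : 0 < k by rewrite divr_gt0// mulr_gt0.
have := mass_le P k0; rewrite -S0 mulr0 addr0 leNgt => /negP; apply.
rewrite /k mulrAC ltr_pdivrMr ?mulr_gt0// ltr_pM2l//.
by have := W_ge0 P; lra.
Qed.

(** An A_p constant for all boxes of the tree, enclosed as they are in parabolic cubes of at most
    2^N times their mass. *)
Let A' := A * (2 ^+ N) `^ p.

Let A'_ge1 : 1 <= A'.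
Proof.
rewrite -[1]mulr1 ler_pM// powR_ge1//; last by rewrite ltW// (lt_trans ltr01).
by rewrite exprn_ege1// ler1n.
Qed.

Let Muckenhoupt P : W P * S P `^ (p - 1) <= A' * mass P `^ p.
Proof.
have t0 := sP_gt0 P; set t := s / 2 ^+ (P.2 %/ N) in t0.
have sub : nbox P `<=` pcorner P.1 t by exact: nbox_sub.
have mono (f : T -> R) : measurable_fun [set: T] f -> (forall z, 0 < f z) ->
    (\int[mu]_(z in pcorner P.1 t) (f z)%:E < +oo)%E ->
    \int[mu]_(z in nbox P) f z <= \int[mu]_(z in pcorner P.1 t) f z.
  move=> mf f0 foo; rewrite /Rintegral fine_le//.
  - exact: int_sub_lty.
  - by rewrite ge0_fin_numE// integral_ge0// => z _; rewrite lee_fin ltW.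
  apply: ge0_subset_integral => //; first exact: measurable_cbox.
  - by apply/measurable_EFinP; exact: measurable_funTS.
  - by move=> z _; rewrite lee_fin ltW.
have pp : 0 <= p by rewrite ltW// (lt_trans ltr01).
have mt := mass_pcorner P.
apply: (@le_trans _ _ (A * (\prod_i (2 * t ^+ deg i)) `^ p)).
  apply: le_trans (Ap P.1 t0); apply: ler_pM.
  - exact: W_ge0.
  - exact: powR_ge0.
  - by apply: mono => //; exact: w_lty.
  - rewrite ge0_ler_powR ?nnegrE ?(ltW p1_gt0)//.
    + by apply: Rintegral_ge0 => z _; exact: powR_ge0.
    + by apply: mono => //; exact: sg_lty.
rewrite /A' -mulrA ler_wpM2l ?(le_trans ler01)//.
rewrite -powRM ?exprn_ge0 ?(ltW (mass_gt0 P))// ge0_ler_powR ?nnegrE//.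
- by apply: prodr_ge0 => i _; rewrite mulr_ge0// exprn_ge0// ltW.
- by rewrite mulr_ge0 ?exprn_ge0// ltW.
Qed.

Hypothesis e_gt0 : 0 < e.
Hypothesis e_small : 4 `^ e <= 1 + 4 `^ (- p) / (A * (2 ^+ (\sum_i deg i)%N) `^ p).

Let cell_sum_le J P : leaf_sum left right W mass e J P <=
  4 / (4 `^ (- p) / A') ^+ 2 * (W P * (W P / mass P) `^ e).
Proof.
apply: (@leaf_sum_le R node (fun=> True) left right W S mass p A' e) => //.
- by move=> Q _; exact: int_split.
- by move=> Q _; exact: int_split.
- by move=> Q k _; exact: mass_le.
- by rewrite /A' sum_degE.
Qed.

Let ind (P : node) (z : T) : R := \1_(nbox P) z.

Let mind P : measurable_fun [set: T] (ind P).
Proof. exact: measurable_indic. Qed.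

Let ind_ge0 P z : 0 <= ind P z.
Proof. by rewrite /ind indicE. Qed.

Let ind_le1 P z : ind P z <= 1.
Proof. by rewrite /ind indicE; case: (_ \in _). Qed.

Let ind_split P z : ind P z = ind (left P) z + ind (right P) z.
Proof.
rewrite /ind !indicE nboxU in_setU.
have [zl|zl] := boolP (z \in nbox (left P)); last by rewrite add0r.
have [zr|zr] := boolP (z \in nbox (right P)); last by rewrite addr0.
have : (nbox (left P) `&` nbox (right P)) z by split; exact: set_mem.
by rewrite nboxI.
Qed.

(** The conditional expectation of [w] on the boxes of depth [J], extended by zero outside the
    root. *)
Fixpoint leaf_avg (J : nat) (P : node) (z : T) : R :=
  if J is J'.+1 then leaf_avg J' (left P) z + leaf_avg J' (right P) z
  else ind P z * (W P / mass P).

(** The kernel of this conditional expectation. Its symmetry lets one marginal provide both bounds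
    required of an approximate identity. *)
Fixpoint leaf_ker (J : nat) (P : node) (z z' : T) : R :=
  if J is J'.+1 then leaf_ker J' (left P) z z' + leaf_ker J' (right P) z z'
  else ind P z * ind P z' / mass P.

Let leaf_ker_ge0 J P z z' : 0 <= leaf_ker J P z z'.
Proof.
elim: J P => [|J IH] P /=; last by rewrite addr_ge0.
by rewrite divr_ge0 ?(ltW (mass_gt0 _))// mulr_ge0.
Qed.

Let leaf_kerC J P z z' : leaf_ker J P z z' = leaf_ker J P z' z.
Proof. by elim: J P => [|J IH] P /=; [rewrite mulrAC mulrC mulrA mulrAC|rewrite !IH]. Qed.

Let leaf_ker_supp J P z z' : leaf_ker J P z z' != 0 ->
  [/\ nbox P z, nbox P z' & forall i, `|X i z - X i z'| <= len i (P.2 + J)].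
Proof.
elim: J P => [|J IH] P /=.
  rewrite /ind !indicE; have [zP|] := boolP (z \in nbox P); last by rewrite !mul0r eqxx.
  have [z'P|] := boolP (z' \in nbox P); last by rewrite mulr0 mul0r eqxx.
  move=> _; have := set_mem zP; have := set_mem z'P => Pz' Pz; split => // i.
  have /andP[h1 h2] := Pz i; have /andP[h3 h4] := Pz' i; rewrite addn0 ler_norml.
  by move: h1 h2 h3 h4; move: (P.1 i) (len i P.2) => ? ?; lra.
have [->|/IH [h1 h2 h3] _] := eqVneq (leaf_ker J (left P) z z') 0.
  rewrite add0r => /IH [h1 h2 h3]; rewrite addnS; split => //; exact: nbox_right.
by rewrite addnS; split => //; exact: nbox_left.
Qed.

Let measurable_leaf_ker J P :
  measurable_fun [set: T * T] (fun zz : T * T => leaf_ker J P zz.1 zz.2).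
Proof.
elim: J P => [|J IH] P /=; last exact: measurable_funD.
apply: measurable_funM => //; apply: measurable_funM.
  exact: measurableT_comp (mind P) measurable_fst.
exact: measurableT_comp (mind P) measurable_snd.
Qed.

Let measurable_leaf_ker1 J P z : measurable_fun [set: T] (leaf_ker J P z).
Proof. exact: (measurableT_comp (measurable_leaf_ker J P) (pair1_measurable z)). Qed.

Let leaf_ker_bounded J P : exists M, forall z z', leaf_ker J P z z' <= M.
Proof.
elim: J P => [|J IH] P /=.
  exists (mass P)^-1 => z z'; rewrite ler_piMl ?invr_ge0 ?(ltW (mass_gt0 _))//.
  by rewrite mulr_ile1.
have [M1 H1] := IH (left P); have [M2 H2] := IH (right P).
by exists (M1 + M2) => z z'; exact: lerD.
Qed.

Let int_ind P : (\int[mu]_z (ind P z)%:E)%E = (mass P)%:E.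
Proof. by rewrite integral_indic// setIT; exact: mu_nbox. Qed.

Let int_leaf_ker J P z : (\int[mu]_z' (leaf_ker J P z z')%:E)%E = (ind P z)%:E.
Proof.
elim: J P => [|J IH] P.
  have m0 := mass_gt0 P.
  rewrite (_ : (fun z' => _) = (fun z' => (ind P z / mass P)%:E * (ind P z')%:E)%E).
    rewrite ge0_integralZl ?lee_fin ?divr_ge0 ?(ltW m0)//.
    - by rewrite int_ind -EFinM divfK ?gt_eqF.
    - exact/measurable_EFinP.
    - by move=> ? _; rewrite lee_fin.
  by apply/funext => z' /=; rewrite -EFinM mulrAC.
under eq_integral do rewrite /= EFinD.
rewrite ge0_integralD//.
- by rewrite !IH -EFinD -ind_split.
- by move=> ? _; rewrite lee_fin.
- exact/measurable_EFinP.
- by move=> ? _; rewrite lee_fin.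
- exact/measurable_EFinP.
Qed.

Let int_leaf_ker_w J P z :
  (\int[mu]_z' (leaf_ker J P z z' * w z')%:E)%E = (leaf_avg J P z)%:E.
Proof.
elim: J P => [|J IH] P.
  have m0 := mass_gt0 P.
  rewrite (_ : (fun z' => _) =
      (fun z' => (ind P z / mass P)%:E * (ind P z' * w z')%:E)%E).
    rewrite ge0_integralZl ?lee_fin ?divr_ge0 ?(ltW m0)//.
    - rewrite (_ : (\int[mu]_z0 (ind P z0 * w z0)%:E)%E = (W P)%:E).
        by rewrite -EFinM /= mulrAC mulrA.
      rewrite fineK// [RHS]integral_mkcond; apply: eq_integral => z' _.
      by rewrite patchE /ind indicE; case: ifPn; rewrite ?mul1r ?mul0r.
    - by apply/measurable_EFinP; exact: measurable_funM.
    - by move=> ? _; rewrite lee_fin mulr_ge0// ltW.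
  by apply/funext => z' /=; rewrite -EFinM; congr EFin; ring.
under eq_integral do rewrite /= mulrDl EFinD.
rewrite ge0_integralD//.
- by rewrite !IH -EFinD.
- by move=> ? _; rewrite lee_fin mulr_ge0// ltW.
- by apply/measurable_EFinP; exact: measurable_funM.
- by move=> ? _; rewrite lee_fin mulr_ge0// ltW.
- by apply/measurable_EFinP; exact: measurable_funM.
Qed.

Let leaf_avg_out J P z : ~ nbox P z -> leaf_avg J P z = 0.
Proof.
elim: J P => [|J IH] P /= Pz.
  by rewrite /ind indicE memNset// mul0r.
by rewrite !IH ?addr0// => z0; apply: Pz; [exact: nbox_right|exact: nbox_left].
Qed.

Let leaf_avg_ge0 J P z : 0 <= leaf_avg J P z.
Proof.
elim: J P => [|J IH] P /=; last by rewrite addr_ge0.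
by rewrite mulr_ge0// divr_ge0 ?W_ge0// ltW.
Qed.

Let measurable_leaf_avg J P : measurable_fun [set: T] (leaf_avg J P).
Proof.
by elim: J P => [|J IH] P /=; [exact: measurable_funM|exact: measurable_funD].
Qed.

Let int_leaf_avg J P :
  (\int[mu]_(z in nbox P) (leaf_avg J P z `^ (1 + e))%:E)%E =
  (leaf_sum left right W mass e J P)%:E.
Proof.
have mpow J' Q : measurable_fun [set: T] (fun z => (leaf_avg J' Q z `^ (1 + e))%:E).
  by apply/measurable_EFinP; exact: measurable_fun_powR.
elim: J P => [|J IH] P.
  have m0 := mass_gt0 P.
  rewrite (eq_integral (fun=> ((W P / mass P) `^ (1 + e))%:E)).
    rewrite integral_cst//; transitivity (((W P / mass P) `^ (1 + e))%:E * (mass P)%:E)%E.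
      by congr (_ * _)%E; exact: mu_nbox.
    rewrite -EFinM /=; congr EFin.
    rewrite powRD ?powRr1 ?divr_ge0 ?W_ge0 ?(ltW m0)//.
      by field; rewrite gt_eqF.
    by rewrite gt_eqF ?implybT// ?addr_gt0.
  by move=> z zP; rewrite /= /ind indicE zP mul1r.
rewrite {1}nboxU ge0_integral_setU//.
- rewrite /= EFinD -!IH; apply: (congr2 adde); apply: eq_integral => z /set_mem zP.
    rewrite (@leaf_avg_out _ (right P)) ?addr0// => zr.
    have : (nbox (left P) `&` nbox (right P)) z by split.
    by rewrite nboxI.
  rewrite (@leaf_avg_out _ (left P)) ?add0r// => zr.
  have : (nbox (left P) `&` nbox (right P)) z by split.
  by rewrite nboxI.
- by apply: measurable_funTS; exact: (mpow J.+1 P).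
- by move=> z _; rewrite lee_fin powR_ge0.
- by rewrite disj_set2E nboxI.
Qed.

Let len_small (b : R) : 0 < b ->
  exists J, forall j, (J <= j)%N -> \sum_i len i j <= b.
Proof.
move=> b0; pose K := \sum_i (2 * s ^+ deg i).
have K0 : 0 <= K by apply: sumr_ge0 => i _; rewrite mulr_ge0// exprn_ge0// ltW.
pose m := (Num.truncn (K / b)).+1.
exists (m * N)%N => j mj.
apply: (@le_trans _ _ (K / 2 ^+ m)).
  rewrite /K mulr_suml; apply: ler_sum => i _; rewrite /len.
  rewrite ler_wpM2l ?mulr_ge0 ?exprn_ge0 ?(ltW s_gt0)//.
  rewrite lef_pV2 ?posrE ?exprn_gt0// ler_weXn2l ?ler1n//.
  apply: leq_trans (cnt_ge _ _); apply: (@leq_trans (m * deg i)).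
    by rewrite leq_pmulr.
  by rewrite leq_mul2r leq_divRL// mj orbT.
rewrite ler_pdivrMr ?exprn_gt0// -ler_pdivrMl// mulrC.
apply: (@le_trans _ _ m%:R); first by rewrite ltW// truncnS_gt.
by rewrite -natrX ler_nat ltnW// ltn_expl.
Qed.

(** The bound on the averages over boxes of depth [J] is independent of [J], and the sides of these
    boxes tend to 0. It passes to [w] by the approximation theorem with weight 1, constant 0 and
    exponent 1 + e. *)
Theorem reverse_Hoelder (a : Ix -> R) :
  (\int[mu]_(z in pcorner a s) (w z `^ (1 + e))%:E <=
   (4 / (4 `^ (- p) / (A * (2 ^+ (\sum_i deg i)%N) `^ p)) ^+ 2 *
    ((\int[mu]_(z in pcorner a s) w z) *
     ((\int[mu]_(z in pcorner a s) w z) / \prod_i (2 * s ^+ deg i)) `^ e))%:E)%E.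
Proof.
pose P : node := (a, 0%N).
have lenE i : len i 0%N = 2 * s ^+ deg i.
  by rewrite /len /cnt div0n mod0n take0 mul0n addn0 expr0 divr1.
have PE : nbox P = pcorner a s by congr (cbox _ _); apply/funext => i; exact: lenE.
have mE : \prod_i (2 * s ^+ deg i) = mass P by apply: eq_bigr => i _; rewrite lenE.
rewrite -PE mE -/(W P) -sum_degE -/A'.
have intw : (\int[mu]_(z in nbox P) `|w z|%:E < +oo)%E.
  by under eq_integral => z _ do rewrite (gtr0_norm (w_gt0 z)); rewrite ltey_eq W_fin.
have := @approx_identity_powR_le _ _ _ mu Ix X (nbox P)
  (fun j => leaf_ker j P) 1 (fun j => \sum_i len i j) mX (mnbox P) _ _ X_generate
  (fun j => measurable_leaf_ker j P) (fun j => @leaf_ker_ge0 j P) _ _ _ _ len_small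
  w (cst 1) 0 (1 + e)
  (4 / (4 `^ (- p) / A') ^+ 2 * (W P * (W P / mass P) `^ e))%:E mw intw
  (measurable_cst _).
have -> : (\int[mu]_(z in nbox P) (w z `^ (1 + e))%:E =
  \int[mu]_(z in nbox P) (`|w z - 0| `^ (1 + e) * cst 1 z)%:E)%E.
  by apply: eq_integral => z _; rewrite subr0 mulr1 gtr0_norm.
apply => //.
- by rewrite mu_nbox ltry.
- by move=> i b; apply: cbox_hyperplane0 => j; rewrite ltW.
- by move=> j z z' /leaf_ker_supp[].
- by move=> j z; rewrite int_leaf_ker lee_fin.
- move=> j z; under eq_integral do rewrite leaf_kerC.
  by rewrite int_leaf_ker lee_fin.
- move=> j z z' /leaf_ker_supp[_ _ /[swap] i /(_ i)/le_trans]; apply.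
  rewrite /= add0n (bigD1 i)//= lerDl; apply: sumr_ge0 => k _; exact: ltW.
- by rewrite addr_gt0.
- by move=> j z; have [M HM] := leaf_ker_bounded j P; exists M.
- by move=> j z Pz; rewrite int_leaf_ker /ind indicE mem_set.
- move=> j; rewrite (eq_integral (fun z => (leaf_avg j P z `^ (1 + e))%:E)).
    by rewrite int_leaf_avg lee_fin cell_sum_le.
  move=> z _; rewrite /Rintegral int_leaf_ker_w /= subr0 mulr1 ger0_norm//.
Qed.

End parabolic_boxes.

(** * Sums of weighted averages over dyadic scales *)

(* Young's inequality for all scalings [k] of the weight is Hoelder's inequality
   up to the factor [2 ^ p]. *)
Lemma scaled_Young_Hoelder (R : realType) (p N F S : R) : 1 < p ->
  0 <= N -> 0 <= F -> 0 <= S ->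
  (forall k, 0 < k -> N <= k * F + k `^ (- (p - 1)^-1) * S) ->
  N `^ p <= 2 `^ p * (F * S `^ (p - 1)).
Proof.
move=> p1 N0 F0 S0 H.
have p0 : 0 < p by rewrite (lt_trans ltr01).
have pm : 0 < p - 1 by rewrite subr_gt0.
have [->|N0'] := eqVneq N 0.
  by rewrite powR0 ?gt_eqF// mulr_ge0 ?powR_ge0// mulr_ge0 ?powR_ge0.
have {N0} N_gt0 : 0 < N by rewrite lt_neqAle eq_sym N0'.
(* If [F] vanishes, the [k] chosen here reduces the bound to N S/(S + 1), less than [N]; if [S]
   vanishes, the one chosen below reduces it to N/2. *)
have [FE|F0'] := eqVneq F 0.
  exfalso; pose k := ((S + 1) / N) `^ (p - 1).
  have S1 : 0 < S + 1 by rewrite ltr_wpDl.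
  have := H k; rewrite FE mulr0 add0r powR_gt0 ?divr_gt0// => /(_ isT).
  rewrite /k -powRrM mulrN divff ?gt_eqF// powR_inv1 ?divr_ge0 ?(ltW S1) ?(ltW N_gt0)//.
  rewrite invf_div mulrAC ler_pdivlMr// leNgt => /negP; apply.
  by rewrite ltr_pM2l// ltrDl.
have {F0} F_gt0 : 0 < F by rewrite lt_neqAle eq_sym F0'.
have [SE|S0'] := eqVneq S 0.
  exfalso; pose k := N / (2 * F).
  have := H k; rewrite SE mulr0 addr0 divr_gt0 ?mulr_gt0// => /(_ isT).
  rewrite /k invfM mulrA divfK// leNgt => /negP; apply.
  by rewrite ltr_pdivrMr// ltr_pMr// ltr1n.
have {S0} S_gt0 : 0 < S by rewrite lt_neqAle eq_sym S0'.
(* At k = (S/F)^((p-1)/p) the two terms balance and both equal [B], so N <= 2 B. *)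
pose B := F `^ p^-1 * S `^ ((p - 1) / p).
have SF : 0 < S / F by rewrite divr_gt0.
have kF : (S / F) `^ ((p - 1) / p) * F = B.
  rewrite powRM ?invr_ge0 ?(ltW S_gt0) ?(ltW F_gt0)// /B mulrC mulrCA mulrC; congr (_ * _).
  rewrite -powR_inv1 ?(ltW F_gt0)// -powRrM -[X in X * _](powRr1 (ltW F_gt0)).
  rewrite -powRD ?(gt_eqF F_gt0) ?implybT//; congr (_ `^ _).
  by field; rewrite gt_eqF.
have kS : ((S / F) `^ ((p - 1) / p)) `^ (- (p - 1)^-1) * S = B.
  rewrite -powRrM (_ : (p - 1) / p * - (p - 1)^-1 = - p^-1); last by field; rewrite !gt_eqF.
  rewrite powRM ?invr_ge0 ?(ltW S_gt0) ?(ltW F_gt0)// /B.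
  rewrite -(powR_inv1 (ltW F_gt0)) -powRrM mulN1r opprK.
  have SE : S `^ (- p^-1) * S = S `^ ((p - 1) / p).
    rewrite -[X in _ * X](powRr1 (ltW S_gt0)) -powRD ?(gt_eqF S_gt0) ?implybT//.
    by congr (_ `^ _); field; rewrite gt_eqF.
  by rewrite -SE; ring.
have := H ((S / F) `^ ((p - 1) / p)); rewrite kF kS powR_gt0// => /(_ isT) NB.
have B0 : 0 <= B by rewrite mulr_ge0 ?powR_ge0.
apply: (@le_trans _ _ ((2 * B) `^ p)).
  apply: ge0_ler_powR; rewrite ?nnegrE ?(ltW p0) ?(ltW N_gt0)//.
    exact: mulr_ge0.
  by apply: le_trans NB _; lra.
rewrite powRM// ler_wpM2l ?powR_ge0// /B powRM ?powR_ge0// -!powRrM.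
by rewrite mulVf ?gt_eqF// powRr1 ?(ltW F_gt0)// divfK ?gt_eqF.
Qed.

(** Compare [h] with (k w)^(-1/(p-1)): up to that value the second term is enough, and beyond it k w
    h^(p-1) >= 1 makes the first term at least [h]. *)
Lemma weight_Young (R : realType) (p k h w : R) : 1 < p -> 0 < k -> 0 <= h -> 0 < w ->
  h <= k * (h `^ p * w) + k `^ (- (p - 1)^-1) * w `^ (- (p - 1)^-1).
Proof.
move=> p1 k0 h0 w0; have p1_gt0 : 0 < p - 1 by rewrite subr_gt0.
rewrite -powRM ?(ltW k0) ?(ltW w0)//.
have kw0 : 0 < k * w by rewrite mulr_gt0.
have [Hle|Hgt] := leP h ((k * w) `^ (- (p - 1)^-1)).
  apply: le_trans Hle _; rewrite lerDr mulr_ge0 ?(ltW k0)//.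
  by rewrite mulr_ge0 ?powR_ge0 ?(ltW w0).
rewrite (@le_trans _ _ (k * (h `^ p * w)))// ?lerDl ?powR_ge0//.
have Hy : 0 < h by apply: le_lt_trans Hgt; exact: powR_ge0.
have h1 : 1 <= k * w * h `^ (p - 1).
  have : ((k * w) `^ (- (p - 1)^-1)) `^ (p - 1) <= h `^ (p - 1).
    by rewrite ge0_ler_powR ?nnegrE ?(ltW p1_gt0) ?powR_ge0 ?(ltW Hgt) ?(ltW Hy).
  rewrite -powRrM mulNr mulVf ?gt_eqF// powR_inv1 ?(ltW kw0)//.
  by rewrite -ler_pdivrMl// mulr1.
rewrite -(@mulr_powRB1 _ h p) ?(ltW Hy) ?(lt_trans ltr01)//.
rewrite (_ : k * _ = h * (k * w * h `^ (p - 1))); last by ring.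
by rewrite ler_peMr// ltW.
Qed.

(** * Averages over parabolic neighbourhoods *)

Section weighted_averages.
Context d (T : measurableType d) (R : realType)
  (mu : {sigma_finite_measure set T -> \bar R}) (Ix : finType)
  (X : Ix -> T -> R) (deg : Ix -> nat).
Hypothesis mX : forall i, measurable_fun [set: T] (X i).
Hypothesis deg_gt0 : forall i, (0 < deg i)%N.

Definition pnb (h : R) (z : T) : set T :=
  [set z' | forall i, `|X i z - X i z'| <= h ^+ deg i].

Lemma pnbC h z z' : pnb h z z' -> pnb h z' z.
Proof. by move=> H i; rewrite distrC; exact: H. Qed.

(** Radius 3 h leaves room for the closed neighbourhood of radius 2 h inside a half-open box. *)
Lemma pnb_pcorner h z : 0 < h ->
  pnb (2 * h) z `<=` pcorner X deg (fun i => X i z - (3 * h) ^+ deg i) (3 * h).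
Proof.
move=> h0 y /= zy i; have := zy i; rewrite ler_norml => /andP[h1 h2].
have lt3 : (2 * h) ^+ deg i < (3 * h) ^+ deg i.
  by rewrite ltrXn2r ?nnegrE ?mulr_ge0 ?(ltW h0)// -?lt0n// ltr_pM2r// ltr_nat.
move: lt3 h1 h2; move: ((2 * h) ^+ deg i) ((3 * h) ^+ deg i) (X i z) (X i y) => *.
by apply/andP; split; lra.
Qed.

(** All degrees are at least 1, so 2 h^deg <= (2 h)^deg. *)
Lemma pnb_trans h z z' y : 0 < h -> pnb h z z' -> pnb h z y -> pnb (2 * h) z' y.
Proof.
move=> h0 zz' zy i; rewrite (@le_trans _ _ (h ^+ deg i + h ^+ deg i))//.
  rewrite (_ : _ - _ = (X i z' - X i z) + (X i z - X i y)); last by ring.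
  by rewrite (le_trans (ler_normD _ _))// lerD// distrC.
rewrite (_ : _ + _ = 2 * h ^+ deg i); last by ring.
rewrite exprMn ler_wpM2r ?exprn_ge0 ?(ltW h0)//.
by rewrite -[leLHS]expr1 ler_weXn2l// ler1n.
Qed.

Lemma pnbS h z : 0 < h -> pnb h z `<=` pnb (2 * h) z.
Proof.
move=> h0 y zy i; apply: le_trans (zy i) _.
by rewrite lerXn2r ?nnegrE ?mulr_ge0 ?(ltW h0)// ler_peMl ?(ltW h0)// ler1n.
Qed.

Lemma measurable_pnb2 h : measurable [set zz : T * T | pnb h zz.1 zz.2].
Proof.
have -> : [set zz : T * T | pnb h zz.1 zz.2] = \bigcap_(i in [set: Ix])
    ((fun zz : T * T => `|X i zz.1 - X i zz.2|) @^-1` [set` `]-oo, h ^+ deg i]]).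
  apply/seteqP; split => [zz H i _ /=|zz H i]; first by rewrite in_itv /=; exact: H.
  by have := H i Logic.I; rewrite /= in_itv.
apply: fin_bigcap_measurable => // i _.
rewrite -[X in measurable X]setTI.
have : measurable_fun [set: T * T] (fun zz : T * T => `|X i zz.1 - X i zz.2|).
  apply: measurableT_comp => //; apply: measurable_funB.
    exact: measurableT_comp (mX i) measurable_fst.
  exact: measurableT_comp (mX i) measurable_snd.
by apply.
Qed.

Let ind h (zz : T * T) : R := \1_[set zz : T * T | pnb h zz.1 zz.2] zz.

Let mind h : measurable_fun [set: T * T] (ind h).
Proof. by apply: measurable_indic; exact: measurable_pnb2. Qed.

Let ind_ge0 h zz : 0 <= ind h zz.
Proof. by rewrite /ind indicE. Qed.

Let ind_neq0 h z z' : ind h (z, z') != 0 -> pnb h z z'.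
Proof.
rewrite /ind indicE; have [zz' _|] := boolP ((z, z') \in _); last by rewrite eqxx.
exact: (set_mem zz').
Qed.

Lemma measurable_pnb h z : measurable (pnb h z).
Proof.
have := measurable_xsection z (measurable_pnb2 h).
suff -> : xsection [set zz : T * T | pnb h zz.1 zz.2] z = pnb h z by [].
by apply/seteqP; split => y; rewrite xsectionE/=.
Qed.

Let int_pnb h z (f : T -> R) :
  (\int[mu]_(y in pnb h z) (f y)%:E = \int[mu]_y (ind h (z, y) * f y)%:E)%E.
Proof.
rewrite integral_mkcond; apply: eq_integral => y _; rewrite patchE /ind indicE.
have [zy|zy] := boolP (y \in pnb h z).
  by rewrite mem_set ?mul1r//; exact: set_mem.
by rewrite memNset ?mul0r// => zy'; move: zy; rewrite notin_setE.
Qed.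

Lemma measurable_int_pnb h (f : T -> R) : measurable_fun setT f ->
  measurable_fun setT (fun z => \int[mu]_(y in pnb h z) f y).
Proof.
move=> mf.
have -> : (fun z => \int[mu]_(y in pnb h z) f y) =
    (fun z => \int[mu]_y (ind h (z, y) * f y)).
  by apply/funext => z; rewrite /Rintegral int_pnb.
apply: (@measurable_Rintegral_snd _ _ _ _ _ mu (fun z y => ind h (z, y) * f y)).
apply: measurable_funM; last exact: measurableT_comp mf measurable_snd.
by apply: eq_measurable_fun (mind h) => -[].
Qed.

Context (w : T -> R) (p A K g h : R).
Hypothesis mw : measurable_fun [set: T] w.
Hypothesis w_gt0 : forall z, 0 < w z.
Hypothesis p_gt1 : 1 < p.
Hypothesis A_ge0 : 0 <= A.
Hypothesis K_ge0 : 0 <= K.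
Hypothesis g_gt1 : 1 < g.
Hypothesis h_gt0 : 0 < h.
Let sg (z : T) : R := w z `^ (- (p - 1)^-1).
Let m : R := \prod_i (2 * (3 * h) ^+ deg i).
Hypothesis sg_lty : forall a,
  (\int[mu]_(z in pcorner X deg a (3 * h)) (w z `^ (- (p - 1)^-1))%:E < +oo)%E.
Hypothesis Ap : forall a,
  (\int[mu]_(z in pcorner X deg a (3 * h)) w z) *
  (\int[mu]_(z in pcorner X deg a (3 * h)) w z `^ (- (p - 1)^-1)) `^ (p - 1) <=
  A * m `^ p.
Hypothesis RH : forall a,
  (\int[mu]_(z in pcorner X deg a (3 * h)) (w z `^ g)%:E <=
   (K * ((\int[mu]_(z in pcorner X deg a (3 * h)) w z) `^ g * m `^ (1 - g)))%:E)%E.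

Context (H : T -> R) (F : R).
Hypothesis mH : measurable_fun [set: T] H.
Hypothesis H_ge0 : forall z, 0 <= H z.
Hypothesis HF : (\int[mu]_z (H z `^ p * w z)%:E = F%:E)%E.

Let p_gt0 : 0 < p. Proof. by rewrite (lt_trans ltr01). Qed.
Let p1_gt0 : 0 < p - 1. Proof. by rewrite subr_gt0. Qed.
Let g_gt0 : 0 < g. Proof. by rewrite (lt_trans ltr01). Qed.

Let m_gt0 : 0 < m.
Proof. by apply: prodr_gt0 => i _; rewrite mulr_gt0// exprn_gt0// mulr_gt0. Qed.

Let msg : measurable_fun [set: T] sg.
Proof. exact: measurable_fun_powR. Qed.

Let sg_ge0 z : 0 <= sg z. Proof. exact: powR_ge0. Qed.

Let G (z : T) : R := H z `^ p * w z.

Let mG : measurable_fun [set: T] G.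
Proof. by apply: measurable_funM => //; exact: measurable_fun_powR. Qed.

Let G_ge0 z : 0 <= G z.
Proof. by rewrite mulr_ge0 ?powR_ge0// ltW. Qed.

Let F_ge0 : 0 <= F.
Proof.
by rewrite -lee_fin -HF; apply: integral_ge0 => z _; rewrite lee_fin; exact: G_ge0.
Qed.

Let S (k : R) (z : T) : R := \int[mu]_(y in pnb k z) sg y.
Let N (z : T) : R := \int[mu]_(y in pnb h z) H y.
Let Fh (z : T) : R := \int[mu]_(y in pnb h z) G y.

Let mE (f : T -> R) (D : set T) : measurable_fun setT f ->
  measurable_fun D (fun z => (f z)%:E).
Proof. by move=> mf; apply/measurable_EFinP; exact: measurable_funTS. Qed.

Let pnb_lty (f : T -> R) k z : k = h \/ k = 2 * h -> measurable_fun setT f ->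
  (forall z, 0 <= f z) ->
  (\int[mu]_(y in pcorner X deg (fun i => (X i z - (3 * h) ^+ deg i)%R) (3 * h))
    (f y)%:E < +oo)%E ->
  (\int[mu]_(y in pnb k z) (f y)%:E)%E \is a fin_num.
Proof.
move=> kE mf f0 foo; rewrite ge0_fin_numE; last first.
  by apply: integral_ge0 => y _; rewrite lee_fin.
apply: le_lt_trans foo; apply: ge0_subset_integral => //.
- exact: measurable_pnb.
- exact: measurable_cbox.
- exact: mE.
- by move=> y _; rewrite lee_fin.
apply: subset_trans (@pnb_pcorner h z h_gt0).
by case: kE => ->//; exact: pnbS.
Qed.

Let S_fin k z : k = h \/ k = 2 * h ->
  (\int[mu]_(y in pnb k z) (sg y)%:E)%E \is a fin_num.
Proof. by move=> kE; apply: pnb_lty => //; exact: sg_lty. Qed.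

Let Fh_fin z : (\int[mu]_(y in pnb h z) (G y)%:E)%E \is a fin_num.
Proof.
rewrite ge0_fin_numE; last by apply: integral_ge0 => y _; rewrite lee_fin.
apply: (@le_lt_trans _ _ F%:E); last exact: ltry.
rewrite -HF; apply: ge0_subset_integral => //; first exact: measurable_pnb.
  exact: mE.
by move=> y _; rewrite lee_fin.
Qed.

Let Fh_le z : Fh z <= F.
Proof.
rewrite -lee_fin fineK// -HF; apply: ge0_subset_integral => //.
- exact: measurable_pnb.
- exact: mE.
- by move=> y _; rewrite lee_fin.
Qed.

Let Fh_ge0 z : 0 <= Fh z.
Proof. exact: Rintegral_ge0. Qed.

Let S_ge0 k z : 0 <= S k z.
Proof. exact: Rintegral_ge0. Qed.

Let Young_pt k y : 0 < k -> H y <= k * G y + k `^ (- (p - 1)^-1) * sg y.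
Proof. by move=> k0; exact: weight_Young. Qed.

Let N_le_ereal z k : 0 < k -> (\int[mu]_(y in pnb h z) (H y)%:E <=
  (k * Fh z + k `^ (- (p - 1)^-1) * S h z)%:E)%E.
Proof.
move=> k0.
have Sf : (\int[mu]_(y in pnb h z) (sg y)%:E)%E \is a fin_num by apply: S_fin; left.
rewrite EFinD !EFinM !fineK//.
rewrite -!ge0_integralZl ?lee_fin ?powR_ge0 ?(ltW k0)//; try
  by [exact: measurable_pnb|exact: mE|move=> y _; rewrite lee_fin].
rewrite -ge0_integralD//; try by [exact: measurable_pnb
  |move=> y _; rewrite lee_fin mulr_ge0 ?powR_ge0 ?(ltW k0)
  |apply/measurable_EFinP; apply: measurable_funM => //; exact: measurable_funTS].
apply: ge0_le_integral_nomeas => y _; first by rewrite lee_fin.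
by rewrite -EFinD lee_fin Young_pt.
Qed.

Lemma int_pnb_fin z : (\int[mu]_(y in pnb h z) (H y)%:E)%E \is a fin_num.
Proof.
rewrite ge0_fin_numE; last by apply: integral_ge0 => y _; rewrite lee_fin.
exact: le_lt_trans (N_le_ereal z ltr01) (ltry _).
Qed.

Let N_ge0 z : 0 <= N z. Proof. exact: Rintegral_ge0. Qed.

Let N_pow z : N z `^ p <= 2 `^ p * (Fh z * S h z `^ (p - 1)).
Proof.
apply: scaled_Young_Hoelder => // k k0.
by rewrite -lee_fin fineK ?int_pnb_fin ?N_le_ereal.
Qed.

(** Hoelder's inequality leaves a dual integral around [z]. Enlarging it to the neighbourhood of
    radius 2 h around [z'] separates the variables, except for the indicator that [z] and [z'] are
    close. *)
Let Cz (z' : T) : R := G z' * (S (2 * h) z' `^ ((p - 1) * g)).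

Let mCz : measurable_fun [set: T] Cz.
Proof.
apply: measurable_funM => //; apply: measurable_fun_powR.
exact: measurable_int_pnb.
Qed.

Let Cz_ge0 z : 0 <= Cz z. Proof. by rewrite mulr_ge0 ?powR_ge0. Qed.

Let powg x y : 0 <= x -> x <= y -> x `^ g <= y `^ g.
Proof.
by move=> x0 xy; rewrite ge0_ler_powR ?nnegrE ?(ltW g_gt0)// (le_trans x0).
Qed.

Let mono4 (i x b c y : R) : 0 <= i -> 0 <= x -> 0 <= y ->
  (i != 0 -> b <= c) -> i * x * (b * y) <= i * (x * c) * y.
Proof.
move=> i0 x0 y0 bc; have [->|/bc {}bc] := eqVneq i 0; first by rewrite !mul0r.
by rewrite mulrA ler_wpM2r// -mulrA ler_wpM2l// ler_wpM2l.
Qed.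

Let ker_ge0 z z' : 0 <= ind h (z, z') * Cz z' * w z `^ g.
Proof. exact: mulr_ge0 (mulr_ge0 (ind_ge0 _ _) (Cz_ge0 _)) (powR_ge0 _ _). Qed.

Let S_mono z z' : pnb h z z' -> S h z <= S (2 * h) z'.
Proof.
move=> zz'; rewrite fine_le ?S_fin//; [by left|by right|].
apply: ge0_subset_integral => //; [exact: measurable_pnb..|exact: mE| |].
- by move=> y _; rewrite lee_fin.
- by move=> y; exact: pnb_trans.
Qed.

(** Hoelder's inequality gives N^(p g) <= 2^(p g) (Fh S^(p-1))^g. Bounding Fh^g by F^(g-1) Fh keeps
    one linear factor [Fh], an integral in [z'] to which Tonelli can be applied. *)
Let step1 z : ((N z `^ (p * g) * w z `^ g)%:E <=
  (2 `^ (p * g) * F `^ (g - 1))%:E *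
  \int[mu]_z' (ind h (z, z') * Cz z' * w z `^ g)%:E)%E.
Proof.
apply: (@le_trans _ _ ((2 `^ (p * g) * F `^ (g - 1))%:E *
    ((Fh z)%:E * (S h z `^ ((p - 1) * g) * w z `^ g)%:E))%E).
  rewrite -!EFinM lee_fin !mulrA ler_wpM2r ?powR_ge0// powRrM.
  apply: (@le_trans _ _ ((2 `^ p * (Fh z * S h z `^ (p - 1))) `^ g)).
    by rewrite ge0_ler_powR ?nnegrE ?(ltW g_gt0) ?powR_ge0 ?mulr_ge0 ?powR_ge0.
  rewrite !powRM ?mulr_ge0 ?powR_ge0// -!powRrM -!mulrA ler_wpM2l ?powR_ge0//.
  rewrite !mulrA ler_wpM2r ?powR_ge0//.
  have [->|Fz] := eqVneq (Fh z) 0.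
    by rewrite powR0 ?gt_eqF// mulr0.
  have Fz0 : 0 < Fh z by rewrite lt_neqAle eq_sym Fz Fh_ge0.
  rewrite -(mulr_powRB1 (Fh_ge0 z) g_gt0) mulrC ler_wpM2r ?Fh_ge0//.
  by rewrite ge0_ler_powR ?nnegrE ?subr_ge0 ?(ltW g_gt1) ?Fh_ge0 ?F_ge0 ?Fh_le.
apply: lee_wpmul2l; first by rewrite lee_fin mulr_ge0 ?powR_ge0.
rewrite fineK// int_pnb -ge0_integralZr//.
- apply: ge0_le_integral_nomeas => z' _.
    rewrite -EFinM lee_fin; apply: mulr_ge0; apply: mulr_ge0;
      by rewrite ?ind_ge0 ?G_ge0 ?powR_ge0.
  rewrite -EFinM lee_fin; apply: (mono4 (ind_ge0 _ _) (G_ge0 _) (powR_ge0 _ _)).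
  move=> /ind_neq0 zz'; apply: ge0_ler_powR; rewrite ?nnegrE ?S_ge0//.
    exact: mulr_ge0 (ltW p1_gt0) (ltW g_gt0).
  exact: S_mono.
- apply/measurable_EFinP; apply: measurable_funM => //.
  exact: (measurableT_comp (mind h) (pair1_measurable z)).
- by move=> z' _; rewrite lee_fin mulr_ge0.
- by rewrite lee_fin mulr_ge0 ?powR_ge0.
Qed.

Let mwg : measurable_fun [set: T] (fun z => w z `^ g).
Proof. exact: measurable_fun_powR. Qed.

Let alg (x s k a b b' c : R) : 0 <= x -> 0 <= k -> 0 <= c -> a * s <= b * b' ->
  x * s * (k * (a * c)) <= k * b * (b' * c) * x.
Proof.
move=> x0 k0 c0 asb.
rewrite [leLHS](_ : _ = k * c * x * (a * s)); last by ring.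
rewrite [leRHS](_ : _ = k * c * x * (b * b')); last by ring.
by rewrite ler_wpM2l// !mulr_ge0.
Qed.

(** All [z] close to [z'] lie in one cube of radius 3 h. There the reverse Hoelder inequality
    replaces the integral of w^g by a power of the integral of [w], which the A_p condition pairs
    with the dual integral in [Cz]. *)
Let step2 z' : (\int[mu]_z (ind h (z, z') * Cz z' * w z `^ g)%:E <=
  (K * A `^ g * m `^ (p * g + (1 - g)))%:E * (G z')%:E)%E.
Proof.
pose a i := X i z' - (3 * h) ^+ deg i.
pose Wa := \int[mu]_(z in pcorner X deg a (3 * h)) w z.
pose Sa := \int[mu]_(z in pcorner X deg a (3 * h)) w z `^ (- (p - 1)^-1).
have sub2 : pnb (2 * h) z' `<=` pcorner X deg a (3 * h) by exact: pnb_pcorner.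
have SS : S (2 * h) z' <= Sa.
  rewrite fine_le ?S_fin//; first by right.
    rewrite ge0_fin_numE ?sg_lty//.
    by apply: integral_ge0 => y _; rewrite lee_fin powR_ge0.
  apply: ge0_subset_integral => //; [exact: measurable_pnb|exact: measurable_cbox
    |exact: mE|by move=> y _; rewrite lee_fin].
apply: (@le_trans _ _ ((Cz z')%:E *
    \int[mu]_(z in pcorner X deg a (3 * h)) (w z `^ g)%:E)%E).
  rewrite -ge0_integralZl//; last 4 first.
  - exact: measurable_cbox.
  - exact: mE.
  - by move=> y _; rewrite lee_fin powR_ge0.
  - by rewrite lee_fin.
  rewrite [leRHS]integral_mkcond; apply: ge0_le_integral_nomeas => z _.
    by rewrite lee_fin ker_ge0.
  rewrite patchE /ind indicE; have [zz'|zz'] := boolP ((z, z') \in _).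
    rewrite mem_set; first by rewrite mul1r.
    by apply: sub2; apply: pnbS => //; apply: pnbC; exact: (set_mem zz').
  rewrite !mul0r; case: ifP => // _.
  by rewrite -EFinM lee_fin mulr_ge0 ?powR_ge0.
apply: (@le_trans _ _ ((Cz z')%:E * (K * (Wa `^ g * m `^ (1 - g)))%:E)%E).
  by apply: lee_wpmul2l; [rewrite lee_fin|exact: RH].
rewrite -!EFinM lee_fin /Cz.
have Wa0 : 0 <= Wa by apply: Rintegral_ge0 => y _; exact: ltW.
have Sa0 : 0 <= Sa by apply: Rintegral_ge0 => y _; exact: powR_ge0.
have ApW : (Wa * Sa `^ (p - 1)) `^ g <= A `^ g * m `^ (p * g).
  rewrite powRrM -(powRM _ A_ge0 (powR_ge0 _ _)).
  exact: powg (mulr_ge0 Wa0 (powR_ge0 _ _)) (Ap a).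
rewrite (@powRD _ m (p * g) (1 - g)); last by rewrite (gt_eqF m_gt0) implybT.
apply: (alg (G_ge0 _) K_ge0 (powR_ge0 _ _)).
apply: le_trans ApW; rewrite (powRM _ Wa0 (powR_ge0 _ _)) -powRrM.
apply: (ler_wpM2l (powR_ge0 _ _)); apply: ge0_ler_powR; rewrite ?nnegrE ?S_ge0//.
exact: mulr_ge0 (ltW p1_gt0) (ltW g_gt0).
Qed.

(** The two steps combine after an exchange of integrals; F^(g-1) from the first one and the
    integral [F] of [G] from the second one make F^g. *)
Theorem weighted_average_bound :
  (\int[mu]_z ((\int[mu]_(y in pnb h z) H y) `^ (p * g) * w z `^ g)%R%:E <=
   (2 `^ (p * g) * K * A `^ g * F `^ g * m `^ (p * g + (1 - g)))%:E)%E.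
Proof.
have mker : measurable_fun [set: T * T]
    (fun zz : T * T => (ind h (zz.1, zz.2) * Cz zz.2 * w zz.1 `^ g)%:E).
  apply/measurable_EFinP; apply: measurable_funM.
    apply: measurable_funM; first by apply: eq_measurable_fun (mind h) => -[].
    exact: measurableT_comp mCz measurable_snd.
  exact: measurableT_comp mwg measurable_fst.
have ker0 z z' : (0 <= (ind h (z, z') * Cz z' * w z `^ g)%:E)%E.
  by rewrite lee_fin ker_ge0.
apply: (@le_trans _ _ (\int[mu]_z ((2 `^ (p * g) * F `^ (g - 1))%:E *
  \int[mu]_z' (ind h (z, z') * Cz z' * w z `^ g)%:E))%E).
  apply: ge0_le_integral_nomeas => z _; first by rewrite lee_fin mulr_ge0 ?powR_ge0.
  exact: step1.
rewrite ge0_integralZl//; last 3 first.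
- exact: (measurable_integral_snd mu mker ker0).
- by move=> z _; apply: integral_ge0.
- by rewrite lee_fin mulr_ge0 ?powR_ge0.
rewrite (tonelli_swap mu mu mker ker0).
apply: (@le_trans _ _ ((2 `^ (p * g) * F `^ (g - 1))%:E *
  ((K * A `^ g * m `^ (p * g + (1 - g)))%:E * F%:E))%E).
  apply: lee_wpmul2l; first by rewrite lee_fin mulr_ge0 ?powR_ge0.
  rewrite -HF -ge0_integralZl//; last 3 first.
  - exact: mE.
  - by move=> z _; rewrite lee_fin; exact: G_ge0.
  - by rewrite lee_fin !mulr_ge0 ?powR_ge0.
  apply: ge0_le_integral_nomeas => z' _; first by apply: integral_ge0.
  exact: step2.
rewrite -!EFinM lee_fin -(mulr_powRB1 F_ge0 g_gt0).
by rewrite le_eqVlt; apply/orP; left; apply/eqP; ring.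
Qed.

End weighted_averages.

(** * Summation over dyadic scales *)

Lemma powR_midpoint (R : realType) (q a b : R) : 1 <= q -> 0 <= a -> 0 <= b ->
  (2^-1 * a + 2^-1 * b) `^ q <= 2^-1 * a `^ q + 2^-1 * b `^ q.
Proof.
move=> q1 a0 b0.
rewrite {2 4}(_ : 2^-1 = 1 - 2^-1); last by rewrite {2}(splitr 1) div1r addrK.
by apply: (convex_powR q1 (Itv01 _ _)) => //=;
  rewrite ?inE/= ?in_itv/= ?a0 ?b0// ?invr_ge0// invf_le1 ?ler1n.
Qed.

(** Iterated convexity: x 0 plus half of the remaining sum is the midpoint of 2 x 0 and that sum.
    The weights 2^-(j+1) keep a geometric gain after the power has been taken. *)
Lemma powR_dyadic_sum (R : realType) (q : R) (x : nat -> R) (J : nat) : 1 <= q ->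
  (forall j, 0 <= x j) ->
  (\sum_(j < J) 2^-1 ^+ j * x j) `^ q <=
  \sum_(j < J) 2^-1 ^+ j.+1 * (2 * x j) `^ q.
Proof.
move=> q1; elim: J x => [|J IH] x x0.
  by rewrite !big_ord0 powR0// gt_eqF// (lt_le_trans ltr01).
rewrite !big_ord_recl /= expr0 mul1r expr1.
have -> : x 0%N + \sum_(i < J) 2^-1 ^+ bump 0 i * x (bump 0 i) =
    2^-1 * (2 * x 0%N) + 2^-1 * \sum_(i < J) 2^-1 ^+ i * x i.+1.
  rewrite mulrA mulVf// mul1r mulr_sumr; congr (_ + _); apply: eq_bigr => i _.
  by rewrite /bump leq0n add1n exprS mulrA.
apply: le_trans (powR_midpoint _ _ _) _ => //.
- by rewrite mulr_ge0.
- by apply: sumr_ge0 => i _; rewrite mulr_ge0// exprn_ge0// invr_ge0.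
rewrite lerD2l; apply: (@le_trans _ _
    (2^-1 * \sum_(j < J) 2^-1 ^+ j.+1 * (2 * x j.+1) `^ q)).
  by rewrite ler_wpM2l ?invr_ge0//; exact: (IH (fun j => x j.+1)).
rewrite mulr_sumr le_eqVlt; apply/orP; left; apply/eqP; apply: eq_bigr => i _.
by rewrite /bump leq0n add1n mulrA -exprS.
Qed.

(** The ratio is 3/4: the gain 1/2 per scale against the loss 3/2 that [g_small] allows. *)
Lemma sum_geometric_le (R : realType) (J : nat) :
  \sum_(j < J) (2^-1 : R) ^+ j.+1 * (3 / 2) ^+ j <= 2.
Proof.
suff -> : \sum_(j < J) (2^-1 : R) ^+ j.+1 * (3 / 2) ^+ j = 2 * (1 - (3 / 4) ^+ J).
  by rewrite ler_piMr// gerBl exprn_ge0.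
elim: J => [|J IH]; first by rewrite big_ord0 expr0 subrr mulr0.
rewrite big_ord_recr /= IH exprS -mulrA -exprMn (_ : 2^-1 * (3 / 2) = 3 / 4 :> R);
  last by field.
by rewrite exprS; field.
Qed.

Section dyadic_chain.
Context d (T : measurableType d) (R : realType)
  (mu : {sigma_finite_measure set T -> \bar R}) (Ix : finType)
  (X : Ix -> T -> R) (deg : Ix -> nat).
Hypothesis mX : forall i, measurable_fun [set: T] (X i).
Hypothesis deg_gt0 : forall i, (0 < deg i)%N.
Context (w : T -> R) (p A K g : R).
Hypothesis mw : measurable_fun [set: T] w.
Hypothesis w_gt0 : forall z, 0 < w z.
Hypothesis p_gt1 : 1 < p.
Hypothesis A_ge0 : 0 <= A.
Hypothesis K_ge0 : 0 <= K.
Hypothesis g_gt1 : 1 < g.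
Hypothesis sg_lty : forall a t, 0 < t ->
  (\int[mu]_(z in pcorner X deg a t) (w z `^ (- (p - 1)^-1))%:E < +oo)%E.
Hypothesis Ap : forall a t, 0 < t ->
  (\int[mu]_(z in pcorner X deg a t) w z) *
  (\int[mu]_(z in pcorner X deg a t) w z `^ (- (p - 1)^-1)) `^ (p - 1) <=
  A * (\prod_i (2 * t ^+ deg i)) `^ p.
Hypothesis RH : forall a t, 0 < t ->
  (\int[mu]_(z in pcorner X deg a t) (w z `^ g)%:E <=
   (K * ((\int[mu]_(z in pcorner X deg a t) w z) `^ g *
         (\prod_i (2 * t ^+ deg i)) `^ (1 - g)))%:E)%E.

Context (H : T -> R) (F : R).
Hypothesis mH : measurable_fun [set: T] H.
Hypothesis H_ge0 : forall z, 0 <= H z.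
Hypothesis HF : (\int[mu]_z (H z `^ p * w z)%:E = F%:E)%E.

Let Ns := (\sum_i deg i)%N.
Hypothesis g_small : 2 `^ (Ns%:R * (g - 1)) <= 3 / 2.

Context (D : set T) (V : nat -> T -> R) (c r C0 : R).
Hypothesis r_gt0 : 0 < r.
Hypothesis C0_ge0 : 0 <= C0.
Let e (j : nat) : R := r / 2 ^+ j.
Hypothesis V0 : forall z, D z -> V 0%N z = c.
Hypothesis V_step : forall j z, D z -> `|V j.+1 z - V j z| <=
  C0 * e j / e j ^+ Ns * \int[mu]_(y in pnb X deg (2 * e j) z) H y.

Let q := p * g.
Let N j z := \int[mu]_(y in pnb X deg (2 * e j) z) H y.
(** The 6 is 3 times 2: neighbourhoods of radius 2 e are enclosed in cubes of radius 3 (2 e). *)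
Let M : R := \prod_i (2 * 6 ^+ deg i).

Let e_gt0 j : 0 < e j. Proof. by rewrite divr_gt0// exprn_gt0. Qed.
Let g_gt0 : 0 < g. Proof. by rewrite (lt_trans ltr01). Qed.
Let p_gt0 : 0 < p. Proof. by rewrite (lt_trans ltr01). Qed.
Let q_gt0 : 0 < q. Proof. exact: mulr_gt0. Qed.
Let q_ge1 : 1 <= q.
Proof. by rewrite -[1]mulr1 ler_pM// ltW. Qed.

Let N_ge0 j z : 0 <= N j z. Proof. exact: Rintegral_ge0. Qed.

Let F_ge0 : 0 <= F.
Proof.
rewrite -lee_fin -HF; apply: integral_ge0 => z _.
by rewrite lee_fin mulr_ge0 ?powR_ge0// ltW.
Qed.

Let M_gt0 : 0 < M.
Proof. by apply: prodr_gt0 => i _; rewrite mulr_gt0// exprn_gt0. Qed.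

Let prod_scale j : \prod_i (2 * (3 * (2 * e j)) ^+ deg i) = M * e j ^+ Ns.
Proof.
rewrite /M /Ns -prodrXr -big_split /=; apply: eq_bigr => i _.
rewrite mulrA -(natrM _ 3 2) -mulrA exprMn; congr (_ * _).
Qed.

Let Ngw_bound j : (\int[mu]_z (N j z `^ q * w z `^ g)%:E <=
  (2 `^ q * K * A `^ g * F `^ g * (M * e j ^+ Ns) `^ (q + (1 - g)))%:E)%E.
Proof.
have h0 : 0 < 2 * e j by rewrite mulr_gt0.
have h3 : 0 < 3 * (2 * e j) by rewrite mulr_gt0.
rewrite -prod_scale; apply: (@weighted_average_bound _ _ _ mu Ix X deg) => //.
- by move=> a; exact: sg_lty.
- by move=> a; exact: Ap.
- by move=> a; exact: RH.
Qed.

(** Telescoping from V 0 = c. The factor e j = r / 2^j in [V_step] supplies the weight 2^-j for the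
    convexity inequality. *)
Let chain_pt J z : D z -> `|V J z - c| `^ q <=
  \sum_(j < J) 2^-1 ^+ j.+1 * (2 * (C0 * r / e j ^+ Ns * N j z)) `^ q.
Proof.
move=> Dz.
have x0 j : 0 <= C0 * r / e j ^+ Ns * N j z.
  by rewrite mulr_ge0// divr_ge0 ?exprn_ge0 ?(ltW (e_gt0 _))// mulr_ge0// ltW.
apply: le_trans (powR_dyadic_sum J q_ge1 x0).
apply: ge0_ler_powR; rewrite ?nnegrE ?(ltW q_gt0)//.
  by apply: sumr_ge0 => j _; rewrite mulr_ge0 ?x0// exprn_ge0// invr_ge0.
elim: J => [|J IH]; first by rewrite V0// subrr normr0 big_ord0.
rewrite big_ord_recr /= (_ : V J.+1 z - c = (V J z - c) + (V J.+1 z - V J z)); last by ring.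
apply: le_trans (ler_normD _ _) _; apply: lerD => //.
apply: le_trans (V_step J Dz) _; rewrite -/(N J z) /e exprVn.
by rewrite le_eqVlt; apply/orP; left; apply/eqP; ring.
Qed.

Let mN j : measurable_fun [set: T] (N j).
Proof. exact: measurable_int_pnb. Qed.

Let const : R := 2 `^ q * C0 `^ q * (2 `^ q * K * A `^ g) * M `^ (q + (1 - g)).

(** The division by e^Ns in the average cancels the power q of the measure. What remains,
    (e^Ns)^(1-g), exceeds its value at scale [r] by the factor 2^(j Ns (g-1)) <= (3/2)^j. *)
Let coef j : (2 * (C0 * r / e j ^+ Ns)) `^ q *
   (2 `^ q * K * A `^ g * F `^ g * (M * e j ^+ Ns) `^ (q + (1 - g))) <=
  const * (r `^ q * F `^ g * (r ^+ Ns) `^ (1 - g)) * (3 / 2) ^+ j.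
Proof.
have eN : 0 < e j ^+ Ns by rewrite exprn_gt0.
rewrite !powRM ?mulr_ge0 ?invr_ge0 ?(ltW eN) ?(ltW r_gt0) ?(ltW M_gt0)//.
rewrite -(powR_inv1 (ltW eN)) -powRrM mulN1r.
rewrite (@powRD _ (e j ^+ Ns)); last by rewrite (gt_eqF eN) implybT.
have eE : (e j ^+ Ns) `^ (1 - g) <= (r ^+ Ns) `^ (1 - g) * (3 / 2) ^+ j.
  rewrite /e expr_div_n powRM ?invr_ge0 ?exprn_ge0 ?(ltW r_gt0)//.
  rewrite ler_wpM2l ?powR_ge0// -[X in X `^ _ <= _]powR_inv1 ?exprn_ge0//.
  rewrite -powRrM mulN1r opprB.
  rewrite -exprM mulnC exprM -powR_mulrn ?exprn_ge0// -powRrM.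
  rewrite -(@powR_mulrn _ 2 Ns)// -powRrM.
  rewrite (_ : Ns%:R * (j%:R * (g - 1)) = (Ns%:R * (g - 1)) * j%:R); last by ring.
  rewrite powRrM powR_mulrn ?powR_ge0//.
  by rewrite lerXn2r ?nnegrE ?powR_ge0.
have enn : (e j ^+ Ns) `^ (- q) * (e j ^+ Ns) `^ q = 1.
  by rewrite powRN mulVf// gt_eqF// powR_gt0.
rewrite [leLHS](_ : _ = const * (r `^ q * F `^ g) *
  ((e j ^+ Ns) `^ (- q) * (e j ^+ Ns) `^ q) * (e j ^+ Ns) `^ (1 - g)); last first.
  by rewrite /const; ring.
rewrite enn mulr1 [leRHS](_ : _ = const * (r `^ q * F `^ g) *
  ((r ^+ Ns) `^ (1 - g) * (3 / 2) ^+ j)); last by ring.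
by rewrite ler_wpM2l// !mulr_ge0 ?powR_ge0.
Qed.

Theorem dyadic_chain_bound J :
  (\int[mu]_(z in D) (`|V J z - c| `^ (p * g) * w z `^ g)%:E <=
   (2 * (2 `^ (p * g) * C0 `^ (p * g) * (2 `^ (p * g) * K * A `^ g) *
      (\prod_i (2 * 6 ^+ deg i)) `^ (p * g + (1 - g))) *
     (r `^ (p * g) * F `^ g * (r ^+ (\sum_i deg i)%N) `^ (1 - g)))%:E)%E.
Proof.
rewrite -/q -/M -/const -/Ns.
have t0 (j : 'I_J) z : 0 <= 2^-1 ^+ j.+1 *
    ((2 * (C0 * r / e j ^+ Ns * N j z)) `^ q * w z `^ g).
  by rewrite !mulr_ge0 ?powR_ge0// exprn_ge0// invr_ge0.
apply: (@le_trans _ _ (\int[mu]_z (\sum_(j < J) (2^-1 ^+ j.+1 *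
    ((2 * (C0 * r / e j ^+ Ns * N j z)) `^ q * w z `^ g))%:E))%E).
  rewrite integral_mkcond; apply: ge0_le_integral_nomeas => z _; rewrite patchE;
    case: ifPn => // Dz.
  - by rewrite lee_fin mulr_ge0 ?powR_ge0.
  - rewrite sumEFin lee_fin; rewrite (eq_bigr (fun j : 'I_J => 2^-1 ^+ j.+1 *
      (2 * (C0 * r / e j ^+ Ns * N j z)) `^ q * w z `^ g)); last first.
      by move=> j _; exact: mulrA.
    rewrite -mulr_suml ler_wpM2r ?powR_ge0//.
    by apply: chain_pt; exact: set_mem.
  - by apply: sume_ge0 => j _; rewrite lee_fin.
have mterm (j : 'I_J) : measurable_fun [set: T] (fun z => (2^-1 ^+ j.+1 *
    ((2 * (C0 * r / e j ^+ Ns * N j z)) `^ q * w z `^ g))%:E).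
  apply/measurable_EFinP; apply: measurable_funM => //; apply: measurable_funM.
    by apply: measurable_fun_powR; apply: measurable_funM => //; exact: measurable_funM.
  exact: measurable_fun_powR.
rewrite ge0_integral_sum//; last by move=> j z _; rewrite lee_fin.
pose Z := const * (r `^ q * F `^ g * (r ^+ Ns) `^ (1 - g)).
have Z0 : 0 <= Z by rewrite !mulr_ge0 ?powR_ge0.
apply: (@le_trans _ _ (\sum_(j < J) (Z * (2^-1 ^+ j.+1 * (3 / 2) ^+ j))%:E)%E).
  apply: lee_sum => j _.
  have cj : 0 <= C0 * r / e j ^+ Ns.
    by rewrite divr_ge0 ?exprn_ge0 ?(ltW (e_gt0 _))// mulr_ge0// ltW.
  rewrite (eq_integral (fun z => ((2^-1 ^+ j.+1 * (2 * (C0 * r / e j ^+ Ns)) `^ q)%:E *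
      (N j z `^ q * w z `^ g)%:E)%E)); last first.
    move=> z _ /=; rewrite -EFinM (mulrA 2) (powRM _ (mulr_ge0 (ler0n _ 2) cj) (N_ge0 j z)).
    by rewrite !mulrA.
  rewrite ge0_integralZl//; last 3 first.
  - apply/measurable_EFinP; apply: measurable_funM; last exact: measurable_fun_powR.
    exact: measurable_fun_powR.
  - by move=> z _; rewrite lee_fin mulr_ge0 ?powR_ge0.
  - by rewrite lee_fin mulr_ge0 ?powR_ge0// exprn_ge0// invr_ge0.
  apply: (@le_trans _ _ ((2^-1 ^+ j.+1 * (2 * (C0 * r / e j ^+ Ns)) `^ q)%:E *
   (2 `^ q * K * A `^ g * F `^ g * (M * e j ^+ Ns) `^ (q + (1 - g)))%:E)%E).
    apply: lee_wpmul2l; last exact: Ngw_bound.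
    by rewrite lee_fin mulr_ge0 ?powR_ge0// exprn_ge0// invr_ge0.
  rewrite -EFinM lee_fin -(mulrA (2^-1 ^+ j.+1)).
  apply: le_trans (ler_wpM2l _ (coef j)) _; first by rewrite exprn_ge0// invr_ge0.
  by rewrite -/Z le_eqVlt; apply/orP; left; apply/eqP; ring.
rewrite sumEFin lee_fin -mulr_sumr [leRHS](_ : _ = Z * 2); last by rewrite /Z; ring.
by rewrite ler_wpM2l// sum_geometric_le.
Qed.

End dyadic_chain.

(** * Lebesgue measure on space-time *)

Section spacetime_coordinates.
Context (R : realType) (n : nat).

(** [None] is time and [Some j] a spatial direction. A single finite index set, with degree 2 for
    time, lets boxes, kernels and neighbourhoods treat all coordinates alike. *)
Definition coordX (i : option 'I_n) (z : 'rV[R]_n * R) : R :=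
  if i is Some j then z.1 ord0 j else z.2.

Definition pdeg (i : option 'I_n) : nat := if i is Some _ then 1%N else 2%N.

Lemma pdeg_gt0 i : (0 < pdeg i)%N. Proof. by case: i. Qed.

Lemma big_option (S : Type) (idx : S) (op : Monoid.com_law idx)
    (F : option 'I_n -> S) :
  \big[op/idx]_i F i = op (F None) (\big[op/idx]_(j < n) F (Some j)).
Proof.
rewrite (bigD1 None)//=; congr (op _ _).
rewrite (reindex_omap (fun j : 'I_n => Some j) id) //=; last by case.
by apply: eq_bigl => j; rewrite eqxx.
Qed.

Lemma sum_pdeg : (\sum_i pdeg i = n.+2)%N.
Proof.
by rewrite (big_option _ pdeg) /= sum_nat_const card_ord muln1 add2n.
Qed.

Lemma measurable_coordX i : measurable_fun setT (coordX i).
Proof.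
case: i => [j|] /=; last exact: measurable_snd.
exact: (measurableT_comp (measurable_coord (T := R) j) measurable_fst).
Qed.

Lemma sigma_algebra_preimage_measurable (T : Type) (f : T -> R)
    (G : set (set T)) : sigma_algebra setT G ->
  (forall a, G [set z | f z < a]) -> forall B, measurable B -> G (f @^-1` B).
Proof.
move=> sG Grays B.
have sG' : sigma_algebra setT [set B : set R | G (f @^-1` B)].
  split => /=.
  - by rewrite preimage_set0; case: sG.
  - move=> C GC; rewrite setTD preimage_setC -setTD.
    by case: sG => _ + _; exact.
  - by move=> F GF; rewrite preimage_bigcup; case: sG => _ _; exact.
rewrite [measurable B](_ : _ = (@RGenInftyO.G R).-sigma.-measurable B); last first.
  by rewrite -RGenInftyO.measurableE.
move: B; apply: smallest_sub => // B [a ->] /=.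
have := Grays a; congr G; apply/seteqP; split => z /=; by rewrite in_itv.
Qed.

(** Supplies the hypothesis [X_generate] of the good-sets argument. *)
Lemma coordX_generate (G : set (set ('rV[R]_n * R))) : sigma_algebra setT G ->
  (forall i a, G [set z | coordX i z < a]) ->
  @measurable _ ('rV[R]_n * R)%type `<=` G.
Proof.
move=> sG Grays; have GX i := sigma_algebra_preimage_measurable sG (Grays i).
apply: smallest_sub => // _ [[B mB <-]|[B mB <-]]; rewrite setTI; last exact: (GX None).
have sG' : sigma_algebra setT [set B : set 'rV[R]_n | G (fst @^-1` B)].
  split => /=.
  - by rewrite preimage_set0; case: sG.
  - move=> C GC; rewrite setTD preimage_setC -setTD.
    by case: sG => _ + _; exact.
  - by move=> F GF; rewrite preimage_bigcup; case: sG => _ _; exact.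
move: B mB; apply: smallest_sub => // B; rewrite -bigcup_seq => -[i _ [C mC <-]] /=.
by rewrite setTI; exact: (GX (Some i)).
Qed.

End spacetime_coordinates.

Section product_integrals.
Context (R : realType).
Local Open Scope ereal_scope.

Lemma measurable_prod_coord n (g : 'I_n -> R -> R) :
  (forall i, measurable_fun setT (g i)) ->
  measurable_fun setT (fun x : 'rV[R]_n => (\prod_(i < n) g i (x ord0 i))%R).
Proof.
move=> mg; apply: measurable_prod => i _.
exact: (measurableT_comp (mg i) (measurable_coord (T := R) i)).
Qed.

Local Notation RL := (measurableTypeR R).

Lemma measurable_rV_cons_RL n :
  measurable_fun [set: (RL * 'rV[R]_n)%type] (@rV_cons R n).
Proof. exact: measurable_rV_cons. Qed.

Lemma integral_lebesgue_rVS n (f : 'rV[R]_n.+1 -> \bar R) :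
  measurable_fun setT f -> (forall x, 0 <= f x) ->
  \int[lebesgue_rV R n.+1]_x f x =
  \int[lebesgue_measure]_a \int[lebesgue_rV R n]_x f (rV_cons (a, x)).
Proof.
move=> mf f0.
have f0' : {in setT, forall x, 0 <= f x} by move=> x _.
pose m := @product_measure1 _ _ RL 'rV[R]_n R (@lebesgue_measure R) (lebesgue_rV R n).
transitivity (\int[m]_z f (rV_cons z)).
  have := @ge0_integral_pushforward _ _ (RL * 'rV[R]_n)%type _ _ _ (@measurable_rV_cons_RL n)
    m setT f measurableT mf f0'.
  by rewrite preimage_setT.
have mf' : measurable_fun setT (f \o @rV_cons R n : RL * 'rV[R]_n -> \bar R).
  exact: (measurableT_comp mf (@measurable_rV_cons_RL n)).
exact: (fubini_tonelli1 _ mf' (fun z => f0 _)).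
Qed.

(* [lebesgue_measure] lives on the copy [measurableTypeR R] of [R], whose
   sigma-algebra has another display than the canonical one. *)
Lemma ge0_integral_spacetimeRL n (f : 'rV[R]_n * R -> \bar R) :
  measurable_fun setT f -> (forall z, 0 <= f z) ->
  \int[@lebesgue_spacetime R n]_z f z =
  \int[(lebesgue_rV R n \x @lebesgue_measure R)]_z f z.
Proof.
move=> mf f0.
have f0' : {in setT, forall x, 0 <= f x} by move=> x _.
have mid : measurable_fun setT (id : 'rV[R]_n * RL -> 'rV[R]_n * R).
  by move=> _ A mA; rewrite setTI.
pose m := @product_measure1 _ _ 'rV[R]_n RL R (lebesgue_rV R n) (@lebesgue_measure R).
exact: (@ge0_integral_pushforward _ _ ('rV[R]_n * RL)%type ('rV[R]_n * R)%type R _ mid m setT f measurableT mf f0').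
Qed.

Lemma integral_lebesgue_spacetime n (f : 'rV[R]_n * R -> \bar R) :
  measurable_fun setT f -> (forall z, 0 <= f z) ->
  \int[@lebesgue_spacetime R n]_z f z =
  \int[lebesgue_rV R n]_x \int[lebesgue_measure]_t f (x, t).
Proof.
move=> mf f0; rewrite ge0_integral_spacetimeRL//.
have mf' : measurable_fun setT (f : 'rV[R]_n * RL -> _) by exact: mf.
exact: (fubini_tonelli1 _ mf' f0).
Qed.

Lemma integral_prod_rV n (g : 'I_n -> R -> R) (c : 'I_n -> R) :
  (forall i, measurable_fun setT (g i)) -> (forall i y, (0 <= g i y)%R) ->
  (forall i, \int[lebesgue_measure]_y (g i y)%:E = (c i)%:E) ->
  \int[lebesgue_rV R n]_x (\prod_(i < n) g i (x ord0 i))%:E =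
  (\prod_(i < n) c i)%:E.
Proof.
elim: n g c => [|n IH] g c mg g0 gc.
  rewrite big_ord0 (_ : (fun x => _) = cst 1); last first.
    by apply/funext => x; rewrite big_ord0.
  by rewrite integral_cst//= diracT mul1e.
have mP : measurable_fun setT (EFin \o (fun x : 'rV[R]_n.+1 =>
    (\prod_(i < n.+1) g i (x ord0 i))%R)).
  by apply/measurable_EFinP; exact: measurable_prod_coord.
rewrite (integral_lebesgue_rVS mP); last by move=> x; rewrite lee_fin prodr_ge0.
have E (z : R * 'rV[R]_n) : (\prod_(i < n.+1) g i (rV_cons z ord0 i) =
    g ord0 z.1 * \prod_(i < n) g (lift ord0 i) (z.2 ord0 i))%R.
  rewrite big_ord_recl /rV_cons mxE unlift_none; congr (_ * _)%R.
  by apply: eq_bigr => i _; rewrite mxE liftK.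
under eq_integral do under eq_integral do rewrite /= E EFinM.
rewrite /=.
under eq_integral => y _.
  rewrite ge0_integralZl//; last 3 first.
  - apply/measurable_EFinP.
    by apply: (measurable_prod_coord (g := fun i => g (lift ord0 i))) => i; exact: mg.
  - by move=> x _; rewrite lee_fin prodr_ge0.
  - by rewrite lee_fin.
  rewrite (IH (fun i => g (lift ord0 i)) (fun i => c (lift ord0 i))) //.
  over.
rewrite ge0_integralZr//; last 3 first.
- by apply/measurable_EFinP; exact: mg.
- by move=> x _; rewrite lee_fin.
- rewrite lee_fin prodr_ge0// => i _; rewrite -lee_fin -gc integral_ge0// => y _.
  by rewrite lee_fin.
by rewrite gc big_ord_recl EFinM.
Qed.

Lemma integral_prod_spacetime n (g : option 'I_n -> R -> R)
    (c : option 'I_n -> R) :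
  (forall i, measurable_fun setT (g i)) -> (forall i y, (0 <= g i y)%R) ->
  (forall i, \int[lebesgue_measure]_y (g i y)%:E = (c i)%:E) ->
  \int[@lebesgue_spacetime R n]_z (\prod_i g i (coordX i z))%:E =
  (\prod_i c i)%:E.
Proof.
move=> mg g0 gc.
have E z : (\prod_i g i (coordX i z) =
    (\prod_(j < n) g (Some j) (z.1 ord0 j)) * g None z.2)%R.
  by rewrite (big_option _ (fun i => g i (coordX i z))) /= mulrC.
under eq_integral do rewrite E EFinM.
have mF : measurable_fun setT (fun z : 'rV[R]_n * R =>
    (\prod_(j < n) g (Some j) (z.1 ord0 j))%:E * (g None z.2)%:E).
  apply/measurable_EFinP; apply: measurable_funM.
    exact: (measurableT_comp (measurable_prod_coord (fun j => mg (Some j))) measurable_fst).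
  exact: (measurableT_comp (mg None) measurable_snd).
rewrite (integral_lebesgue_spacetime mF) => [|z]; last first.
  by rewrite -EFinM lee_fin mulr_ge0// prodr_ge0.
rewrite /=.
under eq_integral => x _.
  rewrite ge0_integralZl//; last 3 first.
  - by apply/measurable_EFinP; exact: mg.
  - by move=> y _; rewrite lee_fin.
  - by rewrite lee_fin prodr_ge0.
  rewrite gc.
  over.
rewrite ge0_integralZr//; last 3 first.
- apply/measurable_EFinP.
  by apply: (measurable_prod_coord (g := fun j => g (Some j))) => j; exact: mg.
- by move=> x _; rewrite lee_fin prodr_ge0.
- by rewrite -gc integral_ge0// => y _; rewrite lee_fin.
rewrite (@integral_prod_rV n (fun j => g (Some j)) (fun j => c (Some j)))//.
by rewrite -EFinM mulrC -(big_option _ c).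
Qed.

Lemma lebesgue_spacetime_prod n (I : option 'I_n -> interval R)
    (c : option 'I_n -> R) :
  (forall i, lebesgue_measure [set` I i] = (c i)%:E) ->
  @lebesgue_spacetime R n [set z | forall i, coordX i z \in I i] = (\prod_i c i)%:E.
Proof.
move=> Ic.
have mS : measurable [set z : 'rV[R]_n * R | forall i, coordX i z \in I i].
  rewrite [X in measurable X](_ : _ = \bigcap_(i in [set: option 'I_n]) (coordX i @^-1` [set` I i])); last first.
    by apply/seteqP; split => [z H i _ //|z H i]; exact: H.
  apply: fin_bigcap_measurable => // i _.
  by rewrite -[X in measurable X]setTI; exact: measurable_coordX.
rewrite -(@integral_prod_spacetime n (fun i => \1_[set` I i]) c) //.
- rewrite -[in LHS](setIT [set z | _]).
  rewrite -(integral_indic (@lebesgue_spacetime R n) _ mS)//.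
  apply: eq_integral => z _; congr (_%:E).
  rewrite indicE; case: (boolP (z \in _)); rewrite ?(inE, notin_setE) /= => H.
    by rewrite big1// => i _; rewrite indicE mem_set//; exact: H.
  apply/esym/eqP; rewrite prodf_seq_eq0; apply/hasP.
  have /existsNP[i Hi] := H; exists i; first by rewrite mem_index_enum.
  by rewrite /= indicE memNset.
- by move=> i; rewrite integral_indic// setIT; exact: Ic.
Qed.

Lemma lebesgue_spacetime_cbox n (a l : option 'I_n -> R) :
  (forall i, (0 <= l i)%R) ->
  @lebesgue_spacetime R n (cbox (@coordX R n) a l) = (\prod_i l i)%:E.
Proof.
move=> l0.
rewrite -(@lebesgue_spacetime_prod n (fun i => `[a i, (a i + l i)%R[)).
  by congr (@lebesgue_spacetime R n _); apply/seteqP; split => z /= H i; have := H i; rewrite in_itv.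
move=> i; rewrite lebesgue_measure_itv/= lte_fin.
by case: ltP; rewrite -?EFinD; have := l0 i => *; congr (_%:E); lra.
Qed.

End product_integrals.

(** * Smooth product functions *)

Section flat_function.
Context (R : realType).

(** The family in [k] is closed under differentiation up to linear combinations, so smoothness at 0
    follows from a first derivative there for every [k]. *)
Definition flat (k : nat) (x : R) : R := if 0 < x then x ^- k * expR (- x^-1) else 0.

Lemma flat_ge0 k x : 0 <= flat k x.
Proof.
rewrite /flat; case: ifPn => // x0.
by rewrite mulr_ge0 ?expR_ge0// invr_ge0 exprn_ge0// ltW.
Qed.

Lemma flat_gt0 k x : 0 < x -> 0 < flat k x.
Proof. by move=> x0; rewrite /flat x0 mulr_gt0 ?expR_gt0// invr_gt0 exprn_gt0. Qed.

Lemma flat_eq0 k x : x <= 0 -> flat k x = 0.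
Proof. by rewrite /flat leNgt => /negbTE ->. Qed.

(* [exp (1/x) = exp (1/(m x)) ^ m >= (1/(m x)) ^ m] with [m = k + 2] *)
Lemma flat_le k x : flat k x <= k.+2%:R ^+ k.+2 * x ^+ 2.
Proof.
have [x0|x0] := ltP 0 x; last first.
  by rewrite flat_eq0// mulr_ge0 ?sqr_ge0// exprn_ge0.
rewrite /flat x0 expRN.
set m := k.+2; have m0 : 0 < m%:R :> R by rewrite ltr0n.
have H : (m%:R * x) ^- m <= expR x^-1.
  have -> : x^-1 = m%:R * (m%:R * x)^-1 by rewrite invfM mulVKf// gt_eqF.
  rewrite expRM_natl -exprVn lerXn2r ?nnegrE ?expR_ge0//.
    by rewrite invr_ge0 mulr_ge0// ltW.
  by rewrite (le_trans _ (expR_ge1Dx _))// lerDr.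
have mx0 : 0 < (m%:R * x) ^+ m by rewrite exprn_gt0// mulr_gt0.
rewrite (le_trans (y := x ^- k * (m%:R * x) ^+ m))//.
  rewrite ler_wpM2l// ?invr_ge0 ?exprn_ge0// ?(ltW x0)//.
  by rewrite -[leRHS]invrK lef_pV2// posrE ?expR_gt0// invr_gt0.
rewrite exprMn mulrCA ler_wpM2l ?exprn_ge0// ?(ltW m0)//.
have -> : x ^+ m = x ^+ k * x ^+ 2 by rewrite -exprD addn2.
by rewrite mulrA mulVf ?mul1r// expf_neq0// gt_eqF.
Qed.

Lemma is_derive_inv (x : R) : x != 0 ->
  is_derive x (1 : R) (fun y => y^-1) (- x ^- 2).
Proof.
move=> x0; have := @is_deriveV _ id x 1 1 x0 (is_derive_id _ _).
by rewrite /GRing.scale /= mulr1.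
Qed.

Lemma is_derive_flat k x :
  is_derive x (1 : R) (flat k) (flat k.+2 x - k%:R * flat k.+1 x).
Proof.
have [x0|x0|->] := ltgtP x 0.
- rewrite !flat_eq0 ?(ltW x0)// mulr0 subr0.
  apply: near_eq_is_derive (is_derive_cst (0 : R) x (1 : R)).
  by near=> y; rewrite flat_eq0// ltW//; near: y; exact: lt_nbhsl.
- have xn0 : x != 0 by rewrite gt_eqF.
  have dV := is_derive_inv xn0.
  have dE : is_derive x 1 (fun y : R => expR (- y^-1)) (expR (- x^-1) * x ^- 2).
    have := @is_derive1_comp R expR (fun y => - y^-1) x _ _ (is_derive_expR _) (is_deriveN dV).
    by rewrite opprK.
  have D := is_deriveM (is_deriveX k dV) dE.
  apply: near_eq_is_derive (is_derive_eq D _).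
    near=> y; have y0 : 0 < y by near: y; exact: lt_nbhsr.
    by rewrite /flat y0 -exprVn mulrfctE exprfctE.
  rewrite /flat x0 /GRing.scale /= exprfctE.
  case: k {D} => [|k] /=; first by rewrite mul0r !mul0r mulr0 subr0 addr0 expr0 mul1r mulrC.
  rewrite -!exprVn; set y := x^-1; set E := expR _; rewrite !exprS expr0; ring.
- rewrite !flat_eq0// mulr0 subr0.
  set C := k.+2%:R ^+ k.+2 : R.
  have C0 : 0 < C by rewrite exprn_gt0// ltr0n.
  (* By the quadratic bound [flat_le], the difference quotient at 0 is at most C |h|. *)
  have H : h^-1 *: (flat k (h *: (1 : R) + 0) - flat k 0) @[h --> 0^'] --> (0 : R).
    apply/cvgrPdist_le => e e0; near=> h.
    have hn0 : h != 0 by near: h; exact: nbhs_dnbhs_neq.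
    rewrite sub0r normrN (flat_eq0 k (lexx 0)) subr0 addr0 /GRing.scale /= mulr1 normrM.
    rewrite (ger0_norm (flat_ge0 _ _)) normfV.
    rewrite (le_trans (y := C * `|h|))//.
      rewrite mulrC ler_pdivrMr ?normr_gt0// -mulrA -expr2 real_normK ?num_real//.
      exact: flat_le.
    rewrite mulrC -ler_pdivlMr//; near: h.
    apply: (@dnbhs0_le _ R); by rewrite divr_gt0.
  apply: DeriveDef; last exact: cvg_lim H.
  by apply/cvg_ex; exists 0.
Unshelve. all: by end_near. Qed.

End flat_function.

(** * A class of functions closed under differentiation *)

Section elementary_functions.
Context (R : realType) (V : normedModType R).

(** A directional derivative is the derivative of the restriction to a line, where the chain rule in
    one variable applies. *)
Lemma is_derive_comp_line (g : R -> R) (f : V -> R) x v a b :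
  is_derive (f x) (1 : R) g a -> is_derive x v f b ->
  is_derive x v (g \o f) (a * b).
Proof.
move=> dg df.
have E (F : V -> R) c : is_derive (0 : R) (1 : R) (fun h => F (h *: v + x)) c <->
    is_derive x v F c.
  have E' : (fun h : R => h^-1 *: (F ((h *: (1 : R) + 0) *: v + x) - F ((0 : R) *: v + x))) =
      (fun h => h^-1 *: (F (h *: v + x) - F x)).
    by apply/funext => h; rewrite scale0r add0r addr0 /GRing.scale /= mulr1.
  split=> -[d1 d2].
    by apply: DeriveDef; [move: d1; rewrite /derivable E'|move: d2; rewrite /derive E'].
  by apply: DeriveDef; [move: d1; rewrite /derivable E'|move: d2; rewrite /derive E'].
apply/E; apply: (@is_derive1_comp R g (fun h => f (h *: v + x))); last exact/E.
by rewrite scale0r add0r.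
Qed.

(** A syntactic class of smooth functions: its members are continuous and their directional
    derivatives belong to it again, so [smooth] follows for all iterated derivatives at once. *)
Inductive elementary : (V -> R) -> Prop :=
| elementary_cst c : elementary (fun=> c)
| elementary_linear (l : V -> R) : linear_for *%R l -> continuous l -> elementary l
| elementary_flat k f : elementary f -> elementary (fun x => flat k (f x))
| elementaryD f g : elementary f -> elementary g -> elementary (fun x => f x + g x)
| elementaryM f g : elementary f -> elementary g -> elementary (fun x => f x * g x)
| elementaryV f : elementary f -> (forall x, f x != 0) ->
    elementary (fun x => (f x)^-1).

Lemma continuous_elementary f : elementary f -> continuous f.
Proof.
elim=> {f} [c|l _ //|k f _ IH|f g _ cf _ cg|f g _ cf _ cg|f _ cf f0] x.
- exact: cvg_cst.
- apply: continuous_comp; first exact: IH.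
  apply: differentiable_continuous; apply/derivable1_diffP.
  by have [] := is_derive_flat k (f x).
- by apply: cvgD; [exact: cf|exact: cg].
- by apply: cvgM; [exact: cf|exact: cg].
- by apply: cvgV; [exact: f0|exact: cf].
Qed.

Lemma elementary_derive f v : elementary f ->
  exists2 g, elementary g & forall x, is_derive x v f (g x).
Proof.
elim=> {f} [c|l ll cl|k f ef [f' ef' df]|f g ef [f' ef' df] eg [g' eg' dg]
  |f g ef [f' ef' df] eg [g' eg' dg]|f ef [f' ef' df] f0].
- by exists (fun=> 0); [exact: elementary_cst|move=> x; exact: is_derive_cst].
- exists (fun=> l v); first exact: elementary_cst.
  move=> x.
  have H : h^-1 *: (l (h *: v + x) - l x) @[h --> 0^'] --> l v.
    have H0 : (fun=> l v) h @[h --> (0 : R)^'] --> l v by exact: cvg_cst.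
    apply: cvg_trans H0; apply: near_eq_cvg; near=> h; have hn0 : h != 0 by near: h; exact: nbhs_dnbhs_neq.
    by rewrite ll addrK /GRing.scale /= mulKf.
  apply: DeriveDef; last exact: cvg_lim H.
  by apply/cvg_ex; exists (l v).
- exists (fun x => (flat k.+2 (f x) + (- k%:R) * flat k.+1 (f x)) * f' x).
    apply: elementaryM => //; apply: elementaryD; first exact: elementary_flat.
    by apply: elementaryM; [exact: elementary_cst|exact: elementary_flat].
  move=> x; apply: (is_derive_comp_line _ (df x)); rewrite mulNr.
  exact: is_derive_flat.
- by exists (fun x => f' x + g' x); [exact: elementaryD|move=> x; exact: is_deriveD].
- exists (fun x => f x * g' x + g x * f' x).
    by apply: elementaryD; exact: elementaryM.
  by move=> x; exact: is_deriveM.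
- exists (fun x => ((-1) * ((f x)^-1 * (f x)^-1)) * f' x).
    apply: elementaryM => //; apply: elementaryM; first exact: elementary_cst.
    by apply: elementaryM; exact: elementaryV.
  move=> x; apply: is_derive_comp_line (df x); rewrite mulN1r -invfM -expr2.
  exact: is_derive_inv.
Unshelve. all: by end_near. Qed.

Lemma smooth_elementary f : elementary f -> smooth f.
Proof.
move=> ef vs.
have H : elementary (iter_derive vs f).
  elim: vs => //= v vs /elementary_derive -/(_ v)[g eg dg].
  suff -> : 'D_v (iter_derive vs f) = g by [].
  by apply/funext => x; exact: derive_val.
split; first exact: continuous_elementary.
by move=> x v; have [g _ dg] := elementary_derive v H; case: (dg x).
Qed.

Lemma elementary_prod (I : Type) (s : seq I) (P : pred I) (F : I -> V -> R) :
  (forall i, P i -> elementary (F i)) ->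
  elementary (fun x => \prod_(i <- s | P i) F i x).
Proof.
move=> eF; elim: s => [|i s IH].
  by under eq_fun do rewrite big_nil; exact: elementary_cst.
under eq_fun do rewrite big_cons; have [Pi|//] := boolP (P i).
by apply: elementaryM => //; exact: eF.
Qed.

End elementary_functions.

Lemma elementary_comp (R : realType) (V : normedModType R) (f : R -> R)
    (g : V -> R) : elementary f -> elementary g -> elementary (f \o g).
Proof.
move=> ef eg; elim: ef => {f} [c|l ll cl|k f _ IH|f h _ IH _ IH'|f h _ IH _ IH'|f _ IH f0].
- exact: elementary_cst.
(* A linear map on [R] is multiplication by its value at 1. *)
- rewrite (_ : l \o g = fun x => g x * l 1).
    by apply: elementaryM => //; exact: elementary_cst.
  apply/funext => x /=; have := ll (g x) 1 0.
  have l0 : l 0 = 0 by have := ll (-1) 0 0; rewrite scaler0 addr0 mulN1r; lra.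
  by rewrite l0 !addr0 /GRing.scale /= mulr1.
- exact: elementary_flat IH.
- exact: elementaryD IH IH'.
- exact: elementaryM IH IH'.
- by apply: elementaryV IH _ => x; exact: f0.
Qed.

Section compactly_supported.
Context (R : realType) (f : R -> R) (lo hi : R).
Hypothesis f_supp : forall y, f y != 0 -> lo <= y <= hi.

Lemma derive_supp (df : R -> R) : (forall y, is_derive y (1 : R) f (df y)) ->
  forall y, df y != 0 -> lo <= y <= hi.
Proof.
move=> dff y; apply: contraNT => Hout.
have f0 x : ~~ (lo <= x <= hi) -> f x = 0 by apply: contraNeq; exact: f_supp.
have [_ <-] := dff y; rewrite -(derive_cst (0 : R) y (1 : R)); apply/eqP.
apply: near_eq_derive.
have o : open (~` `[lo, hi] : set R) by apply: closed_openC; exact: itv_closed.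
have : nbhs y (~` `[lo, hi] : set R).
  by apply: open_nbhs_nbhs; split => //=; rewrite in_itv; exact/negP.
by apply: filterS => x /= /negP; rewrite in_itv; exact: f0.
Qed.

Lemma elementary_bounded : elementary f -> exists2 M : R, 0 <= M & forall y, `|f y| <= M.
Proof.
move=> ef.
have cf : {within `[lo, hi], continuous (fun y => `|f y|)}.
  apply: continuous_subspaceT => y; apply: continuous_comp.
    exact: continuous_elementary.
  exact: norm_continuous.
have [le|gt] := leP lo hi.
  have [c _ cM] := @EVT_max R _ _ _ le cf.
  exists `|f c| => // y; have [->|/f_supp yI] := eqVneq (f y) 0; first by rewrite normr0.
  exact: cM.
exists 0 => // y; have [->|/f_supp/andP[y1 y2]] := eqVneq (f y) 0; first by rewrite normr0.
by have := le_trans y1 y2; rewrite leNgt gt.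
Qed.

End compactly_supported.

Lemma elementary_derive_ext (R : realType) (f df : R -> R) : elementary f ->
  (forall y, is_derive y (1 : R) f (df y)) -> elementary df.
Proof.
move=> ef dff; have [g eg dg] := elementary_derive (1 : R) ef.
by have -> : df = g by apply/funext => y; have [_ <-] := dff y; have [_ <-] := dg y.
Qed.

Lemma elementary_affine (R : realType) (V : normedModType R) (l : V -> R) a b :
  linear_for *%R l -> continuous l -> elementary (fun x => a + b * l x).
Proof.
move=> ll cl; apply: elementaryD; first exact: elementary_cst.
by apply: elementaryM; [exact: elementary_cst|exact: elementary_linear].
Qed.

Section smooth_step.
Context (R : realType).

Lemma elementary_rescale (a b : R) : elementary (fun y : R => (y - b) / a).
Proof.
rewrite (_ : (fun _ => _) = fun y => - b / a + a^-1 * y); last first.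
  by apply/funext => y; rewrite mulrBl mulrC mulNr addrC.
by apply: (@elementary_affine _ _ id) => // x; exact: cvg_id.
Qed.

Lemma is_derive_rescale (a b y : R) : is_derive y (1 : R) (fun y : R => (y - b) / a) a^-1.
Proof.
have := is_deriveZ a^-1 (is_deriveB (is_derive_id y (1 : R)) (is_derive_cst b y (1 : R))).
rewrite subr0 /GRing.scale /= mulr1 => H.
rewrite (_ : (fun _ => _) = a^-1 \*: (id - cst b))//.
by apply/funext => z /=; rewrite mulrC.
Qed.

(** One of 1 + y and 1 - y is positive, so this denominator never vanishes. *)
Let den (y : R) : R := flat 0 (1 + y) + flat 0 (1 - y).

Let den_gt0 y : 0 < den y.
Proof.
have [y0|y0] := ltP 0 (1 + y); first by rewrite ltr_pwDl ?flat_gt0 ?flat_ge0.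
by rewrite ltr_wpDl ?flat_ge0// flat_gt0//; lra.
Qed.

Definition smooth_step (y : R) : R := flat 0 (1 + y) * (den y)^-1.

(** The derivative of [smooth_step], written out. With this choice the integral is 1 by the
    fundamental theorem of calculus, without a normalising constant. *)
Definition bump (y : R) : R :=
  (flat 2 (1 + y) * flat 0 (1 - y) + flat 0 (1 + y) * flat 2 (1 - y)) *
  ((den y)^-1 * (den y)^-1).

Let eD : elementary (fun y : R => 1 + y).
Proof.
apply: elementaryD; first exact: elementary_cst.
by apply: elementary_linear => // x; exact: cvg_id.
Qed.

Let eB : elementary (fun y : R => 1 - y).
Proof.
apply: elementaryD; first exact: elementary_cst.
rewrite (_ : -%R = fun y : R => (-1) * y); last by apply/funext => y; rewrite mulN1r.
apply: elementaryM; first exact: elementary_cst.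
by apply: elementary_linear => // x; exact: cvg_id.
Qed.

Let e_den : elementary (fun y => (den y)^-1).
Proof.
apply: elementaryV => [|y]; last by rewrite gt_eqF.
by apply: elementaryD; exact: elementary_flat.
Qed.

Lemma elementary_smooth_step : elementary smooth_step.
Proof. by apply: elementaryM => //; exact: elementary_flat. Qed.

Lemma elementary_bump : elementary bump.
Proof.
apply: elementaryM; last exact: elementaryM.
by apply: elementaryD; apply: elementaryM; exact: elementary_flat.
Qed.

Lemma is_derive_smooth_step y : is_derive y (1 : R) smooth_step (bump y).
Proof.
have da : is_derive y 1 (fun y : R => 1 + y) (1 : R).
  have := is_deriveD (is_derive_cst (1 : R) y (1 : R)) (is_derive_id y (1 : R)).
  by rewrite add0r.
have db : is_derive y 1 (fun y : R => 1 - y) (- 1 : R).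
  have := is_deriveB (is_derive_cst (1 : R) y (1 : R)) (is_derive_id y (1 : R)).
  by rewrite sub0r.
have dA := is_derive1_comp (is_derive_flat 0 (1 + y)) da.
have dB := @is_derive1_comp R (flat 0) (fun y => 1 - y) y _ _ (is_derive_flat 0 (1 - y)) db.
have dD : is_derive y 1 den _ := is_deriveD dA dB.
have dn0 : den y != 0 by rewrite gt_eqF.
have dV := is_derive1_comp (is_derive_inv dn0) dD.
apply: is_derive_eq (is_deriveM dA dV) _.
rewrite /bump /GRing.scale /= !mul0r !subr0 !mulr1 mulrN1.
rewrite {1 3}/den; move: dn0; rewrite /den.
set a := flat 0 (1 + y); set b := flat 0 (1 - y); set a2 := flat 2 _; set b2 := flat 2 _.
by move=> ab; field.
Qed.

Lemma bump_ge0 y : 0 <= bump y.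
Proof.
rewrite mulr_ge0//; last by rewrite mulr_ge0// invr_ge0 ltW.
by rewrite addr_ge0// mulr_ge0 ?flat_ge0.
Qed.

Lemma bump_neq0 y : bump y != 0 -> -1 <= y <= 1.
Proof.
apply: contraNT; rewrite negb_and -!ltNge => /orP[y1|y1]; rewrite /bump.
  by rewrite !(@flat_eq0 _ _ (1 + y)) ?mul0r ?addr0 ?mul0r//; lra.
by rewrite !(@flat_eq0 _ _ (1 - y)) ?mulr0 ?addr0 ?mul0r//; lra.
Qed.

Lemma smooth_step_eq0 y : y <= -1 -> smooth_step y = 0.
Proof. by move=> y1; rewrite /smooth_step flat_eq0 ?mul0r//; lra. Qed.

Lemma smooth_step_eq1 y : 1 <= y -> smooth_step y = 1.
Proof.
move=> y1; have := den_gt0 y; rewrite /smooth_step /den (@flat_eq0 _ _ (1 - y)); last by lra.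
by rewrite addr0 => d0; rewrite divff// gt_eqF.
Qed.

Lemma smooth_step_itv y : 0 <= smooth_step y <= 1.
Proof.
rewrite /smooth_step divr_ge0 ?flat_ge0 ?(ltW (den_gt0 _))//= ler_pdivrMr//.
by rewrite mul1r lerDl flat_ge0.
Qed.

Lemma measurable_elementary (f : R -> R) : elementary f -> measurable_fun setT f.
Proof. by move=> ef; apply: continuous_measurable_fun; exact: continuous_elementary. Qed.

Lemma integral_bump (a b : R) : 0 < a ->
  (\int[lebesgue_measure]_y (a^-1 * bump ((y - b) / a))%:E = 1)%E.
Proof.
move=> a0.
pose F y := smooth_step ((y - b) / a); pose f y := a^-1 * bump ((y - b) / a).
have dF y : is_derive y (1 : R) F (f y).
  rewrite /f mulrC; exact: (is_derive1_comp (is_derive_smooth_step _) (is_derive_rescale a b y)).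
have cF : continuous F.
  exact: continuous_elementary (elementary_comp elementary_smooth_step (elementary_rescale a b)).
have ef : elementary f.
  apply: elementaryM; first exact: elementary_cst.
  exact: elementary_comp elementary_bump (elementary_rescale a b).
have ab : b - a < b + a by lra.
have := @continuous_FTC2 R f F (b - a) (b + a) ab.
rewrite /F /= (@smooth_step_eq1 ((b + a - b) / a)); last first.
  by rewrite ler_pdivlMr// mul1r; lra.
rewrite (@smooth_step_eq0 ((b - a - b) / a)); last first.
  by rewrite ler_pdivrMr//; lra.
rewrite sube0 => <-.
- rewrite [RHS]integral_mkcond; apply: eq_integral => y _.
  rewrite patchE; case: ifPn => //; rewrite notin_setE /= in_itv /= => /negP H.
  have [->|/bump_neq0/andP[H1 H2]] := eqVneq (bump ((y - b) / a)) 0; first by rewrite mulr0.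
  exfalso; move/negP: H; apply; move: H1 H2.
  rewrite ler_pdivlMr// ler_pdivrMr// => *; apply/andP; split; lra.
- by apply: continuous_subspaceT; exact: continuous_elementary.
- split.
  + by move=> y _; have [] := dF y.
  + by apply: cvg_at_right_filter; exact: cF.
  + by apply: cvg_at_left_filter; exact: cF.
- by move=> y _; rewrite derive1E; have [_ ->] := dF y.
Qed.

End smooth_step.

Section product_test_functions.
Context (R : realType).

Lemma is_derive_prod_coord (V : normedModType R) (I : finType) (X : I -> V -> R)
    (f : I -> R -> R) (i : I) (v x : V) a :
  (forall j, linear_for *%R (X j)) -> (forall j, X j v = (j == i)%:R) ->
  is_derive (X i x) (1 : R) (f i) a ->
  is_derive x v (fun x => \prod_j f j (X j x)) (a * \prod_(j | j != i) f j (X j x)).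
Proof.
move=> lX Xv dfi.
have XE j h : X j (h *: v + x) = h * (j == i)%:R + X j x by rewrite lX Xv.
have drest : is_derive x v (fun x => \prod_(j | j != i) f j (X j x)) 0.
  have H : h^-1 *: ((\prod_(j | j != i) f j (X j (h *: v + x)) : R) -
      \prod_(j | j != i) f j (X j x)) @[h --> 0^'] --> (0 : R).
    have H0 : (fun=> 0 : R) h @[h --> (0 : R)^'] --> (0 : R) by exact: cvg_cst.
    apply: cvg_trans H0; apply: near_eq_cvg; near=> h.
    rewrite /= [X in _ *: (X - _)](_ : _ = \prod_(j | j != i) f j (X j x)).
      by rewrite subrr scaler0.
    by apply: eq_bigr => j /negbTE ji; rewrite XE ji mulr0 add0r.
  apply: DeriveDef; last exact: cvg_lim H.
  by apply/cvg_ex; exists 0.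
have dXi : is_derive x v (X i) 1.
  have H : h^-1 *: (X i (h *: v + x) - X i x) @[h --> (0 : R)^'] --> (1 : R).
    have H0 : (fun=> 1 : R) h @[h --> (0 : R)^'] --> (1 : R) by exact: cvg_cst.
    apply: cvg_trans H0; apply: near_eq_cvg; near=> h.
    have hn0 : h != 0 by near: h; exact: nbhs_dnbhs_neq.
    by rewrite XE eqxx mulr1 addrK /GRing.scale /= mulVf.
  apply: DeriveDef; last exact: cvg_lim H.
  by apply/cvg_ex; exists 1.
have D := is_deriveM (is_derive_comp_line dfi dXi) drest.
rewrite (_ : (fun x => _) = (f i \o X i) * (fun x => \prod_(j | j != i) f j (X j x))).
  apply: is_derive_eq D _; by rewrite /GRing.scale /= mulr0 add0r mulr1 mulrC.
by apply/funext => y; rewrite (bigD1 i).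
Unshelve. all: by end_near. Qed.

Lemma test_function_prod (V : normedModType R) (I : finType) (X : I -> V -> R)
    (f : I -> R -> R) (lo hi : I -> R) (U : set V) :
  (forall j, linear_for *%R (X j)) -> (forall j, continuous (X j)) ->
  (forall j, elementary (f j)) ->
  (forall j y, f j y != 0 -> lo j <= y <= hi j) ->
  compact [set x | forall j, X j x \in `[lo j, hi j]] ->
  (forall x, (forall j, X j x \in `[lo j, hi j]) -> U x) ->
  test_function U (fun x => \prod_j f j (X j x)).
Proof.
move=> lX cX ef f0 cB BU.
have cl : closed [set x | forall j, X j x \in `[lo j, hi j]].
  rewrite (_ : [set x | _] = \bigcap_(j in [set: I]) (X j @^-1` `[lo j, hi j])).
    apply: closed_bigI => j _; apply: preimage_closed; last exact: itv_closed.
    by move=> x _; exact: cX.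
  by apply/seteqP; split => [x H j _|x H j]; [exact: H|exact: H].
have sB : closure [set x | \prod_j f j (X j x) != 0] `<=`
    [set x | forall j, X j x \in `[lo j, hi j]].
  move: cl => /closure_id ->; apply: closureS => x /= /prodf_neq0 H j.
  by rewrite in_itv; apply: f0; exact: H.
split.
- apply: smooth_elementary; apply: elementary_prod => j _.
  by apply: elementary_comp (ef j) _; exact: elementary_linear.
- by apply: subclosed_compact cB sB; exact: closed_closure.
- by move=> x /sB; exact: BU.
Qed.

Lemma compact_rV_box n (lo hi : 'I_n -> R) :
  compact [set x : 'rV[R]_n | forall j, x ord0 j \in `[lo j, hi j]].
Proof.
by apply: (@rV_compact R n (fun j => [set` `[lo j, hi j]])) => j; exact: segment_compact.
Qed.

Lemma compact_spacetime_box n (lo hi : option 'I_n -> R) :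
  compact [set z | forall j, coordX j z \in `[lo j, hi j]].
Proof.
rewrite (_ : [set z | _] =
    [set x : 'rV[R]_n | forall j, x ord0 j \in `[lo (Some j), hi (Some j)]] `*`
    [set` `[lo None, hi None]]).
  by apply: compact_setX; [exact: compact_rV_box|exact: segment_compact].
apply/seteqP; split => [z H|z [H1 H2] [j|]]; first split.
- by move=> j; exact: (H (Some j)).
- exact: (H None).
- exact: H1.
- exact: H2.
Qed.

Lemma linear_coordX n (j : option 'I_n) : linear_for *%R (@coordX R n j).
Proof. by case: j => [j|] a x y /=; rewrite ?mxE. Qed.

Lemma continuous_coordX n (j : option 'I_n) : continuous (@coordX R n j).
Proof.
case: j => [j|] z /=; last exact: cvg_snd.
apply: (@continuous_comp _ _ _ fst (fun x : 'rV[R]_n => x ord0 j)).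
  exact: cvg_fst.
exact: coord_continuous.
Qed.

End product_test_functions.

(** * Kernel averages of weak solutions *)

Section bounded_multipliers.
Context d (T : measurableType d) (R : realType) (mu : {measure set T -> \bar R}).

Lemma integrable_bounded_mul (u b : T -> R) (M : R) :
  mu.-integrable setT (EFin \o u) -> measurable_fun setT b ->
  (forall z, `|b z| <= M) -> mu.-integrable setT (EFin \o (fun z => b z * u z)).
Proof.
move=> iu mb bM.
have mu' : measurable_fun setT u by apply/measurable_EFinP; exact: measurable_int iu.
apply: (@le_integrable _ _ _ mu setT measurableT _ (fun z => (M%:E * (`|u z|)%:E)%E)).
- by apply/measurable_EFinP; exact: measurable_funM.
- move=> z _; rewrite lee_fin !normrM normr_id ler_wpM2r// [leRHS]ger0_norm//.
  exact: le_trans (bM z).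
- by apply: integrableZl => //; exact: integrable_norm iu.
Qed.

Lemma normr_Rintegral_le (f H : T -> R) (S : set T) (B : R) :
  measurable S -> measurable_fun setT f -> measurable_fun setT H ->
  (forall z, 0 <= H z) -> mu.-integrable setT (EFin \o H) -> 0 <= B ->
  (forall z, ~ S z -> f z = 0) -> (forall z, S z -> `|f z| <= B * H z) ->
  mu.-integrable setT (EFin \o f) /\
  `|\int[mu]_z f z| <= B * \int[mu]_(z in S) H z.
Proof.
move=> mS mf mH H0 iH B0 fS fB.
have fB' z : `|f z| <= B * H z.
  have [Sz|nSz] := pselect (S z); first exact: fB.
  by rewrite fS// normr0 mulr_ge0.
have ifm : mu.-integrable setT (EFin \o f).
  apply: (@le_integrable _ _ _ mu setT measurableT _ (fun z => (B%:E * (H z)%:E)%E)).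
  - exact/measurable_EFinP.
  - move=> z _; rewrite lee_fin [leRHS]ger0_norm; first exact: fB'.
    exact: mulr_ge0.
  - exact: integrableZl.
split=> //.
have iS : mu.-integrable S (EFin \o H) by exact: integrableS iH.
rewrite (le_trans (le_normr_Rintegral measurableT ifm))//.
rewrite -RintegralZl// (Rintegral_mkcond _ S).
apply: le_Rintegral => //.
- exact: integrable_norm ifm.
- rewrite (_ : EFin \o _ = ((fun z => (B%:E * (H z)%:E)%E) \_ S)).
    by rewrite -integrable_mkcond//; exact: integrableZl.
  by apply/funext => z; rewrite !patchE /= patchE; case: ifP.
- move=> z _; rewrite patchE; case: ifPn => [|]; rewrite ?inE ?notin_setE.
    exact: fB.
  by move=> nS; rewrite fS// normr0.
Qed.

End bounded_multipliers.

Section kernel_factor.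
Context (R : realType) (n : nat).
Hypothesis n_gt0 : (0 < n)%N.

(** Width of a bump relative to its scale. The factor 1/n is for the ball, where the squares of [n]
    coordinates add up. *)
Definition krho : R := (8 * n%:R)^-1.

Lemma krho_gt0 : 0 < krho.
Proof. by rewrite invr_gt0 mulr_gt0// ltr0n. Qed.

Lemma krho_le : krho <= 8^-1.
Proof. by rewrite lef_pV2// ?posrE ?mulr_gt0// ?ltr0n// ler_peMr// ler1n. Qed.

Definition kfac (L s x y : R) : R :=
  (krho * s * L)^-1 * bump ((y - (1 - s) * x) / (krho * s * L)).

(** A primitive of [kfac] in [y]. It is 0 far to the left and 1 far to the right at every scale, so
    the difference of two of them has bounded support. *)
Definition kprim (L s x y : R) : R :=
  smooth_step ((y - (1 - s) * x) / (krho * s * L)).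

Definition kfac' (L s x y : R) : R :=
  (krho * s * L)^-1 * ('D_1 (@bump R) ((y - (1 - s) * x) / (krho * s * L)) * (krho * s * L)^-1).

Lemma elementary_kfac L s x : elementary (kfac L s x).
Proof.
apply: elementaryM; first exact: elementary_cst.
exact: elementary_comp (@elementary_bump R) (elementary_rescale _ _).
Qed.

Lemma elementary_kprim L s x : elementary (kprim L s x).
Proof. exact: elementary_comp (@elementary_smooth_step R) (elementary_rescale _ _). Qed.

Lemma is_derive_kprim L s x y : is_derive y (1 : R) (kprim L s x) (kfac L s x y).
Proof.
rewrite /kfac mulrC.
exact: (is_derive1_comp (is_derive_smooth_step _) (is_derive_rescale _ _ _)).
Qed.

Let is_derive_bump (y : R) : is_derive y (1 : R) (@bump R) ('D_1 (@bump R) y).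
Proof.
by have [g _ dg] := elementary_derive (1 : R) (@elementary_bump R); have [? ->] := dg y.
Qed.

Lemma is_derive_kfac L s x y : is_derive y (1 : R) (kfac L s x) (kfac' L s x y).
Proof.
exact: (is_deriveZ (krho * s * L)^-1 (is_derive1_comp (is_derive_bump _) (is_derive_rescale _ _ _))).
Qed.

Lemma kfac_ge0 L s x y : 0 <= L -> 0 <= s -> 0 <= kfac L s x y.
Proof.
move=> L0 s0; rewrite mulr_ge0 ?bump_ge0// invr_ge0.
by rewrite mulr_ge0// mulr_ge0// ltW// krho_gt0.
Qed.

Lemma kfac_neq0 L s x y : 0 < L -> 0 < s -> kfac L s x y != 0 ->
  (1 - s) * x - krho * s * L <= y <= (1 - s) * x + krho * s * L.
Proof.
move=> L0 s0; rewrite mulf_eq0 negb_or => /andP[_ /bump_neq0].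
have k0 : 0 < krho * s * L by rewrite mulr_gt0// mulr_gt0// krho_gt0.
by rewrite ler_pdivlMr// ler_pdivrMr// => /andP[H1 H2]; apply/andP; split; lra.
Qed.

Lemma kprim_eq0 L s x y : 0 < L -> 0 < s ->
  y <= (1 - s) * x - krho * s * L -> kprim L s x y = 0.
Proof.
move=> L0 s0 H; rewrite /kprim smooth_step_eq0//.
have k0 : 0 < krho * s * L by rewrite mulr_gt0// mulr_gt0// krho_gt0.
by rewrite ler_pdivrMr//; lra.
Qed.

Lemma kprim_eq1 L s x y : 0 < L -> 0 < s ->
  (1 - s) * x + krho * s * L <= y -> kprim L s x y = 1.
Proof.
move=> L0 s0 H; rewrite /kprim smooth_step_eq1//.
have k0 : 0 < krho * s * L by rewrite mulr_gt0// mulr_gt0// krho_gt0.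
by rewrite ler_pdivlMr//; lra.
Qed.

(** The source of the gain: this bound has no inverse width in it, unlike the one for [kfac]. *)
Lemma normr_kprimB L s s' x y : `|kprim L s' x y - kprim L s x y| <= 1.
Proof.
rewrite /kprim.
have /andP[? ?] := smooth_step_itv ((y - (1 - s) * x) / (krho * s * L)).
have /andP[? ?] := smooth_step_itv ((y - (1 - s') * x) / (krho * s' * L)).
by rewrite ler_norml; apply/andP; split; lra.
Qed.

Lemma integral_kfac L s x : 0 < L -> 0 < s ->
  (\int[lebesgue_measure]_y (kfac L s x y)%:E = 1)%E.
Proof.
by move=> L0 s0; apply: integral_bump; rewrite mulr_gt0// mulr_gt0// krho_gt0.
Qed.

(* The constant is generous, so as to serve both bounds with scale at least l / 4. *)
Lemma kfac_bounds : exists2 K : R, 1 <= K & forall L s x y l, 0 < l -> l / 4 <= s * L ->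
  `|kfac L s x y| <= K / l /\ `|kfac' L s x y| <= K / l ^+ 2.
Proof.
have [M M0 bM] := elementary_bounded (@bump_neq0 R) (@elementary_bump R).
have [M' M'0 bM'] := elementary_bounded (derive_supp (@bump_neq0 R) is_derive_bump)
  (elementary_derive_ext (@elementary_bump R) is_derive_bump).
(* The 4 comes from [l / 4 <= s * L]: the inverse width is at most k / l. *)
have r0 := krho_gt0; pose k := 4 / krho.
have k1 : 1 <= k.
  rewrite ler_pdivlMr// mul1r (le_trans krho_le)//; lra.
have k0 : 0 <= k by rewrite (le_trans ler01).
exists ((M + M' + 1) * k ^+ 2) => [|L s x y l l0 H].
  rewrite -[1]mulr1 ler_pM//; last by rewrite exprn_ege1.
  by lra.
have sL0 : 0 < krho * s * L.
  by rewrite -mulrA mulr_gt0// (lt_le_trans _ H)// divr_gt0.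
have iv : (krho * s * L)^-1 <= k / l.
  rewrite -[k / l]invrK lef_pV2 ?posrE ?invr_gt0 ?divr_gt0//.
  by rewrite /k !invfM !invrK -mulrA -[leRHS]mulrA mulrC -mulrA ler_wpM2l ?(ltW r0)// mulrC.
have kl0 : 0 <= k / l by rewrite divr_ge0// ltW.
split.
  rewrite normrM gtr0_norm ?invr_gt0// mulrC.
  apply: (le_trans (y := M * (k / l))).
    by apply: ler_pM => //; rewrite invr_ge0 ltW.
  rewrite mulrA ler_wpM2r ?invr_ge0 ?(ltW l0)//.
  apply: ler_pM; [by []|by []|lra|].
  by rewrite expr2 ler_peMr.
rewrite normrM gtr0_norm ?invr_gt0// normrM (gtr0_norm (x := (krho * s * L)^-1)) ?invr_gt0//.
rewrite mulrCA.
apply: (le_trans (y := M' * ((k / l) * (k / l)))).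
  apply: ler_pM => //; first by rewrite mulr_ge0// invr_ge0 ltW.
  by apply: ler_pM => //; rewrite invr_ge0 ltW.
rewrite -expr2 expr_div_n mulrA ler_wpM2r ?invr_ge0 ?exprn_ge0 ?(ltW l0)//.
rewrite ler_wpM2r ?exprn_ge0//; lra.
Qed.

End kernel_factor.

Section spacetime_kernel.
Context (R : realType) (n : nat).
Hypothesis n_gt0 : (0 < n)%N.
Let T := ('rV[R]_n * R)%type.
Let mu := @lebesgue_spacetime R n.
Let X := @coordX R n.
Let deg := @pdeg n.
Context (r : R).
Hypothesis r_gt0 : 0 < r.
Let len (j : option 'I_n) : R := r ^+ deg j.

Let len_gt0 j : 0 < len j. Proof. exact: exprn_gt0. Qed.

(* A product bump function around the contraction of [z] by the factors [1 - s j],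
   of half-widths [krho n * s j * len j] *)
Definition kern (s : option 'I_n -> R) (z z' : T) : R :=
  \prod_j kfac n (r ^+ pdeg j) (s j) (coordX j z) (coordX j z').

Lemma kern_ge0 s z z' : (forall j, 0 < s j) -> 0 <= kern s z z'.
Proof. by move=> s0; apply: prodr_ge0 => j _; apply: (kfac_ge0 n_gt0);
  [exact: ltW (len_gt0 j)|exact: ltW (s0 j)]. Qed.

Lemma kern_neq0 s z z' : (forall j, 0 < s j) -> kern s z z' != 0 ->
  forall j, (1 - s j) * X j z - krho R n * s j * len j <= X j z' <=
            (1 - s j) * X j z + krho R n * s j * len j.
Proof. by move=> s0 /prodf_neq0 H j; apply: (kfac_neq0 n_gt0) => //; exact: H. Qed.

Lemma kern_bounded s : (forall j, 0 < s j) ->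
  exists2 M : R, 0 < M & forall z z', kern s z z' <= M.
Proof.
move=> s0; have [K K1 HK] := @kfac_bounds R n n_gt0.
have K0 : 0 < K by rewrite (lt_le_trans _ K1).
exists (\prod_j (K / (s j * len j))).
  by apply: prodr_gt0 => j _; rewrite divr_gt0// mulr_gt0.
move=> z z'; apply: ler_prod => j _.
rewrite (kfac_ge0 n_gt0 _ _ (ltW (len_gt0 j)) (ltW (s0 j)))/=.
have sl : 0 < s j * len j by rewrite mulr_gt0.
have [|+ _] := HK (len j) (s j) (X j z) (X j z') (s j * len j) sl.
  by rewrite ler_pdivrMr// ler_peMr ?(ltW sl)// ler1n.
by apply: le_trans; exact: ler_norm.
Qed.

Lemma measurable_kern2 s :
  measurable_fun [set: T * T] (fun zz : T * T => kern s zz.1 zz.2).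
Proof.
apply: measurable_prod => j _.
apply: measurable_funM; first exact: measurable_cst.
apply: (measurableT_comp (f := @bump R)).
  by apply: measurable_elementary; exact: elementary_bump.
apply: measurable_funM; last exact: measurable_cst.
apply: measurable_funB.
  by apply: measurableT_comp measurable_snd; exact: measurable_coordX.
apply: measurable_funM; first exact: measurable_cst.
by apply: measurableT_comp measurable_fst; exact: measurable_coordX.
Qed.

Lemma measurable_kern s z : measurable_fun setT (kern s z).
Proof.
apply: measurable_prod => j _.
apply: (measurableT_comp (f := kfac n (len j) (s j) (X j z))).
  by apply: measurable_elementary; exact: elementary_kfac.
exact: measurable_coordX.
Qed.

Lemma integral_kern s z : (forall j, 0 < s j) ->
  (\int[mu]_z' (kern s z z')%:E = 1)%E.
Proof.
move=> s0.
rewrite (@integral_prod_spacetime R n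
  (fun j y => kfac n (len j) (s j) (X j z) y) (fun=> 1)).
- by rewrite big1.
- by move=> j; apply: measurable_elementary; exact: elementary_kfac.
- by move=> j y; apply: (kfac_ge0 n_gt0); [exact: ltW (len_gt0 j)|exact: ltW (s0 j)].
- by move=> j; exact: integral_kfac.
Qed.

Context (Q : set T) (u : T -> R) (Du G : 'I_n -> T -> R) (H : T -> R).
Hypothesis mH : measurable_fun setT H.
Hypothesis H_ge0 : forall z, 0 <= H z.
Hypothesis iH : mu.-integrable setT (EFin \o H).
Hypothesis mDu : forall i, measurable_fun setT (Du i).
Hypothesis mG : forall i, measurable_fun setT (G i).
Hypothesis DuH : forall i z, `|Du i z| <= H z.
Hypothesis GH : forall i z, `|G i z| <= H z.
Hypothesis iu : mu.-integrable setT (EFin \o u).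
Hypothesis Q_len : forall z, Q z -> forall j, `|X j z| <= len j.
(** Each coordinate has its own scale between two neighbouring ones, since the scales are halved one
    coordinate at a time. *)
Hypothesis Q_kern : forall (l : R) z y, 0 < l <= 1 -> Q z ->
  (forall j, exists2 s : R, (l / 2) ^+ deg j <= s <= l ^+ deg j &
     `|X j y| <= (1 - s) * `|X j z| + krho R n * s * len j) -> Q y.
Hypothesis weak_x : forall (f : option 'I_n -> R -> R) (lo hi : option 'I_n -> R)
  (df : R -> R) (i : 'I_n),
  (forall j, elementary (f j)) ->
  (forall j y, f j y != 0 -> lo j <= y <= hi j) ->
  (forall z, (forall j, lo j <= X j z <= hi j) -> Q z) ->
  (forall y, is_derive y (1 : R) (f (Some i)) (df y)) ->
  \int[mu]_z (u z * (df (X (Some i) z) * \prod_(j | j != Some i) f j (X j z))) =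
  - \int[mu]_z (Du i z * \prod_j f j (X j z)).
Hypothesis weak_t : forall (f : option 'I_n -> R -> R) (lo hi : option 'I_n -> R)
  (df : option 'I_n -> R -> R),
  (forall j, elementary (f j)) ->
  (forall j y, f j y != 0 -> lo j <= y <= hi j) ->
  (forall z, (forall j, lo j <= X j z <= hi j) -> Q z) ->
  (forall j y, is_derive y (1 : R) (f j) (df j y)) ->
  \int[mu]_z (u z * (df None (X None z) * \prod_(j | j != None) f j (X j z))) =
  \int[mu]_z (\sum_i G i z * (df (Some i) (X (Some i) z) *
    \prod_(j | j != Some i) f j (X j z))).

Let V s z := \int[mu]_z' (kern s z z' * u z').
Let Ns := n.+2.

Let iuK s z : (forall j, 0 < s j) -> mu.-integrable setT (EFin \o (fun z' => kern s z z' * u z')).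
Proof.
move=> s0; have [M M0 kM] := kern_bounded s0.
apply: (integrable_bounded_mul (M := M)) => //; first exact: measurable_kern.
by move=> z'; rewrite ger0_norm// kern_ge0.
Qed.

Section swap.
Context (l : R) (z : T) (i : option 'I_n) (s t : option 'I_n -> R) (K : R).
Hypothesis l01 : 0 < l <= 1.
Hypothesis Qz : Q z.
Hypothesis s_bounds : forall j, (l / 2) ^+ deg j <= s j <= l ^+ deg j.
Hypothesis t_bounds : forall j, (l / 2) ^+ deg j <= t j <= l ^+ deg j.
Hypothesis st : forall j, j != i -> s j = t j.
Hypothesis K_ge1 : 1 <= K.
Hypothesis HK : forall L s x y l, 0 < l -> l / 4 <= s * L ->
  `|kfac n L s x y| <= K / l /\ `|kfac' n L s x y| <= K / l ^+ 2.
Let e : R := l * r.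
Let S : set T := pnb X deg (2 * e) z.

Let l_gt0 : 0 < l. Proof. by case/andP: l01. Qed.
Let e_gt0 : 0 < e. Proof. exact: mulr_gt0. Qed.
Let K_gt0 : 0 < K. Proof. by rewrite (lt_le_trans _ K_ge1). Qed.

Let scale_gt0 (q : option 'I_n -> R) : (forall j, (l / 2) ^+ deg j <= q j <= l ^+ deg j) ->
  forall j, 0 < q j.
Proof.
move=> qb j; have /andP[+ _] := qb j; apply: lt_le_trans.
by rewrite exprn_gt0// divr_gt0.
Qed.

Let s_gt0 := scale_gt0 s_bounds.
Let t_gt0 := scale_gt0 t_bounds.

Let scale_le1 (q : option 'I_n -> R) : (forall j, (l / 2) ^+ deg j <= q j <= l ^+ deg j) ->
  forall j, q j <= 1.
Proof.
move=> qb j; have /andP[_] := qb j; move/le_trans; apply.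
by case/andP: l01 => l0 l1; rewrite exprn_ile1// ltW.
Qed.

Let lo j := Num.min ((1 - s j) * X j z - krho R n * s j * len j)
                    ((1 - t j) * X j z - krho R n * t j * len j).
Let hi j := Num.max ((1 - s j) * X j z + krho R n * s j * len j)
                    ((1 - t j) * X j z + krho R n * t j * len j).
(** The factors of the test function: at [i] a difference of primitives, elsewhere those of the
    kernel. Its derivative in direction [i] is the difference of the kernels at scales [t] and
    [s]. *)
Let f j : R -> R := if j == i then fun y => kprim n (len j) (t j) (X j z) y - kprim n (len j) (s j) (X j z) y
             else kfac n (len j) (s j) (X j z).
Let df j : R -> R := if j == i then fun y => kfac n (len j) (t j) (X j z) y - kfac n (len j) (s j) (X j z) y
             else kfac' n (len j) (s j) (X j z).

Let ef j : elementary (f j).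
Proof.
rewrite /f; case: ifP => _; last exact: elementary_kfac.
have -> : (fun y => kprim n (len j) (t j) (X j z) y - kprim n (len j) (s j) (X j z) y) =
    (fun y => kprim n (len j) (t j) (X j z) y + (-1) * kprim n (len j) (s j) (X j z) y).
  by apply/funext => y; rewrite mulN1r.
apply: elementaryD; first exact: elementary_kprim.
by apply: elementaryM; [exact: elementary_cst|exact: elementary_kprim].
Qed.

Let dff j y : is_derive y (1 : R) (f j) (df j y).
Proof.
rewrite /f /df; case: ifP => _; last exact: is_derive_kfac.
by apply: is_deriveB; exact: is_derive_kprim.
Qed.

Let f_supp j y : f j y != 0 -> lo j <= y <= hi j.
Proof.
have [->|ji] := eqVneq j i; [rewrite /f eqxx|rewrite /f (negbTE ji)].
  apply: contraNT; rewrite negb_and -!ltNge => /orP[|].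
    by rewrite lt_min => /andP[H1 H2]; rewrite !(kprim_eq0 n_gt0)// ?subrr// ltW.
  by rewrite gt_max => /andP[H1 H2]; rewrite !(kprim_eq1 n_gt0)// ?subrr// ltW.
move=> /(kfac_neq0 n_gt0 (len_gt0 j) (s_gt0 j)) /andP[H1 H2].
by rewrite ge_min le_max H1 H2.
Qed.

Let df_supp j y : df j y != 0 -> lo j <= y <= hi j.
Proof. exact: (derive_supp (@f_supp j) (dff j)). Qed.

(** For nonnegative [X j y] the upper end of the hull decides, otherwise the lower end; either end
    is attained at one of the two scales. *)
Let box_abs y j : lo j <= X j y <= hi j ->
  (`|X j y| <= (1 - s j) * `|X j z| + krho R n * s j * len j) \/
  (`|X j y| <= (1 - t j) * `|X j z| + krho R n * t j * len j).
Proof.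
rewrite ge_min le_max => /andP[H1 H2].
have bnd q : q <= 1 -> `|(1 - q) * X j z| <= (1 - q) * `|X j z|.
  by move=> q1; rewrite normrM ger0_norm// subr_ge0.
have := bnd _ (scale_le1 s_bounds j); rewrite ler_norml => /andP[A1 A2].
have := bnd _ (scale_le1 t_bounds j); rewrite ler_norml => /andP[B1 B2].
rewrite !ler_norml; set a := (1 - s j) * X j z in H1 H2 A1 A2 *.
set b := (1 - t j) * X j z in H1 H2 B1 B2 *.
set p := krho R n * s j * len j in H1 H2 *.
set q := krho R n * t j * len j in H1 H2 *.
have [Y|Y] := lerP 0 (X j y).
- case/orP: H2 => H2; [left|right]; apply/andP; split; try lra.
- case/orP: H1 => H1; [left|right]; apply/andP; split; lra.
Qed.

Let box_Q y : (forall j, lo j <= X j y <= hi j) -> Q y.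
Proof.
move=> Hb; apply: (Q_kern l01 Qz) => j.
by have [?|?] := box_abs (Hb j); [exists (s j)|exists (t j)].
Qed.

(** The contraction moves coordinate [j] by at most l^deg r^deg and the bump has a smaller
    half-width. The total displacement is at most 2 l^deg r^deg <= (2 e)^deg. *)
Let box_S y : (forall j, lo j <= X j y <= hi j) -> S y.
Proof.
move=> Hb j; have := Hb j; rewrite ge_min le_max => /andP[H1 H2].
have Xl := Q_len Qz j; have r8 := krho_le R n_gt0; have r0 := krho_gt0 R n_gt0.
have E : 2 * (l ^+ deg j * len j) <= (2 * e) ^+ deg j.
  rewrite /e !exprMn ler_wpM2r ?mulr_ge0 ?exprn_ge0 ?(ltW l_gt0) ?(ltW r_gt0)//.
  by case: (j) => [k|]; rewrite /deg /= ?expr1// expr2; lra.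
have bnd q : (l / 2) ^+ deg j <= q <= l ^+ deg j -> 0 < q ->
   0 <= q * len j /\ q * len j <= l ^+ deg j * len j /\ `|q * X j z| <= q * len j /\
   krho R n * q * len j <= q * len j.
  move=> /andP[_ q1] q0; have ql : 0 <= q * len j by exact: mulr_ge0 (ltW q0) (ltW (len_gt0 j)).
  split=> //; split; first by rewrite ler_wpM2r// ltW.
  split; first by rewrite normrM gtr0_norm// ler_wpM2l// ltW.
  rewrite -mulrA ler_piMl//; lra.
have [S0 [S1 [S2 S3]]] := bnd _ (s_bounds j) (s_gt0 j).
have [T0 [T1 [T2 T3]]] := bnd _ (t_bounds j) (t_gt0 j).
move: S2 T2; rewrite !ler_norml => /andP[S2 S2'] /andP[T2 T2'].
move: H1 H2; rewrite !mulrBl !mul1r => H1 H2.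
apply/andP; split.
- case/orP: H2 => H2; lra.
- case/orP: H1 => H1; lra.
Qed.

Let F j : R := K / e ^+ deg j.
Let F_gt0 j : 0 < F j. Proof. by rewrite divr_gt0// exprn_gt0. Qed.

Let kb j x y : `|kfac n (len j) (s j) x y| <= F j /\ `|kfac' n (len j) (s j) x y| <= K / (e ^+ deg j) ^+ 2.
Proof.
apply: HK; first exact: exprn_gt0.
have /andP[sl _] := s_bounds j.
rewrite (le_trans (y := (l / 2) ^+ deg j * len j))//; last by rewrite ler_wpM2r// ltW.
rewrite /e exprMn expr_div_n [leRHS]mulrAC; apply: ler_wpM2l.
  by rewrite mulr_ge0 ?exprn_ge0 ?(ltW l_gt0) ?(ltW r_gt0).
by case: (j) => [k|]; rewrite /deg /= lef_pV2 ?posrE ?exprn_gt0//; rewrite ?expr1 ?expr2; lra.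
Qed.

Let prodF : \prod_j F j = K ^+ n.+1 / e ^+ Ns.
Proof.
rewrite /F prodf_div prodr_const card_option card_ord; congr (_ / _).
by rewrite -expr_sum sum_pdeg.
Qed.

Let B : R := e * (K ^+ n.+1 / e ^+ Ns).

Let Feq : F i * \prod_(j | j != i) F j = K ^+ n.+1 / e ^+ Ns.
Proof. by rewrite -prodF [RHS](bigD1 i). Qed.

Let prod_le (P : pred (option 'I_n)) z' : (forall j, P j -> j != i) ->
  `|\prod_(j | P j) f j (X j z')| <= \prod_(j | P j) F j.
Proof.
move=> Pi; rewrite normr_prod; apply: ler_prod => j /Pi /negbTE ji.
by rewrite normr_ge0 /f ji; have [] := kb j (X j z) (X j z').
Qed.

Let eF (i1 : 'I_n) : F (Some i1) = K / e. Proof. by rewrite /F /deg expr1. Qed.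

Let VB : V t z - V s z = \int[mu]_z' (u z' * (df i (X i z') * \prod_(j | j != i) f j (X j z'))).
Proof.
rewrite /V -RintegralB//; [|exact: iuK|exact: iuK].
apply: eq_Rintegral => y _.
rewrite -mulrBl mulrC; congr (_ * _).
rewrite /kern (bigD1 i)//= [X in _ - X](bigD1 i)//= /df eqxx mulrBl; congr (_ * _ - _ * _).
  by apply: eq_bigr => j ji; rewrite /f (negbTE ji) (st ji).
by apply: eq_bigr => j ji; rewrite /f (negbTE ji).
Qed.

Let out_box z' : ~ S z' -> exists j, ~~ (lo j <= X j z' <= hi j).
Proof.
move=> nS; apply/not_existsP => Hb; apply: nS; apply: box_S => j.
by apply/negPn/negP; exact: Hb.
Qed.

Let mf j : measurable_fun setT (fun z' => f j (X j z')).
Proof.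
apply: (measurableT_comp (f := f j)); last exact: measurable_coordX.
by apply: measurable_elementary; exact: ef.
Qed.

Let mdf j : measurable_fun setT (fun z' => df j (X j z')).
Proof.
apply: (measurableT_comp (f := df j)); last exact: measurable_coordX.
by apply: measurable_elementary; exact: elementary_derive_ext (ef j) (dff j).
Qed.

Let mS : measurable S.
Proof. by apply: measurable_pnb => k; exact: measurable_coordX. Qed.

(** For a spatial coordinate the derivative moves onto [u]; for time it is exchanged for spatial
    derivatives paired with [G]. Having 1 in place of [F i] gains e in space. In time it gains e^2,
    and the derivative of a spatial factor takes back one e. The factor [n] counts the components of
    [G]. *)
Lemma swap_le : `|V t z - V s z| <= n%:R * B * \int[mu]_(y in S) H y.
Proof.
have I0 : 0 <= \int[mu]_(y in S) H y by apply: Rintegral_ge0.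
have B0 : 0 <= B by rewrite mulr_ge0 ?(ltW e_gt0)// divr_ge0// exprn_ge0 ?(ltW K_gt0) ?(ltW e_gt0).
have n1 : 1 <= n%:R :> R by rewrite ler1n.
rewrite VB; case Ei : i => [k|].
- have dffk y : is_derive y (1 : R) (f (Some k)) (df (Some k) y) by exact: dff.
  rewrite (weak_x ef f_supp box_Q dffk) normrN.
  have mfD : measurable_fun setT (fun z' => Du k z' * \prod_j f j (X j z')).
    apply: measurable_funM => //.
    by under eq_fun do rewrite -big_filter; apply: measurable_prod.
  have f0 z' : ~ S z' -> Du k z' * \prod_j f j (X j z') = 0.
    move=> /out_box[j jb]; rewrite (bigD1 j)//=.
    have [->|/f_supp] := eqVneq (f j (X j z')) 0; first by rewrite mul0r mulr0.
    by rewrite (negbTE jb).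
  have fB z' : S z' -> `|Du k z' * \prod_j f j (X j z')| <= B * H z'.
    move=> _; rewrite normrM mulrC ler_pM// (bigD1 i)//= normrM.
    apply: (le_trans (y := 1 * \prod_(j | j != i) F j)).
      apply: ler_pM => //; last exact: prod_le.
      by rewrite /f eqxx normr_kprimB.
    rewrite mul1r /B -Feq Ei eF mulrA -[leLHS]mul1r ler_wpM2r//.
      by rewrite prodr_ge0// => j _; exact: ltW.
    by rewrite mulrC divfK// gt_eqF.
  have [_] := normr_Rintegral_le mS mfD mH H_ge0 iH B0 f0 fB.
  by move/le_trans; apply; rewrite ler_wpM2r// ler_peMl.
- rewrite (weak_t ef f_supp box_Q dff).
  have mfG : measurable_fun setT (fun z' => \sum_k G k z' * (df (Some k) (X (Some k) z') *
      \prod_(j | j != Some k) f j (X j z'))).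
    apply: measurable_sum => k; apply: measurable_funM => //.
    apply: measurable_funM => //.
    by under eq_fun do rewrite -big_filter; apply: measurable_prod.
  have nB0 : 0 <= n%:R * B by rewrite mulr_ge0.
  have f0 z' : ~ S z' -> \sum_k G k z' * (df (Some k) (X (Some k) z') *
      \prod_(j | j != Some k) f j (X j z')) = 0.
    move=> /out_box[j jb]; rewrite big1// => k _.
    have [jk|jk] := eqVneq j (Some k).
      rewrite -jk; have [->|/df_supp] := eqVneq (df j (X j z')) 0.
        by rewrite mul0r mulr0.
      by rewrite (negbTE jb).
    rewrite (bigD1 j)//=.
    have [->|/f_supp] := eqVneq (f j (X j z')) 0; first by rewrite mul0r !mulr0.
    by rewrite (negbTE jb).
  have fB z' : S z' -> `|\sum_k G k z' * (df (Some k) (X (Some k) z') *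
      \prod_(j | j != Some k) f j (X j z'))| <= n%:R * B * H z'.
    move=> _; rewrite (le_trans (ler_norm_sum _ _ _))//.
    rewrite -mulrA mulr_natl -[X in _ *+ X](card_ord n) -sumr_const.
    apply: ler_sum => k _; rewrite normrM mulrC ler_pM//.
    rewrite (bigD1 None)//= !normrM mulrCA.
    apply: (le_trans (y := 1 * ((K / e ^+ 2) * \prod_(j | (j != Some k) && (j != None)) F j))).
      apply: ler_pM => //.
        by rewrite /f Ei eqxx normr_kprimB.
      apply: ler_pM => //; last by apply: prod_le => j /andP[_]; rewrite Ei.
      rewrite /df Ei /=.
      by have [_] := kb (Some k) (X (Some k) z) (X (Some k) z'); rewrite /deg /= expr1.
    have : \prod_j F j = F (Some k) * (F None * \prod_(j | (j != Some k) && (j != None)) F j).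
      by rewrite (bigD1 (Some k))//= (bigD1 None).
    rewrite prodF /B mul1r => ->; rewrite eF.
    have -> : e * (K / e * (F None * \prod_(j | (j != Some k) && (j != None)) F j)) =
      K * (F None * \prod_(j | (j != Some k) && (j != None)) F j).
      by rewrite mulrA [e * _]mulrC divfK// gt_eqF.
    apply: ler_peMl K_ge1; apply: mulr_ge0; first exact: ltW (F_gt0 None).
    by apply: prodr_ge0 => j _; exact: ltW (F_gt0 j).
  by have [] := normr_Rintegral_le mS mfG mH H_ge0 iH nB0 f0 fB.
Qed.

End swap.

(* Interpolating between two dyadic scales one coordinate at a time *)
Lemma kernel_average_step (l : R) (z : T) (K : R) :
  0 < l <= 1 -> Q z -> 1 <= K ->
  (forall L s x y l, 0 < l -> l / 4 <= s * L ->
    `|kfac n L s x y| <= K / l /\ `|kfac' n L s x y| <= K / l ^+ 2) ->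
  `|V (fun j => (l / 2) ^+ deg j) z - V (fun j => l ^+ deg j) z| <=
  (n.+1 * n)%:R * K ^+ n.+1 * (l * r) / (l * r) ^+ Ns *
    \int[mu]_(y in pnb X deg (2 * (l * r)) z) H y.
Proof.
move=> l01 Qz K1 HK.
(* The coordinates in [sq] are already at the finer scale; each further one costs one application of
   [swap_le]. *)
pose S (sq : seq (option 'I_n)) j : R := if j \in sq then (l / 2) ^+ deg j else l ^+ deg j.
set I := \int[mu]_(y in _) H y; set B := l * r * (K ^+ n.+1 / (l * r) ^+ Ns).
have Sb sq j : (l / 2) ^+ deg j <= S sq j <= l ^+ deg j.
  have H2 : (l / 2) ^+ deg j <= l ^+ deg j.
    case/andP: l01 => l0 _; rewrite lerXn2r ?nnegrE ?divr_ge0 ?(ltW l0)//; lra.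
  by rewrite /S; case: ifP; rewrite ?lexx ?H2.
have step sq : `|V (S sq) z - V (S [::]) z| <= (size sq)%:R * (n%:R * B * I).
  elim: sq => [|i sq IH]; first by rewrite subrr normr0 mul0r.
  rewrite -(subrK (V (S sq) z) (V (S (i :: sq)) z)) -addrA (le_trans (ler_normD _ _))//.
  rewrite [size _]/= -addn1 natrD mulrDl mul1r [leRHS]addrC; apply: lerD; last exact: IH.
  apply: (@swap_le l z i) => // j ji.
  by rewrite /S inE (negbTE ji).
have := step (enum {: option 'I_n}).
rewrite -cardE card_option card_ord.
have -> : S (enum {: option 'I_n}) = (fun j => (l / 2) ^+ deg j).
  by apply/funext => j; rewrite /S mem_enum.
move/le_trans; apply; rewrite le_eqVlt; apply/orP; left; apply/eqP.
by rewrite /B natrM; ring.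
Qed.

End spacetime_kernel.

(** * Convergence of the kernel averages *)

Section kernel_limit.
Context (R : realType) (n : nat).
Hypothesis n_gt0 : (0 < n)%N.
Let T := ('rV[R]_n * R)%type.
Let mu := @lebesgue_spacetime R n.
Let X := @coordX R n.
Let deg := @pdeg n.
Context (r : R).
Hypothesis r_gt0 : 0 < r.
Context (Q : set T).
Hypothesis mQ : measurable Q.
Hypothesis Q_len : forall z, Q z -> forall j, `|X j z| <= r ^+ deg j.
Hypothesis Q_kern : forall (l : R) z y, 0 < l <= 1 -> Q z ->
  (forall j, exists2 s : R, (l / 2) ^+ deg j <= s <= l ^+ deg j &
     `|X j y| <= (1 - s) * `|X j z| + krho R n * s * r ^+ deg j) -> Q y.

Let mX i : measurable_fun setT (X i). Proof. exact: measurable_coordX. Qed.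

Lemma mu_domain_lty : (mu Q < +oo)%E.
Proof.
have l0 j : 0 <= 3 * r ^+ deg j by rewrite mulr_ge0// exprn_ge0// ltW.
apply: (@le_lt_trans _ _ (mu (cbox X (fun j => - r ^+ deg j) (fun j => 3 * r ^+ deg j)))).
  apply: le_measure; rewrite ?inE//; first exact: measurable_cbox.
  move=> z Qz j; have := Q_len Qz j; rewrite ler_norml => /andP[H1 H2].
  have : 0 < r ^+ deg j by rewrite exprn_gt0.
  by move=> r0; apply/andP; split; [exact: H1|lra].
suff -> : mu (cbox X (fun j => - r ^+ deg j) (fun j => 3 * r ^+ deg j)) =
    (\prod_j (3 * r ^+ deg j))%:E by rewrite ltry.
exact: lebesgue_spacetime_cbox.
Qed.

Lemma domain_hyperplane0 i b : mu (Q `&` [set z | X i z = b]) = 0%E.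
Proof.
have l0 j : 0 <= 3 * r ^+ deg j by rewrite mulr_ge0// exprn_ge0// ltW.
have m1 : measurable [set z | X i z = b].
  rewrite (_ : [set z | _] = X i @^-1` [set b]) //.
  by rewrite -[X in measurable X]setTI; exact: mX.
apply/eqP; rewrite eq_le measure_ge0 andbT.
rewrite -(@cbox_hyperplane0 _ _ _ mu _ X mX (@lebesgue_spacetime_cbox R n)
  (fun j => - r ^+ deg j) (fun j => 3 * r ^+ deg j) i b l0).
apply: le_measure; rewrite ?inE//.
- exact: measurableI.
- by apply: measurableI => //; exact: measurable_cbox.
move=> z [Qz Xz]; split=> // j; have := Q_len Qz j; rewrite ler_norml => /andP[H1 H2].
have : 0 < r ^+ deg j by rewrite exprn_gt0.
by move=> r0; apply/andP; split; [exact: H1|lra].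
Qed.

Let ls (j : nat) (i : option 'I_n) : R := (2 ^- j) ^+ deg i.
Let ls_gt0 j i : 0 < ls j i.
Proof. by rewrite exprn_gt0// invr_gt0 exprn_gt0. Qed.
Let ls_le1 j i : ls j i <= 1.
Proof. by rewrite exprn_ile1// ?invr_ge0 ?invf_le1 ?exprn_ge0 ?exprn_ege1// ?exprn_gt0// ler1n. Qed.

(** Cut off to [z] in [Q], where the contraction keeps the support of the kernel inside [Q]. *)
Let kappa j (z z' : T) : R := \1_Q z * kern r (ls j) z z'.

Let kappa_ge0 j z z' : 0 <= kappa j z z'.
Proof. by rewrite mulr_ge0// kern_ge0. Qed.

Let kappa_neq0 j z z' : kappa j z z' != 0 -> Q z /\
  forall i, `|X i z' - (1 - ls j i) * X i z| <= krho R n * ls j i * r ^+ deg i.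
Proof.
rewrite mulf_eq0 negb_or indicE => /andP[].
case: (boolP (z \in Q)) => [|_ /eqP//]; rewrite inE => Qz _.
move=> /(kern_neq0 n_gt0 r_gt0 (ls_gt0 j)) H; split=> // i; have /andP[H1 H2] := H i.
by rewrite ler_norml; apply/andP; split; [rewrite lerBrDl; move: H1; rewrite -/X -/deg; lra|move: H2; rewrite -/X -/deg; lra].
Qed.

Let kappa_Q j z z' : kappa j z z' != 0 -> Q z /\ Q z'.
Proof.
move=> /kappa_neq0[Qz H]; split=> //; apply: (@Q_kern (2 ^- j) z) => // [|i].
  rewrite invr_gt0 exprn_gt0//= invf_le1 ?exprn_gt0// exprn_ege1// ler1n//.
exists (ls j i).
  have h0 : 0 < 2 ^- j :> R by rewrite invr_gt0 exprn_gt0.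
  rewrite lexx andbT lerXn2r ?nnegrE ?divr_ge0 ?(ltW h0)//.
  by rewrite ler_pdivrMr// ler_peMr ?(ltW h0)// ler1n.
rewrite -(subrK ((1 - ls j i) * X i z) (X i z')) (le_trans (ler_normD _ _))//.
rewrite [leRHS]addrC lerD//.
by rewrite normrM ger0_norm// subr_ge0.
Qed.

Let kappa_near j z z' : kappa j z z' != 0 -> forall i,
  `|X i z - X i z'| <= 2 * (ls j i * r ^+ deg i).
Proof.
move=> /kappa_neq0[Qz H] i; have := H i; have := Q_len Qz i.
have r8 := krho_le R n_gt0; have l0 := ls_gt0 j i; have r0 : 0 < r ^+ deg i by rewrite exprn_gt0.
have lr : 0 < ls j i * r ^+ deg i by exact: mulr_gt0.
move=> Xl Hi.
have A1 : `|ls j i * X i z| <= ls j i * r ^+ deg i by rewrite normrM gtr0_norm// ler_pM2l.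
have A2 : krho R n * ls j i * r ^+ deg i <= ls j i * r ^+ deg i.
  by rewrite -mulrA ler_piMl ?(ltW lr)//; lra.
move: A1 Hi; rewrite distrC !ler_norml => /andP[a1 a2] /andP[b1 b2].
rewrite mulrBl mul1r in b1 b2; apply/andP; split; lra.
Qed.

Lemma domain_approximation (f v : T -> R) (c q : R) (B : \bar R) :
  measurable_fun setT f -> mu.-integrable setT (EFin \o f) ->
  measurable_fun Q v -> (forall z, Q z -> 0 <= v z) -> 0 < q ->
  (forall j, (\int[mu]_(z in Q)
     (`|\int[mu]_z' (kern r (fun i => (2 ^- j) ^+ deg i) z z' * f z') - c| `^ q * v z)%:E
     <= B)%E) ->
  (\int[mu]_(z in Q) (`|f z - c| `^ q * v z)%:E <= B)%E.
Proof.
move=> mf intf mv v0 q0 HB.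
have [K K1 HK] := @kfac_bounds R n n_gt0.
have K0 : 0 < K by rewrite (lt_le_trans _ K1).
(* A bound for the integral in [z], where the contraction destroys the symmetry with [z']. The
   kernel is at most the product of K / (ls r^deg) and, for fixed [z'], it vanishes outside a box of
   sides 5 ls r^deg; 5 rather than 4 because the box is half-open. *)
pose C : R := \prod_(i : option 'I_n) (5 * K).
have C1 : 1 <= C by rewrite /C prodr_const exprn_ege1//; lra.
have l0 j i : 0 <= 5 * (ls j i * r ^+ deg i).
  by rewrite mulr_ge0// mulr_ge0 ?(ltW (ls_gt0 _ _))// exprn_ge0// ltW.
have kernM j z z' : kern r (ls j) z z' <= \prod_i (K / (ls j i * r ^+ deg i)).
  apply: ler_prod => i _.
  have ri0 : 0 < r ^+ pdeg i by rewrite exprn_gt0.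
  rewrite (kfac_ge0 n_gt0 _ _ (ltW ri0) (ltW (ls_gt0 j i)))/=.
  have sl : 0 < ls j i * r ^+ pdeg i by rewrite mulr_gt0.
  have [|+ _] := HK (r ^+ pdeg i) (ls j i) (X i z) (X i z') _ sl.
    by rewrite ler_pdivrMr// ler_peMr ?(ltW sl)// ler1n.
  by apply: le_trans; exact: ler_norm.
have kI z j : (\int[mu]_z' (kappa j z z')%:E = (\1_Q z)%:E)%E.
  rewrite /kappa; under eq_integral do rewrite EFinM.
  rewrite ge0_integralZl//=.
  - by rewrite (integral_kern n_gt0 r_gt0) ?mule1.
  - by apply/measurable_EFinP; exact: measurable_kern.
  - by move=> z' _; rewrite lee_fin kern_ge0.
apply: (@approx_identity_powR_le _ _ _ mu (option 'I_n) X Q kappa C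
  (fun j => 2 ^- j * (2 * (1 + r) ^+ 2)) mX mQ mu_domain_lty domain_hyperplane0
  (@coordX_generate R n) _ kappa_ge0 kappa_Q _ _ _ _ f v c q B mf _ mv v0 q0).
- move=> j; apply: measurable_funM; last exact: measurable_kern2.
  by apply: measurableT_comp measurable_fst; exact: measurable_indic.
- by move=> j z; rewrite kI lee_fin (le_trans _ C1)// indicE; case: (z \in Q).
- move=> j z'.
  pose M := \prod_i (K / (ls j i * r ^+ deg i)).
  pose S := cbox X (fun i => X i z' - 2 * (ls j i * r ^+ deg i)) (fun i => 5 * (ls j i * r ^+ deg i)).
  have mS : measurable S by exact: measurable_cbox.
  apply: (@le_trans _ _ (\int[mu]_z (M * \1_S z)%:E)%E).
    apply: ge0_le_integral_nomeas => z _; first by rewrite lee_fin.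
    rewrite lee_fin; have [->|H] := eqVneq (kappa j z z') 0.
      by rewrite mulr_ge0// prodr_ge0// => i _; rewrite divr_ge0 ?(ltW K0)// mulr_ge0 ?(ltW (ls_gt0 _ _))// exprn_ge0// ltW.
    have Sz : S z.
      move=> i; have := kappa_near H i; rewrite ler_norml => /andP[H1 H2].
      have : 0 < ls j i * r ^+ deg i by rewrite mulr_gt0// exprn_gt0.
      by move=> L; apply/andP; split; lra.
    rewrite indicE mem_set// mulr1 /kappa; apply: le_trans (kernM j z z').
    rewrite ler_piMl ?kern_ge0// indicE; case: (z \in Q).
  under eq_integral do rewrite EFinM.
  rewrite ge0_integralZl//; last 2 first.
    by apply/measurable_EFinP; exact: measurable_indic.
    by rewrite lee_fin prodr_ge0// => i _; rewrite divr_ge0 ?(ltW K0)// mulr_ge0 ?(ltW (ls_gt0 _ _))// exprn_ge0// ltW.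
  rewrite integral_indic// setIT.
  rewrite [X in (_ * X)%E](_ : _ = (\prod_i (5 * (ls j i * r ^+ deg i)))%:E); last first.
    exact: lebesgue_spacetime_cbox.
  rewrite -EFinM lee_fin /M -big_split /= le_eqVlt; apply/orP; left; apply/eqP.
  apply: eq_bigr => i _; rewrite mulrCA divfK// gt_eqF// mulr_gt0// exprn_gt0//.
- move=> j z z' H i; apply: le_trans (kappa_near H i) _.
  rewrite mulrCA ler_pM ?mulr_ge0 ?exprn_ge0 ?(ltW r_gt0) ?(ltW (ls_gt0 _ _))//.
    have h0 : 0 <= 2 ^- j :> R by rewrite invr_ge0 exprn_ge0.
    rewrite /ls; case: (i) => [k|]; rewrite /deg /= ?expr1// expr2 ler_piMl//.
    by rewrite invf_le1 ?exprn_gt0// exprn_ege1// ler1n.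
  rewrite ler_pM2l// (le_trans (y := (1 + r) ^+ deg i))//.
    by rewrite lerXn2r ?nnegrE ?(ltW r_gt0) ?addr_ge0 ?(ltW r_gt0)// lerDr.
  by rewrite ler_weXn2l ?lerDl ?(ltW r_gt0)//; case: (i).
- move=> e e0; set M := 2 * (1 + r) ^+ 2.
  have M0 : 0 < M by rewrite mulr_gt0// exprn_gt0// addr_gt0.
  exists (Num.bound (M / e)) => j Nj.
  rewrite mulrC ler_pdivrMr ?exprn_gt0// mulrC -ler_pdivrMr//.
  rewrite (le_trans (ltW (archi_boundP (divr_ge0 (ltW M0) (ltW e0)))))//.
  rewrite (le_trans (y := j%:R))// ?ler_nat//.
  by rewrite -natrX ler_nat ltnW// ltn_expl.
- have := intf => /integrableP[_]; apply: le_lt_trans.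
  apply: ge0_subset_integral => //.
  by apply/measurable_EFinP; apply: measurableT_comp.
- move=> j z; have [M M0 HM] := @kern_bounded R n n_gt0 r r_gt0 (ls j) (ls_gt0 j).
  exists M => z'; rewrite (le_trans _ (HM z z'))// ler_piMl ?kern_ge0// indicE; case: (z \in Q).
- by move=> j z Qz; rewrite kI indicE mem_set.
- move=> j; apply: le_trans _ (HB j); rewrite le_eqVlt; apply/orP; left; apply/eqP.
  apply: eq_integral => z; rewrite inE => Qz.
  suff -> : \int[mu]_z' (kappa j z z' * f z') =
      \int[mu]_z' (kern r (fun i => (2 ^- j) ^+ deg i) z z' * f z') by [].
  by apply: eq_Rintegral => z' _; rewrite /kappa indicE mem_set// mul1r.
Qed.

End kernel_limit.

Section oscillation.
Context (R : realType) (n : nat).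
Hypothesis n_gt0 : (0 < n)%N.
Let T := ('rV[R]_n * R)%type.
Let mu := @lebesgue_spacetime R n.
Let X := @coordX R n.
Let deg := @pdeg n.
Context (r : R).
Hypothesis r_gt0 : 0 < r.
Context (Q : set T).
Hypothesis mQ : measurable Q.
Hypothesis Q_len : forall z, Q z -> forall j, `|X j z| <= r ^+ deg j.
Hypothesis Q_kern : forall (l : R) z y, 0 < l <= 1 -> Q z ->
  (forall j, exists2 s : R, (l / 2) ^+ deg j <= s <= l ^+ deg j &
     `|X j y| <= (1 - s) * `|X j z| + krho R n * s * r ^+ deg j) -> Q y.

Context (w : T -> R) (p A K g : R).
Hypothesis mw : measurable_fun setT w.
Hypothesis w_gt0 : forall z, 0 < w z.
Hypothesis p_gt1 : 1 < p.
Hypothesis A_ge0 : 0 <= A.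
Hypothesis K_ge0 : 0 <= K.
Hypothesis g_gt1 : 1 < g.
Hypothesis sg_lty : forall a t, 0 < t ->
  (\int[mu]_(z in pcorner X deg a t) (w z `^ (- (p - 1)^-1))%:E < +oo)%E.
Hypothesis Ap : forall a t, 0 < t ->
  (\int[mu]_(z in pcorner X deg a t) w z) *
  (\int[mu]_(z in pcorner X deg a t) w z `^ (- (p - 1)^-1)) `^ (p - 1) <=
  A * (\prod_i (2 * t ^+ deg i)) `^ p.
Hypothesis RH : forall a t, 0 < t ->
  (\int[mu]_(z in pcorner X deg a t) (w z `^ g)%:E <=
   (K * ((\int[mu]_(z in pcorner X deg a t) w z) `^ g *
         (\prod_i (2 * t ^+ deg i)) `^ (1 - g)))%:E)%E.
Hypothesis g_small : 2 `^ (n.+2%:R * (g - 1)) <= 3 / 2.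

Context (u : T -> R) (Du G : 'I_n -> T -> R) (H : T -> R) (F : R).
Hypothesis m_u : measurable_fun setT u.
Hypothesis mH : measurable_fun setT H.
Hypothesis H_ge0 : forall z, 0 <= H z.
Hypothesis iH : mu.-integrable setT (EFin \o H).
Hypothesis mDu : forall i, measurable_fun setT (Du i).
Hypothesis mG : forall i, measurable_fun setT (G i).
Hypothesis DuH : forall i z, `|Du i z| <= H z.
Hypothesis GH : forall i z, `|G i z| <= H z.
Hypothesis iu : mu.-integrable setT (EFin \o u).
Hypothesis HF : (\int[mu]_z (H z `^ p * w z)%:E = F%:E)%E.
Hypothesis weak_x : forall (f : option 'I_n -> R -> R) (lo hi : option 'I_n -> R)
  (df : R -> R) (i : 'I_n),
  (forall j, elementary (f j)) ->
  (forall j y, f j y != 0 -> lo j <= y <= hi j) ->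
  (forall z, (forall j, lo j <= X j z <= hi j) -> Q z) ->
  (forall y, is_derive y (1 : R) (f (Some i)) (df y)) ->
  \int[mu]_z (u z * (df (X (Some i) z) * \prod_(j | j != Some i) f j (X j z))) =
  - \int[mu]_z (Du i z * \prod_j f j (X j z)).
Hypothesis weak_t : forall (f : option 'I_n -> R -> R) (lo hi : option 'I_n -> R)
  (df : option 'I_n -> R -> R),
  (forall j, elementary (f j)) ->
  (forall j y, f j y != 0 -> lo j <= y <= hi j) ->
  (forall z, (forall j, lo j <= X j z <= hi j) -> Q z) ->
  (forall j y, is_derive y (1 : R) (f j) (df j y)) ->
  \int[mu]_z (u z * (df None (X None z) * \prod_(j | j != None) f j (X j z))) =
  \int[mu]_z (\sum_i G i z * (df (Some i) (X (Some i) z) *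
    \prod_(j | j != Some i) f j (X j z))).

Context (M : R).
Hypothesis M_ge1 : 1 <= M.
Hypothesis HM : forall L s x y l, 0 < l -> l / 4 <= s * L ->
  `|kfac n L s x y| <= M / l /\ `|kfac' n L s x y| <= M / l ^+ 2.

Lemma oscillation_bound : exists c : R,
  (\int[mu]_(z in Q) (`|u z - c| `^ (p * g) * w z `^ g)%:E <=
   (2 * (2 `^ (p * g) * ((n.+1 * n)%:R * M ^+ n.+1) `^ (p * g) *
         (2 `^ (p * g) * K * A `^ g) *
         (\prod_(i : option 'I_n) (2 * 6 ^+ pdeg i)) `^ (p * g + (1 - g))) *
    (r `^ (p * g) * F `^ g * (r ^+ n.+2) `^ (1 - g)))%:E)%E.
Proof.
pose V j z := \int[mu]_z' (kern r (fun i => (2 ^- j) ^+ deg i) z z' * u z').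
exists (V 0%N 0).
have p_gt0 : 0 < p by rewrite (lt_trans ltr01).
have pg0 : 0 < p * g by rewrite mulr_gt0// (lt_trans ltr01).
apply: (domain_approximation n_gt0 r_gt0 mQ Q_len Q_kern m_u iu _ _ pg0).
- apply: measurable_funTS; exact: measurable_fun_powR.
- by move=> z _; exact: powR_ge0.
move=> J.
have C0 : 0 <= (n.+1 * n)%:R * M ^+ n.+1 :> R.
  by rewrite mulr_ge0// exprn_ge0// (le_trans ler01).
have g_small' : 2 `^ ((\sum_i deg i)%:R * (g - 1)) <= 3 / 2 by rewrite sum_pdeg.
have V0 z : Q z -> V 0%N z = V 0%N 0.
  move=> _; apply: eq_Rintegral => z' _.
  suff -> : kern r (fun i => (2 ^- 0) ^+ deg i) z z' =
    kern r (fun i => (2 ^- 0) ^+ deg i) (0 : T) z' by [].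
  (* At scale 1 the factor 1 - s vanishes, and [z] disappears from the kernel. *)
  by apply: eq_bigr => i _; rewrite /kfac expr0 invr1 expr1n subrr !mul0r.
have Vstep j z : Q z -> `|V j.+1 z - V j z| <=
    ((n.+1 * n)%:R * M ^+ n.+1) * (r / 2 ^+ j) / (r / 2 ^+ j) ^+ (\sum_i deg i) *
    \int[mu]_(y in pnb X deg (2 * (r / 2 ^+ j)) z) H y.
  move=> Qz.
  have l01 : 0 < (2 ^- j : R) <= 1.
    apply/andP; split; first by rewrite invr_gt0 exprn_gt0.
    by rewrite invf_le1 ?exprn_gt0// exprn_ege1// ler1n.
  have := kernel_average_step n_gt0 r_gt0 mH H_ge0 iH mDu mG DuH GH iu Q_len Q_kern
    weak_x weak_t l01 Qz M_ge1 HM.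
  rewrite sum_pdeg -[2 ^- j * r]mulrC => Hs; apply: le_trans Hs.
  rewrite le_eqVlt; apply/orP; left; apply/eqP.
  suff -> : V j.+1 z = \int[mu]_z' (kern r (fun i => (2 ^- j / 2) ^+ deg i) z z' * u z') by [].
  apply: eq_Rintegral => z' _.
  suff -> : kern r (fun i => (2 ^- j.+1) ^+ deg i) z z' =
    kern r (fun i => (2 ^- j / 2) ^+ deg i) z z' by [].
  by apply: eq_bigr => i _; rewrite exprS invfM [_^-1 * _]mulrC.
have := @dyadic_chain_bound _ _ _ mu _ X deg (@measurable_coordX R n) (@pdeg_gt0 n)
  w p A K g mw w_gt0 p_gt1 A_ge0 K_ge0 g_gt1 sg_lty Ap RH H F mH H_ge0 HF g_small'
  Q V (V 0%N 0) r _ r_gt0 C0 V0 Vstep J.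
by rewrite sum_pdeg; exact.
Qed.

End oscillation.

(** * Borel representatives *)

Section ae_integral.
Import HBNNSimple.
Local Open Scope ereal_scope.
Context d (T : measurableType d) (R : realType) (mu : {measure set T -> \bar R}).

(** A simple function below [f] lies below [g] once it is set to 0 on the exceptional null set,
    which leaves its integral unchanged. *)
Let ge0_le_integral_ae (D : set T) (f g : T -> \bar R) :
  (forall x, D x -> 0 <= f x) -> (forall x, D x -> 0 <= g x) ->
  {ae mu, forall x, D x -> f x = g x} ->
  \int[mu]_(x in D) f x <= \int[mu]_(x in D) g x.
Proof.
move=> f0 g0 [N [mN N0 fgN]].
rewrite [leLHS]ge0_integralE//; apply: ge_ereal_sup => _ [h hf <-].
rewrite -integralT_nnsfun.
have mh : measurable_fun setT (fun x : T => (h x)%:E) by exact/measurable_EFinP.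
have h0 (x : T) : 0 <= (h x)%:E by rewrite lee_fin.
rewrite (@ge0_ae_eq_integral _ _ _ mu setT _ (fun x => (h x * \1_(~` N) x)%:E)) //.
- rewrite [leRHS]integral_mkcond; apply: ge0_le_integral_nomeas => x _.
    by rewrite lee_fin mulr_ge0.
  rewrite indicE patchE; have [xN|xN] := pselect (N x).
    rewrite memNset; last by move=> /(_ xN).
    by rewrite mulr0; case: ifPn => //; rewrite inE => /g0.
  rewrite mem_set// mulr1; have := hf x; rewrite patchE; case: ifPn => // + fx.
  rewrite inE => Dx; suff <- : f x = g x by [].
  by apply: contrapT => fg; apply: xN; apply: fgN => /(_ Dx).
- apply/measurable_EFinP; apply: measurable_funM => //.
  by apply: measurable_indic; exact: measurableC.
- by move=> x _; rewrite lee_fin mulr_ge0.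
exists N; split => // x; apply: contra_notP => xN _.
by rewrite indicE mem_set// mulr1.
Qed.

(* No measurability is needed, as in [ge0_le_integral_nomeas]. *)
Lemma eq_integral_ae (D : set T) (f g : T -> \bar R) :
  {ae mu, forall x, D x -> f x = g x} ->
  \int[mu]_(x in D) f x = \int[mu]_(x in D) g x.
Proof.
have ge0_eq (f' g' : T -> \bar R) : (forall x, 0 <= f' x) -> (forall x, 0 <= g' x) ->
    {ae mu, forall x, D x -> f' x = g' x} ->
    \int[mu]_(x in D) f' x = \int[mu]_(x in D) g' x.
  move=> f0 g0 fg; apply/eqP; rewrite eq_le !ge0_le_integral_ae//.
  by apply: filterS fg => x + Dx => /(_ Dx).
move=> fg; rewrite integralE [RHS]integralE; congr (_ - _).
- apply: ge0_eq => //; apply: filterS fg => x + Dx => /(_ Dx).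
  by rewrite !funeposE => ->.
- apply: ge0_eq => //; apply: filterS fg => x + Dx => /(_ Dx).
  by rewrite !funenegE => ->.
Qed.

Lemma eq_integral_set_ae (D E : set T) (f : T -> \bar R) :
  mu.-negligible ((D `\` E) `|` (E `\` D)) ->
  \int[mu]_(x in D) f x = \int[mu]_(x in E) f x.
Proof.
move=> DE; rewrite integral_mkcond [RHS]integral_mkcond; apply: eq_integral_ae.
apply: negligibleS DE => x /= H; apply: contrapT => nDE; apply: H => _.
rewrite !patchE; have [Dx|Dx] := pselect (D x); have [Ex|Ex] := pselect (E x).
- by rewrite !mem_set.
- by exfalso; apply: nDE; left.
- by exfalso; apply: nDE; right.
- by rewrite !memNset.
Qed.

Lemma ae_measurable_Borel (D : set T) (f : T -> R) : measurable D ->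
  ae_measurable mu D f ->
  exists g : T -> R, [/\ measurable_fun setT g, forall x, ~ D x -> g x = 0%R &
    {ae mu, forall x, D x -> f x = g x}].
Proof.
move=> mD [g mg fg]; exists (g \_ D); split.
- exact: (proj1 (measurable_restrictT g mD)).
- by move=> x Dx; rewrite patchE memNset.
- by apply: filterS fg => x + Dx => /(_ Dx) ->; rewrite patchE mem_set.
Qed.

Lemma weighted_Hoelder (D : set T) (f w : T -> R) (p N F S : R) :
  measurable D -> measurable_fun D f -> measurable_fun D w ->
  (forall z, (0 <= f z)%R) -> (forall z, (0 < w z)%R) -> (1 < p)%R ->
  \int[mu]_(z in D) (f z)%:E = N%:E ->
  \int[mu]_(z in D) (f z `^ p * w z)%:E = F%:E ->
  \int[mu]_(z in D) (w z `^ (- (p - 1)^-1))%:E = S%:E ->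
  (N `^ p <= 2 `^ p * (F * S `^ (p - 1)))%R.
Proof.
move=> mD mf mw f0 w0 p1 NE FE SE.
have N0 : (0 <= N)%R by rewrite -lee_fin -NE integral_ge0// => z _; rewrite lee_fin.
have F0 : (0 <= F)%R.
  by rewrite -lee_fin -FE integral_ge0// => z _; rewrite lee_fin mulr_ge0 ?powR_ge0// ltW.
have S0 : (0 <= S)%R by rewrite -lee_fin -SE integral_ge0// => z _; rewrite lee_fin powR_ge0.
apply: scaled_Young_Hoelder => // k k0.
have mp : measurable_fun D (fun z => (f z `^ p * w z)%:E).
  by apply/measurable_EFinP; apply: measurable_funM => //; exact: measurable_fun_powR.
have ms : measurable_fun D (fun z => (w z `^ (- (p - 1)^-1))%:E).
  by apply/measurable_EFinP; exact: measurable_fun_powR.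
rewrite -lee_fin EFinD !EFinM -NE -FE -SE.
rewrite -ge0_integralZl//; last 2 first.
  by move=> z _; rewrite lee_fin mulr_ge0 ?powR_ge0// ltW.
  by rewrite lee_fin ltW.
rewrite -ge0_integralZl//; last 2 first.
  by move=> z _; rewrite lee_fin powR_ge0.
  by rewrite lee_fin powR_ge0.
rewrite -ge0_integralD//; last 4 first.
  by move=> z _; rewrite -EFinM lee_fin mulr_ge0 ?(ltW k0)// mulr_ge0 ?powR_ge0// ltW.
  by apply: measurable_funeM.
  by move=> z _; rewrite -EFinM lee_fin mulr_ge0 ?powR_ge0.
  by apply: measurable_funeM.
apply: ge0_le_integral_nomeas => z _; first by rewrite lee_fin.
rewrite -!EFinM -EFinD lee_fin.
exact: weight_Young.
Qed.

End ae_integral.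

(** * Time slices *)

Section time_slices.
Context (R : realType) (n : nat).
Let T := ('rV[R]_n * R)%type.
Let mu := @lebesgue_spacetime R n.
Let RL := measurableTypeR R.
Local Open Scope ereal_scope.

Let pm := @product_measure1 _ _ 'rV[R]_n RL R (lebesgue_rV R n) (@lebesgue_measure R).

Lemma integral_spacetimeRL (f : T -> \bar R) : measurable_fun setT f ->
  \int[mu]_z f z = \int[pm]_z f z.
Proof.
move=> mf; rewrite integralE [RHS]integralE; congr (_ - _);
  apply: ge0_integral_spacetimeRL => //.
- exact: measurable_funepos.
- exact: measurable_funeneg.
Qed.

Let integrableRL (f : T -> R) : mu.-integrable setT (EFin \o f) ->
  pm.-integrable setT (EFin \o f).
Proof.
move=> /integrableP[mf foo]; apply/integrableP; split; first exact: mf.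
move: foo; rewrite ge0_integral_spacetimeRL//.
exact: measurableT_comp.
Qed.

Lemma ae_integrable_slice (f : T -> R) : mu.-integrable setT (EFin \o f) ->
  {ae @lebesgue_measure R, forall t : RL,
    (lebesgue_rV R n).-integrable setT (EFin \o (fun x => f (x, t)))}.
Proof. by move=> /integrableRL/ae_integrable2. Qed.

Lemma Rintegral_slices0 (f : T -> R) : mu.-integrable setT (EFin \o f) ->
  {ae @lebesgue_measure R, forall t : RL, (\int[lebesgue_rV R n]_x f (x, t) = 0)%R} ->
  (\int[mu]_z f z = 0)%R.
Proof.
move=> intf f0; rewrite /Rintegral integral_spacetimeRL; last exact: measurable_int intf.
rewrite -(integral21_prod_meas1 (integrableRL intf)).
rewrite (@eq_integral_ae _ _ _ _ setT _ (cst 0)).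
  by rewrite integral0.
have H := ae_integrable_slice intf.
apply: filterS2 f0 H => t f0 it _.
rewrite /fubini_G /= -[LHS]fineK; last exact: integrable_fin_num it.
by congr (_%:E); exact: f0.
Qed.

(** Tonelli's theorem for the indicator of a measurable null set that contains the exceptions. *)
Lemma ae_slice (P : T -> Prop) : {ae mu, forall z, P z} ->
  {ae @lebesgue_measure R, forall t : RL, {ae lebesgue_rV R n, forall x, P (x, t)}}.
Proof.
move=> [N [mN N0 PN]].
have mi : measurable_fun [set: 'rV[R]_n * R] (EFin \o \1_N : 'rV[R]_n * R -> \bar R).
  by apply/measurable_EFinP; exact: measurable_indic.
have i0 (z : T) : 0 <= (\1_N z : R)%:E by rewrite lee_fin.
have mi' : measurable_fun setT (EFin \o \1_N : 'rV[R]_n * RL -> \bar R) by exact: mi.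
have E : \int[lebesgue_measure]_(t in [set: RL]) `|\int[lebesgue_rV R n]_x (\1_N (x, t))%:E| = 0.
  transitivity (\int[mu]_z (\1_N z)%:E).
    rewrite (ge0_integral_spacetimeRL mi i0).
    rewrite (fubini_tonelli2 _ mi' i0); apply: eq_integral => t _.
    by rewrite gee0_abs// integral_ge0.
  by rewrite integral_indic// setIT.
have mG : measurable_fun setT (fun t : RL => \int[lebesgue_rV R n]_x (\1_N (x, t) : R)%:E).
  exact: (@measurable_fun_fubini_tonelli_G _ _ 'rV[R]_n RL R (lebesgue_rV R n) _ mi' i0).
have := (ae_eq_integral_abs (@lebesgue_measure R) measurableT mG).1 E.
apply: filterS => t /(_ Logic.I) Ht.
exists [set x | N (x, t)]; split.
- rewrite -[X in measurable X]setTI.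
  have mp : measurable_fun setT (fun x : 'rV[R]_n => (x, t : R)).
    by apply: measurable_fun_pair => //; exact: measurable_cst.
  exact: mp.
- transitivity (\int[lebesgue_rV R n]_x (\1_N (x, t) : R)%:E); last exact: Ht.
  rewrite (_ : (fun x => (\1_N (x, t))%:E) = fun x => (\1_[set x | N (x, t)] x)%:E); last first.
    apply/funext => x; rewrite !indicE.
    by have [Nx|Nx] := pselect (N (x, t)); [rewrite !mem_set|rewrite !memNset].
  rewrite integral_indic// ?setIT//.
  rewrite -[X in measurable X]setTI.
  have mp : measurable_fun setT (fun x : 'rV[R]_n => (x, t : R)).
    by apply: measurable_fun_pair => //; exact: measurable_cst.
  exact: mp.
- by move=> x Px; apply: PN.
Qed.

End time_slices.

Lemma Rintegral_ae_restrict d (T : measurableType d) (R : realType)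
    (mu : {measure set T -> \bar R}) (D : set T) (f g : T -> R) :
  (forall z, ~ D z -> g z = 0) -> {ae mu, forall z, D z -> f z = g z} ->
  \int[mu]_z g z = \int[mu]_(z in D) f z.
Proof.
move=> g0 fg; rewrite [RHS](_ : _ = \int[mu]_(z in D) g z).
  rewrite [RHS]Rintegral_mkcond; congr Rintegral; apply/funext => z.
  by rewrite patchE; case: ifPn => //; rewrite notin_setE => /g0.
congr fine; apply: eq_integral_ae; apply: filterS fg => z + Dz => /(_ Dz) -> //.
Qed.

Section Borel_weak_equations.
Context (R : realType) (n : nat) (r : R) (Omega : set 'rV[R]_n).
Let T := ('rV[R]_n * R)%type.
Let mu := @lebesgue_spacetime R n.
Let X := @coordX R n.
Let I := time_interval 0 r.
Let Q := Omega `*` I.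
Context (u u' : T -> R) (Du G : T -> 'rV[R]_n) (Du' G' : 'I_n -> T -> R).
Hypothesis u'0 : forall z, ~ Q z -> u' z = 0.
Hypothesis Du'0 : forall i z, ~ Q z -> Du' i z = 0.
Hypothesis G'0 : forall i z, ~ Q z -> G' i z = 0.
Hypothesis uu' : {ae mu, forall z, Q z -> u z = u' z}.
Hypothesis DuDu' : forall i, {ae mu, forall z, Q z -> Du z ord0 i = Du' i z}.
Hypothesis GG' : forall i, {ae mu, forall z, Q z -> G z ord0 i = G' i z}.

Section product_test.
Context (f : option 'I_n -> R -> R) (lo hi : option 'I_n -> R).
Hypothesis ef : forall j, elementary (f j).
Hypothesis f_supp : forall j y, f j y != 0 -> lo j <= y <= hi j.
Hypothesis box_Q : forall z, (forall j, lo j <= X j z <= hi j) -> Q z.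

Let coordX_e0 (i : 'I_n) j : X j (delta_mx ord0 i, 0) = (j == Some i)%:R.
Proof. by case: j => [j|]//=; rewrite mxE eqxx. Qed.

Let coordX_01 j : X j (0, 1) = (j == None)%:R.
Proof. by case: j => [j|]//=; rewrite mxE. Qed.

Lemma weak_time_Borel (df : option 'I_n -> R -> R) :
  distributional_solution Q u G ->
  (forall j y, is_derive y (1 : R) (f j) (df j y)) ->
  \int[mu]_z (u' z * (df None (X None z) * \prod_(j | j != None) f j (X j z))) =
  \int[mu]_z (\sum_i G' i z * (df (Some i) (X (Some i) z) *
    \prod_(j | j != Some i) f j (X j z))).
Proof.
move=> [_ sol] dff.
have tf : test_function Q (fun z => \prod_j f j (X j z)).
  apply: (@test_function_prod R _ _ X f lo hi) => //.
  - by move=> j; exact: linear_coordX.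
  - by move=> j; exact: continuous_coordX.
  - exact: compact_spacetime_box.
have D0 z : 'D_(0, 1) (fun z => \prod_j f j (X j z)) z =
    df None (X None z) * \prod_(j | j != None) f j (X j z).
  have [_ ->//] := @is_derive_prod_coord R _ _ X f None (0, 1) z _
    (@linear_coordX R n) coordX_01 (dff None (X None z)).
have Di i z : 'D_(delta_mx ord0 i, 0) (fun z => \prod_j f j (X j z)) z =
    df (Some i) (X (Some i) z) * \prod_(j | j != Some i) f j (X j z).
  have [_ ->//] := @is_derive_prod_coord R _ _ X f (Some i) (delta_mx ord0 i, 0) z _
    (@linear_coordX R n) (coordX_e0 i) (dff (Some i) (X (Some i) z)).
transitivity (\int[mu]_(z in Q) (u z * 'D_(0, 1) (fun z => \prod_j f j (X j z)) z)).
  apply: Rintegral_ae_restrict => [z /u'0 ->|]; first by rewrite mul0r.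
  by apply: filterS uu' => z + Qz => /(_ Qz) ->; rewrite D0.
rewrite (sol _ tf); apply/esym/Rintegral_ae_restrict => [z Qz|].
  by rewrite big1// => i _; rewrite G'0// mul0r.
have : {ae mu, forall z i, Q z -> G z ord0 i = G' i z}.
  exact: filter_forall.
by apply: filterS => z H Qz; apply: eq_bigr => i _; rewrite H// Di.
Qed.

(** The weak gradient is given on almost every time slice only. As the time factor is constant on a
    slice, each slice is tested with the spatial product alone and the result is integrated in
    time. *)
Lemma weak_space_Borel (df : R -> R) (i : 'I_n) :
  mu.-integrable setT (EFin \o u') -> mu.-integrable setT (EFin \o Du' i) ->
  in_L1_W11 I Omega u Du ->
  (forall y, is_derive y (1 : R) (f (Some i)) (df y)) ->
  \int[mu]_z (u' z * (df (X (Some i) z) * \prod_(j | j != Some i) f j (X j z))) =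
  - \int[mu]_z (Du' i z * \prod_j f j (X j z)).
Proof.
move=> iu iDu [aeW _ _] dff.
have bounded_f j : exists2 M : R, 0 <= M & forall y, `|f j y| <= M.
  exact: elementary_bounded (@f_supp j) (ef j).
have edf : elementary df by exact: elementary_derive_ext (ef _) dff.
have [Md Md0 HMd] := elementary_bounded (derive_supp (@f_supp (Some i)) dff) edf.
have bounded_prod (S : Type) (s : seq S) (P : pred S) (h : S -> option 'I_n) (x : S -> R) :
    exists2 M : R, 0 <= M & forall x : S -> R, `|\prod_(j <- s | P j) f (h j) (x j)| <= M.
  pose M j := sval (cid2 (bounded_f j)).
  have [M0 HM] : (forall j, 0 <= M j) /\ forall j y, `|f j y| <= M j.
    by split=> j; rewrite /M; case: cid2.
  exists (\prod_(j <- s | P j) M (h j)) => [|y]; first exact: prodr_ge0.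
  by rewrite normr_prod; apply: ler_prod => j _; rewrite normr_ge0 HM.
pose ph (x : 'rV[R]_n) := \prod_k f (Some k) (x ord0 k).
pose phi (x : 'rV[R]_n) := df (x ord0 i) * \prod_(k | k != i) f (Some k) (x ord0 k).
have [M1 M10 HM1] : exists2 M : R, 0 <= M & forall x, `|ph x| <= M.
  have [M M0 HM] := bounded_prod _ (index_enum 'I_n) xpredT (@Some 'I_n) (fun=> 0).
  by exists M => // x; exact: (HM (x ord0)).
have [M2 M20 HM2] : exists2 M : R, 0 <= M & forall x, `|phi x| <= M.
  have [M M0 HM] := bounded_prod _ (index_enum 'I_n) (fun k => k != i) (@Some 'I_n) (fun=> 0).
  exists (Md * M) => [|x]; first exact: mulr_ge0.
  by rewrite normrM ler_pM//; exact: (HM (x ord0)).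
have [M3 M30 HM3] := bounded_f None.
have E1 z : \prod_j f j (X j z) = f None z.2 * ph z.1 by exact: big_option.
have E2 z : \prod_(j | j != Some i) f j (X j z) =
    f None z.2 * \prod_(k | k != i) f (Some k) (z.1 ord0 k).
  rewrite (big_mkcond (fun j => j != Some i)) big_option /=; congr (_ * _).
  by rewrite [RHS]big_mkcond.
pose a z := f None z.2 * phi z.1; pose b z := f None z.2 * ph z.1.
have mfX j : measurable_fun setT (fun z : T => f j (X j z)).
  apply: (measurableT_comp (f := f j)); last exact: measurable_coordX.
  exact: measurable_elementary.
have mph : measurable_fun setT ph.
  by apply: measurable_prod => k _; apply: (measurableT_comp (f := f (Some k)));
    [exact: measurable_elementary|exact: measurable_coord].
have mphi : measurable_fun setT phi.
  apply: measurable_funM.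
    by apply: (measurableT_comp (f := df));
      [exact: measurable_elementary|exact: measurable_coord].
  under eq_fun do rewrite -big_filter.
  by apply: measurable_prod => k _; apply: (measurableT_comp (f := f (Some k)));
    [exact: measurable_elementary|exact: measurable_coord].
have ma : measurable_fun setT a.
  by apply: measurable_funM; [exact: (mfX None)|exact: measurableT_comp mphi measurable_fst].
have mb : measurable_fun setT b.
  by apply: measurable_funM; [exact: (mfX None)|exact: measurableT_comp mph measurable_fst].
have ia : mu.-integrable setT (EFin \o (fun z => a z * u' z)).
  by apply: (integrable_bounded_mul (M := M3 * M2)) => // z; rewrite normrM ler_pM.
have ib : mu.-integrable setT (EFin \o (fun z => b z * Du' i z)).
  by apply: (integrable_bounded_mul (M := M3 * M1)) => // z; rewrite normrM ler_pM.
(* With both terms under one integral, the identity can be checked slice by slice. *)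
suff H : \int[mu]_z (a z * u' z + b z * Du' i z) = 0.
  move: H; rewrite RintegralD// => /eqP; rewrite addr_eq0 => /eqP H.
  transitivity (\int[mu]_z (a z * u' z)).
    by apply: eq_Rintegral => z _; rewrite E2 mulrC [df _ * _]mulrCA.
  by rewrite H; congr (- _); apply: eq_Rintegral => z _; rewrite E1 mulrC.
apply: Rintegral_slices0.
  exact: (integrableD measurableT ia ib).
have iut := ae_integrable_slice iu; have iDut := ae_integrable_slice iDu.
have uut := ae_slice uu'; have DuDut := ae_slice (DuDu' i).
have FF : Filter (almost_everywhere (@lebesgue_measure R)) by exact: ae_filter_ringOfSetsType.
have aeW_DuDut : {ae @lebesgue_measure R, forall t : measurableTypeR R,
    (I t -> in_W11 Omega (fun x => u (x, t)) (fun x => Du (x, t))) /\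
    {ae lebesgue_rV R n, forall x, Q (x, t) -> Du (x, t) ord0 i = Du' i (x, t)}}.
  by apply: (@filterS2 _ _ FF _ _ _ _ aeW DuDut) => t.
have iut_uut : {ae @lebesgue_measure R, forall t : measurableTypeR R,
    (lebesgue_rV R n).-integrable setT (EFin \o (fun x => u' (x, t))) /\
    {ae lebesgue_rV R n, forall x, Q (x, t) -> u (x, t) = u' (x, t)}}.
  by apply: (@filterS2 _ _ FF _ _ _ _ iut uut) => t.
apply: (@filterS3 _ _ FF _ _ _ _ _ aeW_DuDut iut_uut iDut) => t [Wt Dut'] [ut uut'] Dut.
have R0 : \int[lebesgue_rV R n]_x (0 : R) = 0 by rewrite /Rintegral integral0.
(* Where the time factor vanishes there is nothing to show. Elsewhere [t] lies within its bounds,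
   which is what places the spatial box in [Omega]. *)
have [ft0|ft0] := eqVneq (f None t) 0.
  transitivity (\int[lebesgue_rV R n]_x (0 : R)); last exact: R0.
  by apply: eq_Rintegral => x _; rewrite /a /b /= ft0 !mul0r addr0.
have [It|It] := pselect (I t); last first.
  transitivity (\int[lebesgue_rV R n]_x (0 : R)); last exact: R0.
  apply: eq_Rintegral => x _; have nQ : ~ Q (x, t) by case.
  by rewrite u'0// Du'0// !mulr0 addr0.
have [_ _ W] := Wt It.
have tI := f_supp ft0.
have tph : test_function Omega ph.
  apply: (@test_function_prod R _ _ (fun k (x : 'rV[R]_n) => x ord0 k)
    (fun k => f (Some k)) (fun k => lo (Some k)) (fun k => hi (Some k))) => //.
  - by move=> k c x y; rewrite !mxE.
  - by move=> k; exact: coord_continuous.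
  - by move=> k y; exact: f_supp.
  - exact: compact_rV_box.
  - move=> x xb; have [|Ox _] := @box_Q (x, t); last exact: Ox.
    by move=> [k|] //=; have := xb k; rewrite in_itv.
have Dph x : 'D_(delta_mx ord0 i) ph x = phi x.
  have lX (k : 'I_n) : linear_for *%R (fun x : 'rV[R]_n => x ord0 k).
    by move=> c y y'; rewrite !mxE.
  have Xe (k : 'I_n) : (delta_mx ord0 i : 'rV[R]_n) ord0 k = (k == i)%:R.
    by rewrite mxE eqxx.
  have [_ ->//] := @is_derive_prod_coord R _ _ (fun k (x : 'rV[R]_n) => x ord0 k)
    (fun k => f (Some k)) i (delta_mx ord0 i) x _ lX Xe (dff (x ord0 i)).
have H1 : \int[lebesgue_rV R n]_x (phi x * u' (x, t)) =
    \int[lebesgue_rV R n]_(x in Omega) (u (x, t) * 'D_(delta_mx ord0 i) ph x).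
  apply: Rintegral_ae_restrict => [x Ox|]; first by rewrite u'0 ?mulr0// => -[].
  by apply: filterS uut' => x H Ox; rewrite H// Dph mulrC.
have H2 : \int[lebesgue_rV R n]_x (ph x * Du' i (x, t)) =
    \int[lebesgue_rV R n]_(x in Omega) (Du (x, t) ord0 i * ph x).
  apply: Rintegral_ae_restrict => [x Ox|]; first by rewrite Du'0 ?mulr0// => -[].
  by apply: filterS Dut' => x H Ox; rewrite H// mulrC.
have J1 : (lebesgue_rV R n).-integrable setT (EFin \o (fun x => phi x * u' (x, t))).
  exact: (integrable_bounded_mul (M := M2)).
have J2 : (lebesgue_rV R n).-integrable setT (EFin \o (fun x => ph x * Du' i (x, t))).
  exact: (integrable_bounded_mul (M := M1)).
transitivity (f None t * (\int[lebesgue_rV R n]_x (phi x * u' (x, t)) +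
    \int[lebesgue_rV R n]_x (ph x * Du' i (x, t)))).
  rewrite -RintegralD// -RintegralZl//.
    by apply: eq_Rintegral => x _; rewrite /a /b /=; ring.
  exact: (integrableD measurableT J1 J2).
by rewrite H1 H2 (W _ tph i) addNr mulr0.
Qed.

End product_test.
End Borel_weak_equations.

(** * Parabolic cubes and weights *)

Section parabolic_cubes.
Context (R : realType) (n : nat).
Let T := ('rV[R]_n * R)%type.
Let mu := @lebesgue_spacetime R n.
Let X := @coordX R n.

Lemma measurable_coordX_itv (I : option 'I_n -> interval R) :
  measurable [set z : T | forall i, X i z \in I i].
Proof.
rewrite [X in measurable X](_ : _ = \bigcap_(i in [set: option 'I_n]) (X i @^-1` [set` I i])).
  apply: fin_bigcap_measurable => // i _.
  by rewrite -[Y in measurable Y]setTI; exact: measurable_coordX.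
by apply/seteqP; split => [z H i _ //|z H i]; exact: H.
Qed.

Lemma pcubeE z s : pcube z s =
  [set y : T | forall i, X i y \in `](X i z - s ^+ pdeg i), (X i z + s ^+ pdeg i)[].
Proof.
apply/seteqP; split => [y [H1 H2] [j|]|y H].
- have := H1 j; rewrite in_itv /= expr1 distrC ltr_norml => /andP[? ?].
  by apply/andP; split; lra.
- by have := H2; rewrite /time_interval /= in_itv.
- split=> [j|].
    have := H (Some j); rewrite in_itv /= expr1 => /andP[? ?].
    by rewrite distrC ltr_norml; apply/andP; split; lra.
  by have := H None; rewrite /time_interval /= in_itv.
Qed.

Lemma measurable_pcube z s : measurable (pcube z s : set T).
Proof. by rewrite pcubeE; exact: measurable_coordX_itv. Qed.

Lemma lebesgue_pcube z s : 0 < s ->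
  mu (pcube z s) = (\prod_(i : option 'I_n) (2 * s ^+ pdeg i))%:E.
Proof.
move=> s0; rewrite pcubeE; apply: lebesgue_spacetime_prod => i.
have : 0 < s ^+ pdeg i by rewrite exprn_gt0.
rewrite lebesgue_measure_itv/= lte_fin => p0.
by rewrite ifT -?EFinD; [congr (_%:E); lra|lra].
Qed.

Lemma prod_pdeg_gt0 (s : R) : 0 < s -> 0 < \prod_(i : option 'I_n) (2 * s ^+ pdeg i) :> R.
Proof. by move=> s0; apply: prodr_gt0 => i _; rewrite mulr_gt0// exprn_gt0. Qed.

Definition corner_center (a : option 'I_n -> R) (s : R) : T :=
  (\row_j (a (Some j) + s), a None + s ^+ 2).

(** The A_p condition speaks of open cubes and the bisection of half-open ones; they are nested and
    have the same finite measure. *)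
Lemma integral_pcorner a s (f : T -> \bar R) : 0 < s ->
  (\int[mu]_(z in pcorner X (@pdeg n) a s) f z =
   \int[mu]_(z in pcube (corner_center a s) s) f z)%E.
Proof.
move=> s0.
have Xc i : X i (corner_center a s) = a i + s ^+ pdeg i.
  by case: i => [j|] //=; rewrite mxE expr1.
have sub : pcube (corner_center a s) s `<=` pcorner X (@pdeg n) a s.
  rewrite pcubeE => y H i; have := H i; rewrite in_itv /= Xc => /andP[? ?].
  by apply/andP; split; lra.
have mc : measurable (pcorner X (@pdeg n) a s).
  by apply: measurable_cbox => i; exact: measurable_coordX.
have mp := measurable_pcube (corner_center a s) s.
have E : mu (pcorner X (@pdeg n) a s) = (\prod_(i : option 'I_n) (2 * s ^+ pdeg i))%:E.
  apply: lebesgue_spacetime_cbox => i; rewrite mulr_ge0// exprn_ge0// ltW//.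
apply: eq_integral_set_ae.
have -> : pcube (corner_center a s) s `\` pcorner X (@pdeg n) a s = set0.
  by apply/seteqP; split => // y [/sub].
rewrite setU0; apply/negligibleP; first exact: measurableD.
have L : (mu (pcorner X (@pdeg n) a s) < +oo)%E by rewrite E ltry.
have := measureD (mu := mu) mc mp L; rewrite (setIidr sub) => H.
apply: eq_trans H _.
transitivity (mu (pcorner X (@pdeg n) a s) - mu (pcube (corner_center a s) s))%E => //.
by rewrite E [mu (pcube _ _)]lebesgue_pcube// subee.
Qed.

End parabolic_cubes.

Section Borel_weight.
Context (R : realType) (n : nat) (p A : R) (w : 'rV[R]_n * R -> R).
Let T := ('rV[R]_n * R)%type.
Let mu := @lebesgue_spacetime R n.
Let X := @coordX R n.
Hypothesis p_gt1 : 1 < p.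
Hypothesis Apw : Ap_weight p w.
Hypothesis ApA : Ap_const p w = A%:E.

Let w_ge0 z : 0 <= w z. Proof. by case: Apw => -[_ + _] _ _; apply. Qed.

Let w_lty z s : 0 < s -> (\int[mu]_(y in pcube z s) (w y)%:E < +oo)%E.
Proof.
move=> s0; case: Apw => -[_ _ wK] _ _.
apply: le_lt_trans (wK _ (@compact_spacetime_box R n (fun i => X i z - s ^+ pdeg i)
  (fun i => X i z + s ^+ pdeg i))).
rewrite integral_mkcond [leRHS]integral_mkcond.
apply: ge0_le_integral_nomeas => y _.
  by rewrite patchE; case: ifP; rewrite ?lee_fin.
rewrite !patchE; case: ifPn => [|_]; last by case: ifP; rewrite ?lee_fin.
rewrite inE pcubeE => H; rewrite mem_set// => i; have := H i.
by rewrite !in_itv /= => /andP[/ltW -> /ltW ->].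
Qed.

Let imu_gt0 z s : 0 < s -> 0 < (fine (mu (pcube z s)))^-1.
Proof. by move=> s0; rewrite [mu _]lebesgue_pcube// invr_gt0; exact: prod_pdeg_gt0. Qed.

Let dual_lty z s : 0 < s -> (\int[mu]_(y in pcube z s) dual_weight p w y < +oo)%E.
Proof.
move=> s0; case: Apw => _ /(_ z s s0) + _; rewrite /mean.
rewrite !ltey; apply: contra_neq => ->.
by rewrite gt0_muley// lte_fin; exact: imu_gt0.
Qed.

(** A Borel version of [w] can be nonpositive somewhere. There the dual weight is infinite almost
    everywhere, while its integral over every cube is finite; so this set is null, and the value 1
    is put on it. *)
Lemma weight_Borel : exists w' : T -> R,
  [/\ measurable_fun setT w', forall z, 0 < w' z & {ae mu, forall z, w z = w' z}].
Proof.
case: Apw => -[[g mg wg] _ _] _ _.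
pose Z := [set z | g z <= 0].
have mZ : measurable Z.
  have := mg measurableT [set` `]-oo, 0]] (measurable_itv _); rewrite setTI.
  by congr measurable; apply/seteqP; split => z /=; rewrite in_itv.
have Z0 k : mu (Z `&` pcube 0 k.+1%:R) = 0%E.
  set P := pcube 0 k.+1%:R; have mP : measurable P by exact: measurable_pcube.
  have mZP : measurable (Z `&` P) by exact: measurableI.
  have k0 : 0 < k.+1%:R :> R by rewrite ltr0n.
  have H : (\int[mu]_(z in P) (if (g z <= 0)%R then +oo else 0) < +oo)%E.
    rewrite (_ : (\int[mu]_(z in P) _ = \int[mu]_(z in P) (if (w z == 0)%R then +oo else 0))%E).
      apply: le_lt_trans (dual_lty 0 k0); apply: ge0_le_integral_nomeas => z _.
        by case: ifP.
      by rewrite /dual_weight; case: ifP => // _; rewrite lee_fin powR_ge0.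
    apply: eq_integral_ae; apply: filterS wg => z + _ => /(_ Logic.I) <-.
    by rewrite eq_le w_ge0 andbT.
  have H' : (\int[mu]_(z in Z `&` P) cst +oo z < +oo)%E.
    apply: le_lt_trans H; rewrite setIC integral_mkcondr le_eqVlt; apply/orP; left; apply/eqP.
    apply: eq_integral => z _; rewrite patchE; case: ifPn; rewrite ?inE ?notin_setE /=.
      by rewrite /Z /= => ->.
    by move=> /negP/negbTE ->.
  apply/eqP; rewrite eq_le measure_ge0 andbT leNgt; apply/negP => mu0.
  by move: H'; rewrite integral_cst// gt0_mulye.
have nZ : mu.-negligible Z.
  (* Cubes of integer radius around the origin exhaust space-time. *)
  apply: (negligibleS (A := \bigcup_k (Z `&` pcube 0 k.+1%:R))) => [z Zz|].
    have [m Hm] : exists m : nat, forall i, `|X i z| < m.+1%:R ^+ pdeg i.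
      pose M := \sum_i `|X i z|.
      exists (Num.bound M) => i.
      have XM : `|X i z| <= M by rewrite /M (bigD1 i)//= lerDl sumr_ge0.
      have M0 : 0 <= M by rewrite sumr_ge0.
      rewrite (le_lt_trans XM)// (lt_le_trans (archi_boundP M0))//.
      rewrite (le_trans (y := (Num.bound M).+1%:R))// ?ler_nat//.
      by case: (i) => [j|]; rewrite /= ?expr1// expr2 ler_peMr// ler1n.
    exists m => //; split=> //; rewrite pcubeE => i.
    have X0 : coordX i (0 : T) = 0 by case: (i) => [j|]//=; rewrite mxE.
    by rewrite X0 sub0r add0r in_itv /= -ltr_norml; exact: Hm.
  apply: negligible_bigcup => k; apply/negligibleP => //.
  by apply: measurableI => //; exact: measurable_pcube.
exists (fun z => if 0 < g z then g z else 1); split.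
- apply: measurable_fun_if => //.
  + by apply: measurable_fun_ltr.
  + exact: measurable_funTS.
- by move=> z; case: ifP.
have : mu.-negligible (~` [set z | setT z -> w z = g z] `|` Z) by exact: negligibleU.
apply: negligibleS => z /= H; apply: contrapT => /not_orP[/contrapT wz Zz]; apply: H.
by rewrite ifT; [exact: wz|rewrite ltNge; exact/negP].
Qed.

Context (w' : T -> R).
Hypothesis w'_gt0 : forall z, 0 < w' z.
Hypothesis ww' : {ae mu, forall z, w z = w' z}.

Let int_w' (D : set T) : (\int[mu]_(z in D) (w' z)%:E = \int[mu]_(z in D) (w z)%:E)%E.
Proof. by apply: eq_integral_ae; apply: filterS ww' => z ->. Qed.

Let int_dual (D : set T) : (\int[mu]_(z in D) (w' z `^ (- (p - 1)^-1))%:E =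
  \int[mu]_(z in D) dual_weight p w z)%E.
Proof.
apply: eq_integral_ae; apply: filterS ww' => z wz _.
by rewrite /dual_weight wz gt_eqF.
Qed.

Lemma weight_Borel_lty a t : 0 < t ->
  (\int[mu]_(z in pcorner X (@pdeg n) a t) (w' z)%:E < +oo)%E.
Proof. by move=> t0; rewrite integral_pcorner// int_w' w_lty. Qed.

Lemma dual_Borel_lty a t : 0 < t ->
  (\int[mu]_(z in pcorner X (@pdeg n) a t) (w' z `^ (- (p - 1)^-1))%:E < +oo)%E.
Proof. by move=> t0; rewrite integral_pcorner// int_dual dual_lty. Qed.

(** The A_p condition multiplied by m^p: the normalisations of the two averages contribute m^-1 and
    m^-(p-1). *)
Lemma weight_Borel_Ap a t : 0 < t ->
  (\int[mu]_(z in pcorner X (@pdeg n) a t) w' z) *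
  (\int[mu]_(z in pcorner X (@pdeg n) a t) w' z `^ (- (p - 1)^-1)) `^ (p - 1) <=
  A * (\prod_(i : option 'I_n) (2 * t ^+ pdeg i)) `^ p.
Proof.
move=> t0.
set W := \int[mu]_(z in _) _; set S := \int[mu]_(z in _) _; set m := \prod_i _.
have m0 : 0 < m by exact: prod_pdeg_gt0.
pose c := corner_center a t.
have WE : (\int[mu]_(z in pcube c t) (w z)%:E = W%:E)%E.
  rewrite -int_w' -integral_pcorner// /W /Rintegral fineK// ge0_fin_numE ?weight_Borel_lty//.
  by apply: integral_ge0 => z _; rewrite lee_fin ltW.
have SE : (\int[mu]_(z in pcube c t) dual_weight p w z = S%:E)%E.
  rewrite -int_dual -integral_pcorner// /S /Rintegral fineK// ge0_fin_numE ?dual_Borel_lty//.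
  by apply: integral_ge0 => z _; rewrite lee_fin powR_ge0.
have W0 : 0 <= W by apply: Rintegral_ge0 => z _; exact: ltW.
have S0 : 0 <= S by apply: Rintegral_ge0 => z _; exact: powR_ge0.
have H : (((m^-1 * W) * (m^-1 * S) `^ (p - 1))%R%:E <= A%:E)%E.
  rewrite -ApA; apply: ereal_sup_ubound; exists (c, t) => //=.
  by rewrite /mean /= WE SE lebesgue_pcube//= -!EFinM poweR_EFin.
have {}H : (m^-1 * W) * (m^-1 * S) `^ (p - 1) <= A by rewrite -lee_fin.
rewrite powRM ?invr_ge0 ?(ltW m0)// in H.
have mp : m `^ p = m * m `^ (p - 1) by rewrite mulr_powRB1 ?(ltW m0)// (lt_trans ltr01).
have mp0 : 0 < m `^ (p - 1) by rewrite powR_gt0.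
rewrite mp -ler_pdivrMr ?mulr_gt0//; apply: le_trans H.
rewrite le_eqVlt; apply/orP; left; apply/eqP.
have -> : m^-1 `^ (p - 1) = (m `^ (p - 1))^-1.
  by rewrite -powRN -powR_inv1 ?(ltW m0)// -powRrM mulN1r.
by field; rewrite !gt_eqF.
Qed.

End Borel_weight.

Section cubes_and_balls.
Context (R : realType) (n : nat) (domain : R -> set 'rV[R]_n).
Hypothesis n_gt0 : (0 < n)%N.
Hypothesis domainE : domain = cube 0 \/ domain = eball 0.
Let T := ('rV[R]_n * R)%type.
Let mu := @lebesgue_spacetime R n.
Let X := @coordX R n.
Context (r : R).
Hypothesis r_gt0 : 0 < r.
Let Q : set T := domain r `*` time_interval 0 r.

Let cubeP y : cube 0 r y <-> forall i : 'I_n, `|y ord0 i| < r.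
Proof. by split=> H i; have := H i; rewrite mxE sub0r normrN. Qed.

Let eballP y : eball 0 r y <-> \sum_(i < n) y ord0 i ^+ 2 < r ^+ 2.
Proof.
rewrite /eball /= /enorm sub0r.
have -> : \sum_(i < n) (- y) ord0 i ^+ 2 = \sum_(i < n) y ord0 i ^+ 2.
  by apply: eq_bigr => i _; rewrite mxE sqrrN.
have S0 : 0 <= \sum_(i < n) y ord0 i ^+ 2 by apply: sumr_ge0 => i _; exact: sqr_ge0.
by rewrite -[in X in _ <-> X](sqr_sqrtr S0) ltr_pXn2r ?nnegrE ?sqrtr_ge0 ?(ltW r_gt0).
Qed.

Let timeP t : time_interval 0 r t <-> `|t| < r ^+ 2.
Proof. by rewrite /time_interval /= in_itv /= sub0r add0r -ltr_norml. Qed.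

Let domain_cube y : domain r y -> forall i, `|y ord0 i| < r.
Proof.
case: domainE => ->; first by move/cubeP.
move/eballP => H i; rewrite -(ltr_pXn2r (n := 2)) ?nnegrE ?(ltW r_gt0)//.
rewrite real_normK ?num_real//; apply: le_lt_trans H.
by rewrite (bigD1 i)//= lerDl sumr_ge0// => j _; exact: sqr_ge0.
Qed.

Lemma measurable_domain : measurable (domain r).
Proof.
case: domainE => ->.
  rewrite (_ : cube 0 r = \bigcap_(i in [set: 'I_n])
      ((fun y : 'rV[R]_n => y ord0 i) @^-1` [set` `](- r), r[])).
    apply: fin_bigcap_measurable => // i _.
    by rewrite -[Y in measurable Y]setTI; exact: measurable_coord.
  apply/seteqP; split=> [y /cubeP H i _ /=|y H]; first by rewrite in_itv /= -ltr_norml.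
  by apply/cubeP => i; have := H i Logic.I; rewrite /= in_itv /= -ltr_norml.
rewrite (_ : eball 0 r = (fun y : 'rV[R]_n => \sum_(i < n) y ord0 i ^+ 2) @^-1`
    [set` `]-oo, (r ^+ 2)[]).
  rewrite -[Y in measurable Y]setTI.
  have ms : measurable_fun setT (fun y : 'rV[R]_n => \sum_(i < n) y ord0 i ^+ 2).
    apply: measurable_sum => i; apply: measurable_funX; exact: measurable_coord.
  exact: ms.
by apply/seteqP; split=> y; [move/eballP|move=> H; apply/eballP; move: H]; rewrite /= in_itv.
Qed.

Lemma measurable_domain_cylinder : measurable Q.
Proof. by apply: measurableX; [exact: measurable_domain|exact: measurable_itv]. Qed.

(* Convexity of the square handles the ball; it needs the strict inequality
   [n * (4 * krho n) ^ 2 < 1]. *)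
Let domain_contract (s : R) (x y : 'rV[R]_n) : 0 < s <= 1 -> domain r x ->
  (forall i, `|y ord0 i| <= (1 - s) * `|x ord0 i| + s * (4 * krho R n * r)) -> domain r y.
Proof.
move=> /andP[s0 s1] Dx H.
have k0 := krho_gt0 R n_gt0; have k8 := krho_le R n_gt0.
set b := 4 * krho R n * r.
have b0 : 0 <= b by rewrite mulr_ge0 ?(ltW r_gt0)// mulr_ge0// ltW.
have br : b < r by rewrite /b gtr_pMl//; lra.
have n1 : 1 <= n%:R :> R by rewrite ler1n.
case: domainE Dx => ->.
  move/cubeP => Dx; apply/cubeP => i; apply: le_lt_trans (H i) _.
  have := Dx i; have : 0 <= `|x ord0 i| by []; rewrite -/b => x0 xr.
  have : (1 - s) * `|x ord0 i| <= (1 - s) * r by rewrite ler_wpM2l ?(ltW xr)// subr_ge0.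
  have : s * b < s * r by rewrite ltr_pM2l.
  lra.
move/eballP => Dx; apply/eballP.
apply: (@le_lt_trans _ _ (\sum_(i < n) ((1 - s) * x ord0 i ^+ 2 + s * b ^+ 2))).
  apply: ler_sum => i _.
  rewrite -[y ord0 i ^+ 2]real_normK ?num_real// -[x ord0 i ^+ 2]real_normK ?num_real//.
  apply: (@le_trans _ _ (((1 - s) * `|x ord0 i| + s * b) ^+ 2)).
    by rewrite lerXn2r ?nnegrE//; exact: le_trans (H i).
  have d0 : 0 <= s * (1 - s) * (`|x ord0 i| - b) ^+ 2.
    by rewrite mulr_ge0 ?sqr_ge0// mulr_ge0 ?(ltW s0)// subr_ge0.
  rewrite -subr_ge0; apply: le_trans d0 _; rewrite le_eqVlt; apply/orP; left; apply/eqP.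
  by ring.
rewrite big_split /= -mulr_sumr sumr_const card_ord -mulr_natr.
have nb : b ^+ 2 * n%:R < r ^+ 2.
  have kn : krho R n * n%:R = 8^-1.
    by rewrite /krho; field; rewrite pnatr_eq0 -lt0n.
  have -> : b ^+ 2 * n%:R = (16 * krho R n * (krho R n * n%:R)) * r ^+ 2.
    by rewrite /b; ring.
  by rewrite kn gtr_pMl ?exprn_gt0//; lra.
have : (1 - s) * (\sum_(i < n) x ord0 i ^+ 2) <= (1 - s) * r ^+ 2.
  by rewrite ler_wpM2l ?(ltW Dx)// subr_ge0.
have : s * (b ^+ 2 * n%:R) < s * r ^+ 2 by rewrite ltr_pM2l.
rewrite mulrA; lra.
Qed.

Let domain0 : domain r 0.
Proof.
case: domainE => ->; first by apply/cubeP => i; rewrite mxE normr0.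
by apply/eballP; rewrite big1 ?exprn_gt0// => i _; rewrite mxE expr0n.
Qed.

Lemma domain_len z : Q z -> forall j, `|X j z| < r ^+ pdeg j.
Proof.
move=> [Dz Iz] [j|]; first by rewrite /= expr1; exact: domain_cube.
exact/timeP.
Qed.

(** In space the coordinates carry different scales between l/2 and l. All of them satisfy the
    weaker condition with contraction factor 1 - l/2 and width 4 krho l/2, which explains the 4 in
    [domain_contract]. Time is a single coordinate and keeps its own scale. *)
Lemma domain_kern (l : R) z y : 0 < l <= 1 -> Q z ->
  (forall j, exists2 s : R, (l / 2) ^+ pdeg j <= s <= l ^+ pdeg j &
     `|X j y| <= (1 - s) * `|X j z| + krho R n * s * r ^+ pdeg j) -> Q y.
Proof.
move=> /andP[l0 l1] [Dz Iz] H.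
have k0 := krho_gt0 R n_gt0; have k8 := krho_le R n_gt0; split.
  apply: (@domain_contract (l / 2) z.1) => //.
    by apply/andP; split; lra.
  move=> i; have [s] := H (Some i); rewrite /= !expr1 => /andP[s1 s2] Hi.
  apply: le_trans Hi _; apply: lerD; first by apply: ler_wpM2r => //; lra.
  rewrite [leRHS](_ : _ = krho R n * (2 * l) * r); last by field.
  by apply: ler_wpM2r; [exact: ltW|apply: ler_wpM2l; [exact: ltW|lra]].
have [s] := H None; rewrite /= => /andP[s1 s2] Hi.
have s0 : 0 < s by apply: lt_le_trans s1; rewrite exprn_gt0// divr_gt0.
have s1' : s <= 1 by apply: le_trans s2 _; rewrite exprn_ile1// ltW.
apply/timeP; apply: le_lt_trans Hi _; move/timeP : Iz => Iz.
have r2 : 0 < r ^+ 2 by rewrite exprn_gt0.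
have : (1 - s) * `|z.2| <= (1 - s) * r ^+ 2 by rewrite ler_wpM2l ?(ltW Iz)// subr_ge0.
have : krho R n * s * r ^+ 2 < s * r ^+ 2.
  by rewrite ltr_pM2r// gtr_pMl//; lra.
lra.
Qed.

Lemma mu_domain_le : (mu Q <= (\prod_(i : option 'I_n) (2 * r ^+ pdeg i))%:E)%E.
Proof.
rewrite -(lebesgue_pcube (n := n) 0 r_gt0); apply: le_measure; rewrite ?inE.
- exact: measurable_domain_cylinder.
- exact: measurable_pcube.
move=> z Qz; rewrite pcubeE => i; have := domain_len Qz i.
have X0 : coordX i (0 : T) = 0 by case: (i) => [j|]//=; rewrite mxE.
by rewrite X0 sub0r add0r in_itv /= -ltr_norml.
Qed.

Lemma domain_pcorner : Q `<=` pcorner X (@pdeg n) (fun i => - r ^+ pdeg i) r.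
Proof.
move=> z Qz i; have := domain_len Qz i; rewrite ltr_norml => /andP[H1 H2].
by apply/andP; split; [exact: ltW|lra].
Qed.

Lemma mu_domain_ge :
  ((\prod_(i : option 'I_n) (2 * (r / (2 * n%:R)) ^+ pdeg i))%:E <= mu Q)%E.
Proof.
have n1 : 1 <= n%:R :> R by rewrite ler1n.
(* This radius is 4 krho r, so [domain_contract] with s = 1 and x = 0 puts the cube inside the
   domain. *)
set s := r / (2 * n%:R).
have s0 : 0 < s by rewrite divr_gt0// mulr_gt0// ltr0n.
have sr : s <= r / 2 by rewrite /s invfM mulrA ler_piMr ?divr_ge0 ?(ltW r_gt0)// invf_le1 ?ltr0n.
rewrite -(lebesgue_pcube (n := n) 0 s0); apply: le_measure; rewrite ?inE.
- exact: measurable_pcube.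
- exact: measurable_domain_cylinder.
move=> z; rewrite pcubeE => H.
have Xs i : `|X i z| < s ^+ pdeg i.
  have X0 : coordX i (0 : T) = 0 by case: (i) => [j|]//=; rewrite mxE.
  by have := H i; rewrite X0 sub0r add0r in_itv /= -ltr_norml.
split.
  apply: (@domain_contract 1 0); rewrite ?ltr01 ?lexx// => i.
  rewrite subrr mul0r add0r mul1r; have := Xs (Some i); rewrite /= expr1 => /ltW.
  move/le_trans; apply; rewrite /s /krho le_eqVlt; apply/orP; left; apply/eqP.
  by field; rewrite pnatr_eq0 -lt0n.
apply/timeP; have := Xs None => /= /lt_le_trans; apply.
rewrite lerXn2r ?nnegrE ?(ltW s0) ?(ltW r_gt0)//.
by apply: le_trans sr _; have := r_gt0; lra.
Qed.

End cubes_and_balls.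

(** * Oscillation around the mean *)

Lemma powRD_le (R : realType) (q x y : R) : 0 <= q -> 0 <= x -> 0 <= y ->
  (x + y) `^ q <= 2 `^ q * (x `^ q + y `^ q).
Proof.
move=> q0 x0 y0; have M0 : 0 <= Num.max x y by rewrite le_max x0.
apply: (@le_trans _ _ ((2 * Num.max x y) `^ q)).
  apply: ge0_ler_powR; rewrite ?nnegrE ?addr_ge0 ?mulr_ge0//.
  by rewrite mulr_natl mulr2n lerD// le_max lexx ?orbT.
rewrite powRM// ler_wpM2l ?powR_ge0// /Order.max.
by case: ifP => _; rewrite ?lerDl ?lerDr powR_ge0.
Qed.

Section oscillation_around_mean.
Context d (T : measurableType d) (R : realType) (mu : {measure set T -> \bar R}).
Context (Q P : set T) (u w : T -> R) (p g A K M m c I : R).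
Hypothesis mQ : measurable Q.
Hypothesis mP : measurable P.
Hypothesis QP : Q `<=` P.
Hypothesis muQ : mu Q = m%:E.
Hypothesis m_gt0 : 0 < m.
Hypothesis M_gt0 : 0 < M.
Hypothesis p_gt1 : 1 < p.
Hypothesis g_gt1 : 1 < g.
Hypothesis A_ge0 : 0 <= A.
Hypothesis K_ge0 : 0 <= K.
Hypothesis mw : measurable_fun setT w.
Hypothesis w_gt0 : forall z, 0 < w z.
Hypothesis sg_lty : (\int[mu]_(z in P) (w z `^ (- (p - 1)^-1))%:E < +oo)%E.
Hypothesis Ap : (\int[mu]_(z in P) w z) *
  (\int[mu]_(z in P) w z `^ (- (p - 1)^-1)) `^ (p - 1) <= A * M `^ p.
Hypothesis RH : (\int[mu]_(z in P) (w z `^ g)%:E <=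
  (K * ((\int[mu]_(z in P) w z) `^ g * M `^ (1 - g)))%:E)%E.
Hypothesis m_u : measurable_fun setT u.
Hypothesis iu : mu.-integrable Q (EFin \o u).
Hypothesis intI : (\int[mu]_(z in Q) (`|u z - c| `^ (p * g) * w z `^ g)%:E = I%:E)%E.

Let q := p * g.
Let p_gt0 : 0 < p. Proof. by rewrite (lt_trans ltr01). Qed.
Let g_gt0 : 0 < g. Proof. by rewrite (lt_trans ltr01). Qed.
Let q_gt0 : 0 < q. Proof. exact: mulr_gt0. Qed.
Let q_ge1 : 1 <= q. Proof. by rewrite -[1]mulr1 ler_pM// ltW. Qed.
Let muQ_lty : (mu Q < +oo)%E. Proof. by rewrite muQ ltry. Qed.

Let I_ge0 : 0 <= I.
Proof.
rewrite -lee_fin -intI; apply: integral_ge0 => z _.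
by rewrite lee_fin mulr_ge0 ?powR_ge0.
Qed.

Let sg (z : T) : R := w z `^ (- (p - 1)^-1).
Let h (z : T) : R := `|u z - c|.

Let mh : measurable_fun setT h.
Proof. by apply: measurableT_comp => //; apply: measurable_funB. Qed.

Let mwg : measurable_fun setT (fun z => w z `^ g).
Proof. exact: measurable_fun_powR. Qed.

Let mE (D : set T) (f : T -> R) : measurable_fun setT f ->
  measurable_fun D (fun z => (f z)%:E).
Proof. by move=> mf; apply/measurable_EFinP; exact: measurable_funTS. Qed.

Let mhp : measurable_fun setT (fun z => h z `^ p * w z).
Proof. by apply: measurable_funM => //; exact: measurable_fun_powR. Qed.

Let mhq : measurable_fun setT (fun z => h z `^ q * w z `^ g).
Proof. by apply: measurable_funM => //; exact: measurable_fun_powR. Qed.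

Let fin_of (D : set T) (f : T -> R) : (forall z, 0 <= f z) ->
  (\int[mu]_(z in D) (f z)%:E < +oo)%E ->
  (\int[mu]_(z in D) (f z)%:E = (\int[mu]_(z in D) f z)%:E)%E.
Proof.
move=> f0 foo; rewrite /Rintegral fineK// ge0_fin_numE//.
by apply: integral_ge0 => z _; rewrite lee_fin.
Qed.

Let hpE z : (h z `^ p * w z) `^ g = h z `^ q * w z `^ g.
Proof. by rewrite powRM ?powR_ge0 ?(ltW (w_gt0 z))// -powRrM. Qed.

Let hp_lty : (\int[mu]_(z in Q) (h z `^ p * w z)%:E < +oo)%E.
Proof.
apply: (@le_lt_trans _ _ (\int[mu]_(z in Q) (1 + h z `^ q * w z `^ g)%:E)%E).
  apply: ge0_le_integral_nomeas => z _; rewrite lee_fin; first by rewrite mulr_ge0 ?powR_ge0// ltW.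
  rewrite -hpE; set x := h z `^ p * w z.
  have x0 : 0 <= x by rewrite mulr_ge0 ?powR_ge0// ltW.
  have [x1|x1] := leP x 1; first by rewrite (le_trans x1)// lerDl powR_ge0.
  by rewrite (le_trans (y := x `^ g)) ?lerDr// -[leLHS](powRr1 x0) ler_powR// ltW.
under eq_integral do rewrite EFinD.
rewrite ge0_integralD//=; last 2 first.
- by move=> z _; rewrite lee_fin mulr_ge0 ?powR_ge0.
- exact: mE.
rewrite integral_cst// mul1e intI muQ -EFinD ltry//.
Qed.

Let N1 := \int[mu]_(z in Q) h z.
Let F1 := \int[mu]_(z in Q) (h z `^ p * w z).
Let S := \int[mu]_(z in Q) sg z.
Let SP := \int[mu]_(z in P) sg z.
Let WP := \int[mu]_(z in P) w z.
Let Wg := \int[mu]_(z in Q) w z `^ g.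

Let Wg_lty : (\int[mu]_(z in Q) (w z `^ g)%:E < +oo)%E.
Proof.
apply: le_lt_trans (ltry _); apply: le_trans RH.
apply: ge0_subset_integral => //; first exact: mE.
by move=> z _; rewrite lee_fin powR_ge0.
Qed.

Let sgQ_lty : (\int[mu]_(z in Q) (sg z)%:E < +oo)%E.
Proof.
apply: le_lt_trans sg_lty; apply: ge0_subset_integral => //.
  by apply: mE; exact: measurable_fun_powR.
by move=> z _; rewrite lee_fin powR_ge0.
Qed.

Let icst : mu.-integrable Q (EFin \o (fun=> c)).
Proof.
apply/integrableP; split; first exact: measurable_cst.
rewrite (eq_integral (cst (`|c|%:E)%E))//.
by rewrite integral_cst// muQ -EFinM ltry.
Qed.

Let iuc : mu.-integrable Q (EFin \o (fun z => u z - c)).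
Proof. exact: (integrableB mQ iu icst). Qed.

Let h_lty : (\int[mu]_(z in Q) (h z)%:E < +oo)%E.
Proof. by have /integrableP[_] := iuc. Qed.

Let S_le : S <= SP.
Proof.
rewrite -lee_fin -!fin_of//; try by move=> z; exact: powR_ge0.
apply: ge0_subset_integral => //.
  by apply: mE; exact: measurable_fun_powR.
by move=> z _; rewrite lee_fin powR_ge0.
Qed.

Let S_ge0 : 0 <= S. Proof. by apply: Rintegral_ge0 => z _; exact: powR_ge0. Qed.
Let WP_ge0 : 0 <= WP. Proof. by apply: Rintegral_ge0 => z _; exact: ltW. Qed.
Let F1_ge0 : 0 <= F1.
Proof. by apply: Rintegral_ge0 => z _; rewrite mulr_ge0 ?powR_ge0// ltW. Qed.
Let N1_ge0 : 0 <= N1. Proof. by apply: Rintegral_ge0 => z _; exact: normr_ge0. Qed.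
Let Wg_ge0 : 0 <= Wg. Proof. by apply: Rintegral_ge0 => z _; exact: powR_ge0. Qed.

Let N1_le : N1 `^ p <= 2 `^ p * (F1 * S `^ (p - 1)).
Proof.
apply: (@weighted_Hoelder _ _ _ mu Q h w p) => //.
- exact: measurable_funTS mh.
- exact: measurable_funTS mw.
- by move=> z; exact: normr_ge0.
- by apply: fin_of => // z; exact: normr_ge0.
- by apply: fin_of hp_lty => z; rewrite mulr_ge0 ?powR_ge0// ltW.
- by apply: fin_of => // z; exact: powR_ge0.
Qed.

(** Hoelder's inequality with exponent [g] and weight 1, whose dual integral is the measure [m]. *)
Let F1_le : F1 `^ g <= 2 `^ g * (I * m `^ (g - 1)).
Proof.
apply: (@weighted_Hoelder _ _ _ mu Q (fun z => h z `^ p * w z) (cst 1) g) => //.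
- exact: measurable_funTS mhp.
- by move=> z; rewrite mulr_ge0 ?powR_ge0// ltW.
- by apply: fin_of hp_lty => z; rewrite mulr_ge0 ?powR_ge0// ltW.
- by rewrite -intI; apply: eq_integral => z _; rewrite mulr1 hpE.
- by under eq_integral do rewrite powR1; rewrite integral_cst// mul1e.
Qed.

Let Wg_le : Wg <= K * (WP `^ g * M `^ (1 - g)).
Proof.
rewrite -lee_fin -fin_of//; last by move=> z; exact: powR_ge0.
apply: le_trans RH; apply: ge0_subset_integral => //; first exact: mE.
by move=> z _; rewrite lee_fin powR_ge0.
Qed.

Let a := m^-1 * \int[mu]_(z in Q) u z.

Let mean_le : `|c - a| <= m^-1 * N1.
Proof.
have -> : c - a = - (m^-1 * \int[mu]_(z in Q) (u z - c)).
  rewrite RintegralB//.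
  rewrite Rintegral_cst// muQ /= mulrBr opprB mulrCA mulVf ?gt_eqF// mulr1.
  by rewrite /a.
rewrite normrN normrM gtr0_norm ?invr_gt0// ler_wpM2l ?invr_ge0 ?(ltW m_gt0)//.
exact: le_normr_Rintegral.
Qed.

(** Hoelder's inequality bounds the displacement of the constant by [F1] and the dual integral [S],
    and then [F1] by [I]. The reverse Hoelder bound on [Wg] brings in the integral of [w], which the
    A_p condition pairs with S^(p-1). The powers of [M] and [m] combine to (M/m)^(q+1-g). *)
Let shift_le : `|c - a| `^ q * Wg <=
  2 `^ (q + g) * K * A `^ g * (M / m) `^ (q + 1 - g) * I.
Proof.
have M0 := ltW M_gt0; have m0 := ltW m_gt0.
have im0 : 0 <= m^-1 by rewrite invr_ge0.
apply: (@le_trans _ _ (m^-1 `^ q * (2 `^ p * (F1 * S `^ (p - 1))) `^ g * Wg)).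
  rewrite ler_wpM2r//.
  apply: (@le_trans _ _ ((m^-1 * N1) `^ q)).
    by apply: ge0_ler_powR; rewrite ?nnegrE ?(ltW q_gt0)// mulr_ge0.
  rewrite (powRM q im0 N1_ge0); apply: ler_wpM2l; first exact: powR_ge0.
  rewrite /q powRrM.
  apply: ge0_ler_powR; rewrite ?nnegrE ?(ltW g_gt0) ?powR_ge0//.
  by rewrite mulr_ge0 ?powR_ge0// mulr_ge0 ?powR_ge0.
have Ap' : WP * S `^ (p - 1) <= A * M `^ p.
  apply: le_trans _ Ap; apply: (ler_wpM2l WP_ge0).
  apply: ge0_ler_powR; [by rewrite subr_ge0 ltW|by rewrite nnegrE| |exact: S_le].
  by rewrite nnegrE; exact: le_trans S_ge0 S_le.
have E1 : (2 `^ p * (F1 * S `^ (p - 1))) `^ g = 2 `^ q * (F1 `^ g * (S `^ (p - 1)) `^ g).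
  by rewrite powRM ?powR_ge0 ?mulr_ge0 ?powR_ge0// -powRrM powRM ?powR_ge0.
rewrite E1.
apply: (@le_trans _ _ (m^-1 `^ q * (2 `^ q * ((2 `^ g * (I * m `^ (g - 1))) * (S `^ (p - 1)) `^ g)) *
    (K * (WP `^ g * M `^ (1 - g))))).
  apply: ler_pM => //; first by rewrite !mulr_ge0 ?powR_ge0.
  rewrite ler_wpM2l ?powR_ge0// ler_wpM2l ?powR_ge0// ler_wpM2r ?powR_ge0//.
rewrite (_ : _ * _ = (2 `^ (q + g) * K * I * (m^-1 `^ q * m `^ (g - 1) * M `^ (1 - g))) *
   (WP * S `^ (p - 1)) `^ g); last first.
  rewrite (powRD (x := 2)) ?pnatr_eq0 ?implybT// (powRM g WP_ge0 (powR_ge0 S (p - 1))).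
  by ring.
apply: (@le_trans _ _ ((2 `^ (q + g) * K * I * (m^-1 `^ q * m `^ (g - 1) * M `^ (1 - g))) *
   (A * M `^ p) `^ g)).
  apply: ler_wpM2l; first by rewrite !mulr_ge0 ?powR_ge0.
  by apply: ge0_ler_powR Ap'; rewrite ?nnegrE ?(ltW g_gt0) ?mulr_ge0 ?powR_ge0.
rewrite (powRM g A_ge0 (powR_ge0 M p)) -(powRrM M) -/q.
have -> : (M / m) `^ (q + 1 - g) = m^-1 `^ q * m `^ (g - 1) * (M `^ (1 - g) * M `^ q).
  rewrite powRM// -powRD ?(gt_eqF M_gt0) ?implybT//.
  have -> : m `^ (g - 1) = m^-1 `^ (1 - g).
    by rewrite -powR_inv1// -powRrM mulN1r opprB.
  rewrite -powRD ?invr_eq0 ?(gt_eqF m_gt0) ?implybT// mulrC.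
  by congr (_ `^ _ * _ `^ _); ring.
by rewrite le_eqVlt; apply/orP; left; apply/eqP; ring.
Qed.

Let powR_dist (x y z : R) : `|x - y| `^ q <= 2 `^ q * (`|x - z| `^ q + `|z - y| `^ q).
Proof.
apply: le_trans (powRD_le (ltW q_gt0) (normr_ge0 (x - z)) (normr_ge0 (z - y))).
apply: ge0_ler_powR; rewrite ?nnegrE ?(ltW q_gt0) ?addr_ge0//.
exact: ler_distD.
Qed.

Let int_dist b : (\int[mu]_(z in Q) (`|u z - b| `^ q * w z `^ g)%:E <=
  (2 `^ q * (I + `|c - b| `^ q * Wg))%:E)%E.
Proof.
apply: (@le_trans _ _ (\int[mu]_(z in Q) ((2 `^ q)%:E *
   ((h z `^ q * w z `^ g)%:E + (`|c - b| `^ q)%:E * (w z `^ g)%:E)))%E).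
  apply: ge0_le_integral_nomeas => z _; first by rewrite lee_fin mulr_ge0 ?powR_ge0.
  rewrite -[leRHS]/((2 `^ q * (h z `^ q * w z `^ g + `|c - b| `^ q * w z `^ g))%:E).
  rewrite lee_fin -mulrDl mulrA ler_wpM2r ?powR_ge0//.
  exact: powR_dist.
rewrite ge0_integralZl//; last 2 first.
- apply: emeasurable_funD; first exact: mE.
  by apply: measurable_funeM; exact: mE.
- move=> z _; rewrite -EFinM -EFinD lee_fin addr_ge0// mulr_ge0 ?powR_ge0//.
have B0 : (0 <= (`|c - b| `^ q)%:E)%E by rewrite lee_fin powR_ge0.
have W0 z : Q z -> (0 <= (w z `^ g)%:E)%E by rewrite lee_fin powR_ge0.
have mW : measurable_fun Q (fun z => (w z `^ g)%:E) by exact: mE.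
rewrite (ge0_integralD mu mQ).
- rewrite (ge0_integralZl mu mQ)//.
  rewrite intI (fin_of _ Wg_lty); last by move=> z; exact: powR_ge0.
  exact: lexx.
- by move=> z _; rewrite lee_fin mulr_ge0 ?powR_ge0.
- exact: mE.
- by move=> z Qz; rewrite mule_ge0// W0.
- exact: measurable_funeM.
Qed.

Lemma oscillation_around_mean :
  (\int[mu]_(z in Q) (`|u z - m^-1 * \int[mu]_(z in Q) u z| `^ (p * g) * w z `^ g)%:E <=
   (2 `^ q * (1 + 2 `^ (q + g) * K * A `^ g * (M / m) `^ (q + 1 - g)) * I)%:E)%E.
Proof.
apply: le_trans (int_dist _) _; rewrite lee_fin -mulrA ler_wpM2l ?powR_ge0//.
by rewrite mulrDl mul1r lerD2l; exact: shift_le.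
Qed.

Lemma powR_weight_lty : (\int[mu]_(z in Q) (`|u z| `^ (p * g) * w z `^ g)%:E < +oo)%E.
Proof.
have := int_dist 0; under eq_integral do rewrite subr0.
by move/le_lt_trans; apply; exact: ltry.
Qed.

End oscillation_around_mean.

(** * Choice of the exponent and of the constants *)

Lemma powR_small_exponent (R : realType) (a b : R) : 1 < a -> 1 < b ->
  exists2 e0, 0 < e0 & forall e, e <= e0 -> a `^ e <= b.
Proof.
move=> a1 b1; have la : 0 < ln a by rewrite ln_gt0.
exists (ln b / ln a) => [|e ele]; first by rewrite divr_gt0// ln_gt0.
have a0 : 0 < a by rewrite (lt_trans ltr01).
have b0 : 0 < b by rewrite (lt_trans ltr01).
by rewrite /powR (gt_eqF a0) -[leRHS](lnK b0) ler_expR -ler_pdivlMr.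
Qed.

Lemma prod_pdegE (R : realType) n (s : R) :
  \prod_(i : option 'I_n) (2 * s ^+ pdeg i) = 2 ^+ n.+1 * s ^+ n.+2.
Proof. by rewrite big_split /= prodr_const card_option card_ord -expr_sum sum_pdeg. Qed.

(** The exponent and the constant are fixed before the weight. Two conditions cap the exponent: [e1]
    serves the stopping argument and [e2] the convergence of the dyadic series. *)
Lemma reverse_Hoelder_exponent (R : realType) (n : nat) (p A : R) :
  1 < p -> 1 <= A -> exists g K : R,
  [/\ 1 < g, 0 <= K, 2 `^ (n.+2%:R * (g - 1)) <= 3 / 2 &
   forall w : 'rV[R]_n * R -> R, measurable_fun setT w -> (forall z, 0 < w z) ->
   (forall a t, 0 < t ->
     (\int[@lebesgue_spacetime R n]_(z in pcorner (@coordX R n) (@pdeg n) a t) (w z)%:E < +oo)%E) ->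
   (forall a t, 0 < t -> (\int[@lebesgue_spacetime R n]_(z in pcorner (@coordX R n) (@pdeg n) a t)
     (w z `^ (- (p - 1)^-1))%:E < +oo)%E) ->
   (forall a t, 0 < t ->
     (\int[@lebesgue_spacetime R n]_(z in pcorner (@coordX R n) (@pdeg n) a t) w z) *
     (\int[@lebesgue_spacetime R n]_(z in pcorner (@coordX R n) (@pdeg n) a t)
       w z `^ (- (p - 1)^-1)) `^ (p - 1) <=
     A * (\prod_(i : option 'I_n) (2 * t ^+ pdeg i)) `^ p) ->
   forall a t, 0 < t ->
     (\int[@lebesgue_spacetime R n]_(z in pcorner (@coordX R n) (@pdeg n) a t) (w z `^ g)%:E <=
      (K * ((\int[@lebesgue_spacetime R n]_(z in pcorner (@coordX R n) (@pdeg n) a t) w z) `^ g *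
         (\prod_(i : option 'I_n) (2 * t ^+ pdeg i)) `^ (1 - g)))%:E)%E].
Proof.
move=> p1 A1.
pose th : R := 4 `^ (- p) / (A * (2 ^+ (\sum_i @pdeg n i)) `^ p).
have th0 : 0 < th.
  by rewrite divr_gt0 ?powR_gt0// mulr_gt0 ?powR_gt0 ?exprn_gt0// (lt_le_trans ltr01).
have [e1 e10 H1] : exists2 e0 : R, 0 < e0 & forall e, e <= e0 -> 4 `^ e <= 1 + th.
  by apply: powR_small_exponent; lra.
have [e2 e20 H2] : exists2 e0 : R, 0 < e0 & forall e, e <= e0 -> (2 `^ n.+2%:R) `^ e <= 3 / 2.
  apply: powR_small_exponent; last by lra.
  by rewrite powR_mulrn// exprn_egt1//; lra.
pose e := Num.min e1 e2.
have e0 : 0 < e by rewrite lt_min e10 e20.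
exists (1 + e), (4 / th ^+ 2); split.
- by rewrite ltrDl.
- by rewrite divr_ge0// exprn_ge0// ltW.
- by rewrite addrAC subrr add0r powRrM H2// ge_min lexx orbT.
move=> w mw w0 w_lty sg_lty Ap a t t0.
have e_small : 4 `^ e <= 1 + th by rewrite H1// ge_min lexx.
have := @reverse_Hoelder _ _ _ (@lebesgue_spacetime R n) _ (@coordX R n) (@pdeg n) None
  (@measurable_coordX R n) (@lebesgue_spacetime_cbox R n) (@coordX_generate R n)
  (@pdeg_gt0 n) t t0 w p A e mw w0 p1 A1 w_lty sg_lty Ap e0 e_small a.
move/le_trans; apply; rewrite lee_fin -/th le_eqVlt; apply/orP; left; apply/eqP.
set W := \int[_]_(z in _) w z; set m := \prod_i _.
have m0 : 0 < m by exact: prod_pdeg_gt0.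
have W0 : 0 <= W by apply: Rintegral_ge0 => z _; exact: ltW.
congr (_ * _); have [->|Wn0] := eqVneq W 0.
  by rewrite mul0r powR0 ?mul0r// gt_eqF// ltr_wpDl.
rewrite (powRM e W0); last by rewrite invr_ge0 ltW.
rewrite mulrA; congr (_ * _).
  by rewrite -[X in X * _](powRr1 W0) -powRD// Wn0 implybT.
rewrite -powR_inv1 ?(ltW m0)// -powRrM; congr (_ `^ _); ring.
Qed.

(** Here [N] stands for r^(n+2) and [m] for the measure of the domain. As 1 - g is negative, the
    upper bound m <= L N gives N^(1-g) <= L^(g-1) m^(1-g); together with the m^-1 of the average
    this makes the m^-g of the right-hand side. The summand 1 keeps the constant positive. *)
Lemma powR_average_bound (R : realType) (p g r N m E J C L : R) :
  0 < p -> 1 < g -> 0 < r -> 0 < N -> 0 < m -> 0 < L -> m <= L * N -> 0 <= E ->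
  0 <= C -> 0 <= J -> J <= C * (r `^ (p * g) * E `^ g * N `^ (1 - g)) ->
  (m^-1 * J) `^ (p * g)^-1 <=
  (C * L `^ (g - 1) + 1) `^ (p * g)^-1 * r * (m^-1 * E) `^ p^-1.
Proof.
move=> p0 g1 r0 N0 m0 L0 mL E0 C0 J0 JC.
have g0 : 0 < g by rewrite (lt_trans ltr01).
have q0 : 0 < p * g by rewrite mulr_gt0.
have im0 : 0 <= m^-1 by rewrite invr_ge0 ltW.
have D0 : 0 <= C * L `^ (g - 1) + 1 by rewrite addr_ge0// mulr_ge0 ?powR_ge0.
have -> : r = (r `^ (p * g)) `^ (p * g)^-1.
  by rewrite -powRrM mulfV ?gt_eqF// powRr1// ltW.
have -> : (m^-1 * E) `^ p^-1 = ((m^-1 * E) `^ g) `^ (p * g)^-1.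
  by rewrite -powRrM; congr (_ `^ _); field; rewrite !gt_eqF.
rewrite -!powRM ?powR_ge0 ?mulr_ge0 ?powR_ge0//.
apply: ge0_ler_powR; rewrite ?nnegrE ?invr_ge0 ?(ltW q0) ?mulr_ge0 ?powR_ge0//.
apply: (@le_trans _ _ (m^-1 * (C * (r `^ (p * g) * E `^ g * N `^ (1 - g))))).
  exact: ler_wpM2l.
rewrite (powRM g im0 E0).
have -> : m^-1 `^ g = m^-1 * m `^ (1 - g).
  rewrite -powR_inv1 ?(ltW m0)// -powRrM mulN1r.
  by rewrite -powRD ?(gt_eqF m0) ?implybT//; congr (_ `^ _); ring.
have key : N `^ (1 - g) <= L `^ (g - 1) * m `^ (1 - g).
  have gm0 : 0 <= g - 1 by rewrite subr_ge0 ltW.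
  have -> : 1 - g = - (g - 1) by ring.
  rewrite !powRN ler_pdivlMr ?powR_gt0// mulrC ler_pdivrMr ?powR_gt0//.
  rewrite -powRM ?(ltW L0) ?(ltW N0)//.
  apply: ge0_ler_powR => //; rewrite nnegrE ?(ltW m0)// mulr_ge0// ltW//.
rewrite (_ : m^-1 * (C * _) = (m^-1 * (r `^ (p * g) * E `^ g)) * (C * N `^ (1 - g))); last by ring.
rewrite [leRHS](_ : _ = (m^-1 * (r `^ (p * g) * E `^ g)) *
  ((C * L `^ (g - 1) + 1) * m `^ (1 - g))); last by ring.
apply: ler_wpM2l; first by rewrite !mulr_ge0 ?powR_ge0.
apply: (@le_trans _ _ (C * (L `^ (g - 1) * m `^ (1 - g)))); first exact: ler_wpM2l.
by rewrite mulrA ler_wpM2r ?powR_ge0// lerDl.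
Qed.

Section Euclidean_norm.
Context (R : realType) (n : nat).

Lemma enorm_ge0 (x : 'rV[R]_n) : 0 <= enorm x. Proof. exact: sqrtr_ge0. Qed.

Lemma normr_coord_le_enorm (x : 'rV[R]_n) i : `|x ord0 i| <= enorm x.
Proof.
rewrite -sqrtr_sqr ler_wsqrtr// (bigD1 i)//= lerDl.
by apply: sumr_ge0 => j _; exact: sqr_ge0.
Qed.

Lemma enorm_le_sum (x : 'rV[R]_n) : enorm x <= \sum_i `|x ord0 i|.
Proof.
have S0 : 0 <= \sum_i `|x ord0 i| by apply: sumr_ge0.
rewrite -[leRHS](ger0_norm S0) -sqrtr_sqr ler_wsqrtr// expr2 mulr_suml.
apply: ler_sum => i _; rewrite -[leLHS]real_normK ?num_real// expr2 ler_wpM2l//.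
by rewrite (bigD1 i)//= lerDl sumr_ge0.
Qed.

Lemma measurable_enorm_row d (T : measurableType d) (f : 'I_n -> T -> R) :
  (forall i, measurable_fun setT (f i)) ->
  measurable_fun setT (fun z => enorm (\row_i f i z)).
Proof.
move=> mf; apply: (measurableT_comp (f := @Num.sqrt R)).
  by apply: continuous_measurable_fun; exact: sqrt_continuous.
apply: measurable_sum => i; under eq_fun do rewrite mxE.
exact: measurable_funX.
Qed.

End Euclidean_norm.

Lemma in_L1_Borel d (T : measurableType d) (R : realType)
    (mu : {measure set T -> \bar R}) (D : set T) (f : T -> R) :
  measurable D -> in_Lp mu 1 D f ->
  exists g : T -> R, [/\ measurable_fun setT g, forall x, ~ D x -> g x = 0,
    {ae mu, forall x, D x -> f x = g x} & mu.-integrable setT (EFin \o g)].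
Proof.
move=> mD [/(ae_measurable_Borel mD)[g [mg g0 fg]] foo]; exists g; split=> //.
apply/integrableP; split; first exact/measurable_EFinP.
apply: le_lt_trans foo.
rewrite (@eq_integral_ae _ _ _ mu D _ (fun z => (`|g z|)%:E)); last first.
  by apply: filterS fg => x + Dx => /(_ Dx) ->; rewrite powRr1.
rewrite [leRHS]integral_mkcond; apply: ge0_le_integral_nomeas => x _ //.
rewrite patchE; case: ifPn => //; rewrite notin_setE => /g0 /= ->.
by rewrite normr0.
Qed.

Unset Implicit Arguments.

Theorem corollary3p10 (R : realType) (n : nat) (p A : R)
    (n_ge1 : (1 <= n)%N) (p_gt1 : 1 < p)
    (domain : R -> set 'rV[R]_n)
    (domainE : domain = cube 0 \/ domain = eball 0) :
  exists delta c gamma : R,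
    [/\ 0 < delta, 0 < c, 1 < gamma
      & gamma < n.+2%:R / n.+1%:R + delta] /\
    forall w : 'rV[R]_n * R -> R,
      Ap_weight p w -> Ap_const p w = A%:E ->
    forall (r : R), 0 < r ->
    forall (u : 'rV[R]_n * R -> R) (Du G : 'rV[R]_n * R -> 'rV[R]_n),
      let mu := @lebesgue_spacetime R n in
      let I := time_interval 0 r in
      let Q := domain r `*` I in
      in_L1_W11 I (domain r) u Du ->
      in_Lpw_rV mu p w Q Du ->
      in_Lpw_rV mu p w Q G ->
      distributional_solution Q u G ->
      in_Lp mu gamma Q (fun z => `|u z| `^ p * w z) /\
      let uQ := fine (mean mu Q (EFin \o u)) in
      (poweR (mean mu Q (fun z => ((`|u z - uQ| `^ p * w z) `^ gamma)%:E))
             (p * gamma)^-1 <=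
       (c * r)%:E *
       poweR (mean mu Q
               (fun z => ((enorm (Du z) `^ p + enorm (G z) `^ p) * w z)%:E))
             p^-1)%E.
Proof.
have p_gt0 : 0 < p by rewrite (lt_trans ltr01).
(* [A] is quantified before any weight and may be any real number, whereas the stopping argument
   wants a constant at least 1. Raising it preserves the A_p inequality. *)
pose A1 := Num.max A 1.
have A1_ge1 : 1 <= A1 by rewrite /A1 le_max lexx orbT.
have A1_ge0 : 0 <= A1 by rewrite (le_trans ler01).
have [g [K [g_gt1 K_ge0 g_small RHall]]] := reverse_Hoelder_exponent n p_gt1 A1_ge1.
have [B B_ge1 HB] := @kfac_bounds R n n_ge1.
have g_gt0 : 0 < g by rewrite (lt_trans ltr01).
pose q := p * g; have q_gt0 : 0 < q by rewrite mulr_gt0.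
pose C1 := 2 * (2 `^ (p * g) * ((n.+1 * n)%:R * B ^+ n.+1) `^ (p * g) *
         (2 `^ (p * g) * K * A1 `^ g) *
         (\prod_(i : option 'I_n) (2 * 6 ^+ pdeg i)) `^ (p * g + (1 - g))) : R.
have C1_ge0 : 0 <= C1 by rewrite !mulr_ge0 ?powR_ge0.
(* The price of replacing the constant by the mean; (2 n)^(n+2) bounds the measure of the enclosing
   parabolic cube relative to that of the domain. *)
pose C2 := 2 `^ q * (1 + 2 `^ (q + g) * K * A1 `^ g * ((2 * n%:R) ^+ n.+2) `^ (q + 1 - g)) : R.
have C2_ge0 : 0 <= C2 by rewrite mulr_ge0 ?powR_ge0// addr_ge0// !mulr_ge0 ?powR_ge0.
(* The last factor comes from (|Du| + |G|)^p <= 2^p (|Du|^p + |G|^p), raised to the power [g]. *)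
pose C3 := C2 * C1 * (2 `^ p) `^ g : R.
have C3_ge0 : 0 <= C3 by exact: mulr_ge0 (mulr_ge0 C2_ge0 C1_ge0) (powR_ge0 _ _).
pose L := 2 ^+ n.+1 : R; have L_gt0 : 0 < L by rewrite exprn_gt0.
have Dc_gt0 : 0 < C3 * L `^ (g - 1) + 1 by rewrite ltr_wpDl// mulr_ge0 ?powR_ge0.
(* With delta and gamma both equal to [g], the condition gamma < (n+2)/(n+1) + delta reduces to the
   positivity of the fraction. *)
exists g, ((C3 * L `^ (g - 1) + 1) `^ (p * g)^-1), g; split.
  split => //; first exact: powR_gt0.
  by rewrite ltrDr divr_gt0.
move=> w Apw ApA r r_gt0 u Du G mu I Q uW [_ LDu] [_ LG] sol.
have mD : measurable (domain r) by exact: measurable_domain.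
have mQ : measurable Q by exact: measurable_domain_cylinder.
have Q_len z : Q z -> forall j, `|coordX j z| <= r ^+ pdeg j.
  by move=> Qz j; rewrite ltW//; exact: (domain_len domainE r_gt0 Qz).
have Q_kern := domain_kern n_ge1 domainE r_gt0.
have [w' [mw' w'_gt0 ww']] := weight_Borel Apw.
have w'_lty := weight_Borel_lty Apw ww'.
have sg_lty := dual_Borel_lty Apw w'_gt0 ww'.
have Ap' a t : 0 < t -> (\int[mu]_(z in pcorner (@coordX R n) (@pdeg n) a t) w' z) *
    (\int[mu]_(z in pcorner (@coordX R n) (@pdeg n) a t) w' z `^ (- (p - 1)^-1)) `^ (p - 1) <=
    A1 * (\prod_(i : option 'I_n) (2 * t ^+ pdeg i)) `^ p.
  move=> t_gt0; apply: le_trans (weight_Borel_Ap p_gt1 Apw ApA w'_gt0 ww' a t_gt0) _.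
  by rewrite ler_wpM2r ?powR_ge0// /A1 le_max lexx.
have RH := RHall w' mw' w'_gt0 w'_lty sg_lty Ap'.
(* The functions [u], [Du] and [G] are replaced by Borel versions that vanish outside [Q], so that
   integrals over [Q] become integrals over space-time. *)
have [u' [mu' u'0 uu' iu']] := in_L1_Borel mQ (let: And3 _ H _ := uW in H).
have LDu1 : in_Lp_rV mu 1 Q Du by case: uW.
have LG1 : in_Lp_rV mu 1 Q G by case: sol.
have [Du' HDu'] := choice (fun i => in_L1_Borel mQ (LDu1 i)).
have [G' HG'] := choice (fun i => in_L1_Borel mQ (LG1 i)).
have mDu' i : measurable_fun setT (Du' i) by case: (HDu' i).
have mG' i : measurable_fun setT (G' i) by case: (HG' i).
have Du'0 i z : ~ Q z -> Du' i z = 0 by case: (HDu' i) => _ + _ _; apply.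
have G'0 i z : ~ Q z -> G' i z = 0 by case: (HG' i) => _ + _ _; apply.
have DuDu' i : {ae mu, forall z, Q z -> Du z ord0 i = Du' i z} by case: (HDu' i).
have GG' i : {ae mu, forall z, Q z -> G z ord0 i = G' i z} by case: (HG' i).
have iDu' i : mu.-integrable setT (EFin \o Du' i) by case: (HDu' i).
have iG' i : mu.-integrable setT (EFin \o G' i) by case: (HG' i).
pose a z := enorm (\row_i Du' i z); pose b z := enorm (\row_i G' i z).
have ma : measurable_fun setT a by exact: measurable_enorm_row.
have mb : measurable_fun setT b by exact: measurable_enorm_row.
have a0 z : 0 <= a z by exact: enorm_ge0.
have b0 z : 0 <= b z by exact: enorm_ge0.
pose H z := a z + b z.
have mH : measurable_fun setT H by exact: measurable_funD.
have H_ge0 z : 0 <= H z by rewrite addr_ge0.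
have enorm00 : enorm (0 : 'rV[R]_n) = 0.
  rewrite /enorm big1 ?sqrtr0// => i _; by rewrite mxE expr0n.
have aQ z : ~ Q z -> a z = 0.
  move=> nQ; rewrite /a (_ : \row_i _ = 0) ?enorm00//.
  by apply/rowP => i; rewrite !mxE Du'0.
have bQ z : ~ Q z -> b z = 0.
  move=> nQ; rewrite /b (_ : \row_i _ = 0) ?enorm00//.
  by apply/rowP => i; rewrite !mxE G'0.
have DuH i z : `|Du' i z| <= H z.
  rewrite (le_trans (y := a z)) ?lerDl//.
  by have := normr_coord_le_enorm (\row_i Du' i z) i; rewrite mxE.
have GH i z : `|G' i z| <= H z.
  rewrite (le_trans (y := b z)) ?lerDr//.
  by have := normr_coord_le_enorm (\row_i G' i z) i; rewrite mxE.
have iH : mu.-integrable setT (EFin \o H).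
  have isum (F : 'I_n -> 'rV[R]_n * R -> R) : (forall i, mu.-integrable setT (EFin \o F i)) ->
      (forall i, measurable_fun setT (F i)) ->
      mu.-integrable setT (EFin \o (fun z => enorm (\row_i F i z))).
    move=> iF mF.
    have iS : mu.-integrable setT (fun z => (\sum_i (`|F i z|)%:E)%E).
      by apply: integrable_sum => // i _; exact: integrable_norm (iF i).
    apply: le_integrable iS => //.
      by apply/measurable_EFinP; exact: measurable_enorm_row.
    move=> z _; rewrite sumEFin /= lee_fin ger0_norm ?enorm_ge0//.
    rewrite (le_trans (enorm_le_sum _))// (le_trans _ (ler_norm _))//.
    by apply: ler_sum => i _; rewrite mxE.
  exact: (integrableD measurableT (isum _ iDu' mDu') (isum _ iG' mG')).
pose e z := (a z `^ p + b z `^ p) * w' z.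
have e0 z : 0 <= e z by rewrite mulr_ge0 ?addr_ge0 ?powR_ge0 ?(ltW (w'_gt0 z)).
have me : measurable_fun setT e.
  apply: measurable_funM => //; apply: measurable_funD; exact: measurable_fun_powR.
have aeDu : {ae mu, forall z i, Q z -> Du z ord0 i = Du' i z} by exact: filter_forall.
have aeG : {ae mu, forall z i, Q z -> G z ord0 i = G' i z} by exact: filter_forall.
have EE : (\int[mu]_(z in Q) ((enorm (Du z) `^ p + enorm (G z) `^ p) * w z)%:E =
    \int[mu]_(z in Q) (e z)%:E)%E.
  apply: eq_integral_ae; apply: filterS3 aeDu aeG ww' => z Dz Gz wz Qz.
  rewrite /e /a /b wz.
  have -> : \row_i Du' i z = Du z by apply/rowP => i; rewrite mxE Dz.
  by have -> : \row_i G' i z = G z by apply/rowP => i; rewrite mxE Gz.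
have E_lty : (\int[mu]_(z in Q) (e z)%:E < +oo)%E.
  rewrite (_ : (fun z => (e z)%:E) = fun z => ((a z `^ p * w' z)%:E + (b z `^ p * w' z)%:E)%E); last first.
    by apply/funext => z; rewrite /e mulrDl.
  rewrite (ge0_integralD mu mQ); first apply: lte_add_pinfty.
  - apply: le_lt_trans LDu; rewrite le_eqVlt; apply/orP; left; apply/eqP.
    apply: eq_integral_ae; apply: filterS2 aeDu ww' => z Dz wz Qz; rewrite /a wz.
    by have -> : \row_i Du' i z = Du z by apply/rowP => i; rewrite mxE Dz.
  - apply: le_lt_trans LG; rewrite le_eqVlt; apply/orP; left; apply/eqP.
    apply: eq_integral_ae; apply: filterS2 aeG ww' => z Gz wz Qz; rewrite /b wz.
    by have -> : \row_i G' i z = G z by apply/rowP => i; rewrite mxE Gz.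
  - by move=> z _; rewrite lee_fin mulr_ge0 ?powR_ge0// ltW.
  - apply/measurable_EFinP/measurable_funTS; apply: measurable_funM => //.
    exact: measurable_fun_powR.
  - by move=> z _; rewrite lee_fin mulr_ge0 ?powR_ge0// ltW.
  - apply/measurable_EFinP/measurable_funTS; apply: measurable_funM => //.
    exact: measurable_fun_powR.
pose E := \int[mu]_(z in Q) e z.
have EfE : (\int[mu]_(z in Q) (e z)%:E = E%:E)%E.
  by rewrite /E /Rintegral fineK// ge0_fin_numE// integral_ge0// => z _; rewrite lee_fin.
have E_ge0 : 0 <= E by apply: Rintegral_ge0.
have HpE : (\int[mu]_z (H z `^ p * w' z)%:E <= (2 `^ p * E)%:E)%E.
  have me' : measurable_fun Q (fun z => (e z)%:E).
    by apply/measurable_EFinP; exact: measurable_funTS.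
  have e0' z : Q z -> (0 <= (e z)%:E)%E by rewrite lee_fin.
  have k0 : (0 <= (2 `^ p : R)%:E)%E by rewrite lee_fin powR_ge0.
  rewrite EFinM -EfE -(ge0_integralZl mu mQ me' e0' k0).
  rewrite [leRHS]integral_mkcond; apply: ge0_le_integral_nomeas => z _.
    by rewrite lee_fin mulr_ge0 ?powR_ge0// ltW.
  rewrite patchE; case: ifPn => [_|]; last first.
    by rewrite notin_setE => nQ; rewrite /H aQ// bQ// addr0 powR0 ?mul0r// gt_eqF.
  rewrite -EFinM lee_fin /e mulrA ler_wpM2r ?(ltW (w'_gt0 z))//.
  exact: powRD_le (ltW p_gt0) (a0 z) (b0 z).
pose F := fine (\int[mu]_z (H z `^ p * w' z)%:E).
have HF : (\int[mu]_z (H z `^ p * w' z)%:E = F%:E)%E.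
  rewrite /F fineK// ge0_fin_numE; first exact: le_lt_trans HpE (ltry _).
  by apply: integral_ge0 => z _; rewrite lee_fin mulr_ge0 ?powR_ge0// ltW.
have F_le : F <= 2 `^ p * E by rewrite -lee_fin -HF.
have F_ge0 : 0 <= F.
  rewrite -lee_fin -HF; apply: integral_ge0 => z _.
  by rewrite lee_fin mulr_ge0 ?powR_ge0// ltW.
have weak_x f lo hi df i ef fs bQ' dff :=
  @weak_space_Borel R n r (domain r) u u' Du Du' u'0 Du'0 uu' DuDu' f lo hi ef fs bQ'
    df i iu' (iDu' i) uW dff.
have weak_t f lo hi df ef fs bQ' dff :=
  @weak_time_Borel R n r (domain r) u u' G G' u'0 G'0 uu' GG' f lo hi ef fs bQ' df sol dff.
have [c osc] := oscillation_bound n_ge1 r_gt0 mQ Q_len Q_kern mw' w'_gt0 p_gt1 A1_ge0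
  K_ge0 g_gt1 sg_lty Ap' RH g_small mu' mH H_ge0 iH mDu' mG' DuH GH iu' HF weak_x weak_t
  B_ge1 HB.
pose Io := \int[mu]_(z in Q) (`|u' z - c| `^ (p * g) * w' z `^ g).
have IoE : (\int[mu]_(z in Q) (`|u' z - c| `^ (p * g) * w' z `^ g)%:E = Io%:E)%E.
  rewrite /Io /Rintegral fineK// ge0_fin_numE; first exact: le_lt_trans osc (ltry _).
  by apply: integral_ge0 => z _; rewrite lee_fin mulr_ge0 ?powR_ge0.
have Io_le : Io <= C1 * (r `^ (p * g) * F `^ g * (r ^+ n.+2) `^ (1 - g)).
  by rewrite -lee_fin -IoE.
pose N := r ^+ n.+2; have N_gt0 : 0 < N by rewrite exprn_gt0.
have muQ_lty : (mu Q < +oo)%E := le_lt_trans (mu_domain_le domainE r_gt0) (ltry _).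
pose m := fine (mu Q).
have muQ : mu Q = m%:E by rewrite /m fineK// ge0_fin_numE.
pose M := \prod_(i : option 'I_n) (2 * r ^+ pdeg i) : R.
have M_gt0 : 0 < M by exact: prod_pdeg_gt0.
have ME : M = L * N by exact: prod_pdegE.
have m_le : m <= L * N by rewrite -ME -lee_fin -muQ; exact: mu_domain_le.
have n_gt0 : 0 < 2 * n%:R :> R by rewrite mulr_gt0// ltr0n.
have Mm : M <= (2 * n%:R) ^+ n.+2 * m.
  have := mu_domain_ge n_ge1 domainE r_gt0; rewrite -/Q [lebesgue_spacetime _]muQ lee_fin prod_pdegE.
  rewrite expr_div_n mulrA ler_pdivrMr ?exprn_gt0// ME [leRHS]mulrC.
  by [].
have m_gt0 : 0 < m.
  by rewrite -(pmulr_rgt0 _ (exprn_gt0 n.+2 n_gt0)) (lt_le_trans M_gt0).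
have iuQ : mu.-integrable Q (EFin \o u').
  by apply: integrableS iu'.
pose P := pcorner (@coordX R n) (@pdeg n) (fun i => - r ^+ pdeg i) r.
have mP : measurable P by apply: measurable_cbox => i; exact: measurable_coordX.
have QP : Q `<=` P by exact: domain_pcorner.
have meanE (f : 'rV[R]_n * R -> \bar R) (x : R) : (\int[mu]_(z in Q) f z = x%:E)%E ->
    (mean mu Q f = (m^-1 * x)%:E)%E.
  by rewrite /mean => ->.
have uE : (\int[mu]_(z in Q) (u z)%:E = (\int[mu]_(z in Q) u' z)%:E)%E.
  rewrite (@eq_integral_ae _ _ _ mu Q _ (EFin \o u')).
    by rewrite /Rintegral fineK//; exact: integrable_fin_num.
  by apply: filterS uu' => z + Qz => /(_ Qz) ->.
have uQE : fine (mean mu Q (EFin \o u)) = m^-1 * \int[mu]_(z in Q) u' z.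
  by rewrite (meanE _ _ uE).
split.
  split.
    exists (fun z => `|u' z| `^ p * w' z).
      apply: measurable_funTS; apply: measurable_funM => //; apply: measurable_fun_powR.
      exact: measurableT_comp.
    by apply: filterS2 uu' ww' => z uz wz Qz; rewrite uz// wz.
  have := powR_weight_lty mQ mP QP p_gt1 g_gt1 mw' (RH _ _ r_gt0) mu' IoE.
  apply: le_lt_trans; rewrite le_eqVlt; apply/orP; left; apply/eqP.
  apply: eq_integral_ae; apply: filterS2 uu' ww' => z uz wz Qz.
  rewrite uz// wz ger0_norm ?mulr_ge0 ?powR_ge0 ?(ltW (w'_gt0 z))//.
  by rewrite powRM ?powR_ge0 ?(ltW (w'_gt0 z))// -powRrM.
move=> uQ; rewrite /uQ uQE {uQ}; set uQ := m^-1 * _.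
have := oscillation_around_mean mQ mP QP muQ m_gt0 M_gt0 p_gt1 g_gt1 A1_ge0 K_ge0
  mw' w'_gt0 (sg_lty _ _ r_gt0) (Ap' _ _ r_gt0) (RH _ _ r_gt0) mu' iuQ IoE.
rewrite -/uQ => J_le.
pose J := \int[mu]_(z in Q) (`|u' z - uQ| `^ (p * g) * w' z `^ g).
have JE : (\int[mu]_(z in Q) (`|u' z - uQ| `^ (p * g) * w' z `^ g)%:E = J%:E)%E.
  rewrite /J /Rintegral fineK// ge0_fin_numE; first exact: le_lt_trans J_le (ltry _).
  by apply: integral_ge0 => z _; rewrite lee_fin mulr_ge0 ?powR_ge0.
have J_ge0 : 0 <= J by apply: Rintegral_ge0 => z _; rewrite mulr_ge0 ?powR_ge0.
have Io_ge0 : 0 <= Io by apply: Rintegral_ge0 => z _; rewrite mulr_ge0 ?powR_ge0.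
(* A nonnegative exponent is what allows the upper bound on M/m to be raised to it. *)
have q1g : 0 <= q + 1 - g.
  have : g <= q by rewrite /q ler_peMl ?(ltW g_gt0)// ltW.
  by move=> gq; rewrite addrAC addr_ge0 ?subr_ge0.
have {}J_le : J <= C3 * (r `^ (p * g) * E `^ g * N `^ (1 - g)).
  move: J_le; rewrite JE lee_fin => /le_trans; apply.
  apply: (@le_trans _ _ (C2 * Io)).
    apply: ler_wpM2r => //; apply: ler_wpM2l; first exact: powR_ge0.
    rewrite lerD2l; apply: ler_wpM2l; first by rewrite !mulr_ge0 ?powR_ge0.
    apply: ge0_ler_powR => //; rewrite ?nnegrE ?divr_ge0 ?(ltW M_gt0) ?(ltW m_gt0)//.
    by rewrite ler_pdivrMr.
  apply: (@le_trans _ _ (C2 * (C1 * (r `^ (p * g) * (2 `^ p * E) `^ g * N `^ (1 - g))))).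
    apply: ler_wpM2l => //; apply: le_trans Io_le _; apply: ler_wpM2l => //.
    rewrite ler_wpM2r ?powR_ge0// ler_wpM2l ?powR_ge0//.
    by apply: ge0_ler_powR; rewrite ?nnegrE ?(ltW g_gt0) ?mulr_ge0 ?powR_ge0.
  rewrite (powRM g (powR_ge0 2 p) E_ge0) le_eqVlt; apply/orP; left; apply/eqP.
  by rewrite /C3; ring.
have lhsE : (\int[mu]_(z in Q) ((`|u z - uQ| `^ p * w z) `^ g)%:E = J%:E)%E.
  rewrite -JE; apply: eq_integral_ae; apply: filterS2 uu' ww' => z uz wz Qz.
  by rewrite uz// wz powRM ?powR_ge0 ?(ltW (w'_gt0 z))// -powRrM.
have rhsE := eq_trans EE EfE.
rewrite (meanE _ _ lhsE) (meanE _ _ rhsE) !poweR_EFin -EFinM lee_fin.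
exact: (powR_average_bound p_gt0 g_gt1 r_gt0 N_gt0 m_gt0 L_gt0 m_le E_ge0 C3_ge0
  J_ge0 J_le).
Qed.
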